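(* Let $W(\cdot)$ be a sample-path continuous, intrinsically stationary Gaussian random field on $\mathbb{R}^d$ with variogram $\gamma$, mean $0$ and variance $\sigma^2(\cdot)$, such that $$\lim_{|t|\to\infty}\left(W(t)-\frac{\sigma^2(t)}{2}\right)=-\infty\quad\text{almost surely.}$$ Let $W_i^{(j)}(\cdot)$, $i\in\mathbb{N}$, $j\in\mathbb{Z}^d$, be independent copies of $W(\cdot)$ and let $$T_i^{(j)}:=\inf\left(\mathrm{argsup}_{t\in\mathbb{R}^d}\left(W_i^{(j)}(t)-\frac{\sigma^2(t)}{2}\right)\right).$$ Let $m\in\mathbb{N}$, $p\in\mathbb{R}_{>0}^d$, and let $\Pi^{(j)}=\sum_{i\in\mathbb{N}}\delta_{X_i^{(j)}}$, $j\in\mathbb{Z}^d$, be independent Poisson point processes on $\mathbb{R}$, independent of $\{W_i^{(j)}(\cdot):i\in\mathbb{N},j\in\mathbb{Z}^d\}$, each with intensity measure $\frac{1}{m^d}e^{-x}dx$. Then $$Z_3(t):=\max_{j\in\mathbb{Z}^d}\ \max_{\substack{i\in\mathbb{N}\\ T_i^{(j)}\in\left(-\frac{mp}{2},\frac{mp}{2}\right]}}\left(X_i^{(j)}+W_i^{(j)}(t-p\cdot j)-\frac{\sigma^2(t-p\cdot j)}{2}\right),\qquad t\in\mathbb{R}^d,$$ is a Brown-Resnick process associated to the variogram $\gamma$, i.e. $Z_3\stackrel{d}{=}Z$, where $Z$ is the Brown-Resnick process associated to $\gamma$.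
   Context: A random field $W$ on $\mathbb{R}^d$ is intrinsically stationary if for every $h\in\mathbb{R}^d$ the field $\{W(x+h)-W(x):x\in\mathbb{R}^d\}$ is weakly stationary; its (semi-)variogram is $\gamma(h)=\frac12\mathbb{E}(W(h)-W(0))^2$. The Brown-Resnick process associated to $\gamma$ is the process $Z(t)=\max_{i\in\mathbb{N}}\big(X'_i+W'_i(t)-\frac{\sigma^2(t)}{2}\big)$, $t\in\mathbb{R}^d$, where $\sum_i\delta_{X'_i}$ is a Poisson point process on $\mathbb{R}$ with intensity measure $e^{-x}dx$ and $W'_i$ are independent copies of $W$, independent of the $X'_i$. It is a stationary max-stable process with standard Gumbel margins whose law depends only on $\gamma$. The relation $\stackrel{d}{=}$ denotes equality of all finite-dimensional distributions. The product $p\cdot j=(p_1j_1,\ldots,p_dj_d)$ is componentwise, and $\left(-\frac{mp}{2},\frac{mp}{2}\right]$ is the box $\prod_{l=1}^d\left(-\frac{mp_l}{2},\frac{mp_l}{2}\right]$. $\mathrm{argsup}$ denotes the set of points at which the supremum is attained, and $\inf$ of this set is its smallest element (with respect to the lexicographic order if $d>1$). *)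

(* Defs.v *)
From HB Require Import structures.
From mathcomp Require Import all_boot all_order all_algebra.
From mathcomp Require Import all_classical all_reals all_analysis.
From mathcomp Require Import measurable_realfun.

Set Implicit Arguments.
Unset Strict Implicit.
Unset Printing Implicit Defensive.

Import Order.TTheory GRing.Theory Num.Theory.
Import numFieldNormedType.Exports.

Local Open Scope classical_set_scope.
Local Open Scope ring_scope.

Section independence.
Context {dO} {O : measurableType dO} {R : realType} (P : probability O R).

Definition sigma_of {dE} {E : measurableType dE} {K : Type} (D : set K)
    (X : K -> O -> E) : set (set O) :=
  <<s \bigcup_(k in D) preimage_set_system setT (X k) measurable >>.

Definition independent2 (F G : set (set O)) : Prop :=
  forall A B, F A -> G B -> P (A `&` B) = (P A * P B)%E.

Definition mutually_independent {K : choiceType} (F : K -> set (set O)) : Prop :=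
  forall (s : seq K) (A : K -> set O), uniq s ->
    (forall k, k \in s -> F k (A k)) ->
    P (\big[setI/setT]_(k <- s) A k) = (\prod_(k <- s) P (A k))%E.

End independence.

(* Equality of all finite-dimensional distributions; the two fields may live on
   different probability spaces. Measurability of the one-dimensional
   coordinates is part of the definition, since [P] has no prescribed value on
   non-measurable sets. *)
Definition eq_fdd {R : realType} {I : Type} {dE} {E : measurableType dE}
    {d1} {O1 : measurableType d1} (P1 : probability O1 R) (Y1 : I -> O1 -> E)
    {d2} {O2 : measurableType d2} (P2 : probability O2 R) (Y2 : I -> O2 -> E) :
    Prop :=
  [/\ forall t, measurable_fun setT (Y1 t),
      forall t, measurable_fun setT (Y2 t) &
      forall (n : nat) (t : 'I_n -> I) (B : set (n.-tuple E)), measurable B ->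
        P1 [set w | B [tuple Y1 (t k) w | k < n]] =
        P2 [set w | B [tuple Y2 (t k) w | k < n]]].

Section fields.
Context {dO} {O : measurableType dO} {R : realType} (P : probability O R).
Variable d : nat.
Local Notation field := ('rV[R]_d -> {RV P >-> R}).

(* [normal_prob m s] has standard deviation [s]; it is not the Dirac mass when
   [s = 0], so the degenerate case is stated separately. *)
Definition gaussian_variable (X : O -> R) : Prop :=
  (exists m s : R, 0 < s /\
     forall B : set R, measurable B -> P (X @^-1` B) = normal_prob m s B) \/
  (exists m : R,
     forall B : set R, measurable B -> P (X @^-1` B) = \d_m B).

Definition gaussian_field (W : field) : Prop :=
  forall (n : nat) (t : 'I_n -> 'rV[R]_d) (c : 'I_n -> R),
    gaussian_variable (fun w => \sum_(k < n) c k * W (t k) w).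

Definition weakly_stationary (Y : 'rV[R]_d -> O -> R) : Prop :=
  [/\ forall x, Y x \in Lfun P 2%:E,
      forall x y, ('E_P[Y x] = 'E_P[Y y])%E &
      forall x y z, covariance P (Y (x + z)) (Y (y + z)) =
                    covariance P (Y x) (Y y)].

Definition intrinsically_stationary (W : field) : Prop :=
  forall h, weakly_stationary (fun x w => W (x + h) w - W x w).

Definition has_variogram (W : field) (gamma : 'rV[R]_d -> R) : Prop :=
  forall h, (gamma h)%:E =
    (2^-1%:E * 'E_P[fun w => ((W h w - W 0 w) ^+ 2)%R])%E.

Definition has_mean_zero (W : field) : Prop := forall t, ('E_P[W t] = 0)%E.

Definition has_variance (W : field) (sigma2 : 'rV[R]_d -> R) : Prop :=
  forall t, ('V_P[W t] = (sigma2 t)%:E)%E.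

Definition sample_continuous (W : field) : Prop :=
  forall w, continuous (fun t => W t w).

End fields.

Definition independent_copies {R : realType} {d : nat} {K : choiceType}
    {d0} {O0 : measurableType d0} (P0 : probability O0 R)
    (W : 'rV[R]_d -> {RV P0 >-> R})
    {dO} {O : measurableType dO} (P : probability O R)
    (Wf : K -> 'rV[R]_d -> {RV P >-> R}) : Prop :=
  (forall k, eq_fdd P (fun t => Wf k t : O -> R) P0 (fun t => W t : O0 -> R)) /\
  mutually_independent P (fun k => sigma_of setT (fun t => Wf k t : O -> R)).

Section poisson.
Context {dO} {O : measurableType dO} {R : realType} (P : probability O R).
Local Open Scope ereal_scope.

(* The random measure \sum_i \delta_{X_i}, indexed by Borel sets. *)
Definition point_process (X : nat -> {RV P >-> R}) (B : set R) (w : O) :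
  \bar R := mseries (fun i => \d_(X i w)) 0%N B.

Definition poisson_point_process (X : nat -> {RV P >-> R})
    (Lambda : set R -> \bar R) : Prop :=
  [/\ forall (B : set R) (l : R), measurable B -> Lambda B = l%:E ->
        forall k : nat, P [set w | point_process X B w = k%:R%:E] =
                        (l ^+ k / k`!%:R * expR (- l))%:E,
      forall B : set R, measurable B -> Lambda B = +oo ->
        P [set w | point_process X B w = +oo] = 1 &
      forall (n : nat) (B : 'I_n -> set R),
        (forall k, measurable (B k)) -> trivIset setT B ->
        mutually_independent P
          (fun k => sigma_of [set B k] (point_process X))].

Definition exp_intensity (c : R) (B : set R) : \bar R :=
  \int[lebesgue_measure]_(x in B) (c * expR (- x))%:E.

End poisson.

(* [Z] is a Brown-Resnick process associated to the variogram [gamma]: the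
   spectral processes [W i] are i.i.d. copies of some centred, intrinsically
   stationary Gaussian field with variogram [gamma]. *)
Definition brown_resnick_process {R : realType} {d : nat}
    (gamma : 'rV[R]_d -> R)
    {dO} {O : measurableType dO} (P : probability O R)
    (Z : 'rV[R]_d -> O -> \bar R) : Prop :=
  exists (X : nat -> {RV P >-> R}) (W : nat -> 'rV[R]_d -> {RV P >-> R})
         (sigma2 : 'rV[R]_d -> R),
  [/\ [/\ gaussian_field (W 0%N), intrinsically_stationary (W 0%N),
          has_variogram (W 0%N) gamma, has_mean_zero (W 0%N) &
          has_variance (W 0%N) sigma2],
      independent_copies (W 0%N) W,
      poisson_point_process X (exp_intensity 1),
      independent2 P (sigma_of setT (fun i => X i : O -> R))
        (sigma_of setT (fun it : nat * 'rV[R]_d => W it.1 it.2 : O -> R)) &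
      forall t w, Z t w =
        ereal_sup (range (fun i => (X i w + W i t w - sigma2 t / 2)%:E))].

Section argsup.
Context {R : realType} {d : nat}.
Implicit Types (f : 'rV[R]_d -> R) (s t p : 'rV[R]_d).

Definition tends_to_ninfty_at_infinity f : Prop :=
  forall a : R, exists r : R, forall t, r < `|t| -> f t < a.

Definition argsup f : set 'rV[R]_d := [set s | forall t, f t <= f s].


Definition lexi_le s t : bool :=
  (([tuple s ord0 l | l < d] : d.-tuplelexi R) <= [tuple t ord0 l | l < d])%O.

Definition lexi_min (A : set 'rV[R]_d) : set 'rV[R]_d :=
  [set s | A s /\ forall t, A t -> lexi_le s t].

(* inf (argsup f); the default value [0] is taken when the set of maximizers
   has no smallest element. *)
Definition inf_argsup f : 'rV[R]_d := xget 0 (lexi_min (argsup f)).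

(* The box (-p/2, p/2]. *)
Definition half_open_box p : set 'rV[R]_d :=
  [set s | forall l, - (p ord0 l / 2) < s ord0 l <= p ord0 l / 2].

Definition lattice_point p (j : 'rV[int]_d) : 'rV[R]_d :=
  \row_l (p ord0 l * (j ord0 l)%:~R).

End argsup.

Definition Z3 {R : realType} {d : nat} {O : Type}
    (sigma2 : 'rV[R]_d -> R) (m : nat) (p : 'rV[R]_d)
    (X : nat -> 'rV[int]_d -> O -> R)
    (W : nat -> 'rV[int]_d -> 'rV[R]_d -> O -> R)
    (t : 'rV[R]_d) (w : O) : \bar R :=
  let T i j := inf_argsup (fun s => W i j s w - sigma2 s / 2) in
  ereal_sup [set y | exists i j,
    T i j \in half_open_box (m%:R *: p) /\
    y = (X i j w + W i j (t - lattice_point p j) w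
         - sigma2 (t - lattice_point p j) / 2)%:E].

(* Main.v *)
Require Import Defs.
From HB Require Import structures.
From mathcomp Require Import all_boot all_order all_algebra.
From mathcomp Require Import finmap.
From mathcomp Require Import all_classical all_reals all_analysis.
From mathcomp Require Import measurable_realfun.
From mathcomp Require Import ring lra.

Set Implicit Arguments.
Unset Strict Implicit.
Unset Printing Implicit Defensive.

Import Order.TTheory GRing.Theory Num.Theory.
Import numFieldNormedType.Exports.
Import HBNNSimple.

Local Open Scope classical_set_scope.
Local Open Scope ring_scope.

(** Write [V = W - sigma2 / 2]. Both [Z] and [Z3] are maxima of spectral values
    carried by Poisson points of exponential intensity. The inequalities
    [Z (t k) <= z k], for all [k], say that no point [x] satisfies
    [exp (- x) < y], where the mark of the point is
    [y = max_k exp (V (t k) - z k)]. Such an event has probability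
    [exp (- c * S)] if the intensity is [c * exp (- x)] and [S] is the sum over
    the processes of the mean marks ([void_probability]), and events of this
    form determine the finite-dimensional distributions
    ([eq_fdd_lower_boxes]). For [Z] the exponent is the mean of
    [max_k exp (V (t k) - z k)] ([brown_resnick_lower_box]).

    For [Z3] the points of the process [j] carry the field at [t k - p * j], and
    their mark vanishes unless the maximizer [T] lies in the box. Under the
    measure with density [exp (V s)] the law of the increments of [V] from [s]
    depends on the variogram only, and not on [s] ([tilted_laplace],
    [tilted_law]). Since adding a constant to a path multiplies its mark by an
    exponential, the mean of a mark is the same for the path and for its
    translates ([drifted_path_shift]). The translation by [p * j] brings the
    points back to [t k] and moves the maximizer to [T - p * j]; for exactly
    [m ^ d] values of [j] this point is in the box ([lattice_count]). Hence the
    mean marks add up to [m ^ d] times the mean of [max_k exp (V (t k) - z k)]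
    ([mark_mean_sum]), and the factor [m ^ d] compensates the intensity
    [m ^- d] ([thinned_lower_box]). What is left is the exponent of [Z], because
    it depends on the field only through the variogram ([max_exp_mean]).

    Three auxiliary results carry this argument. A finite measure on tuples is
    determined by its Laplace transform, if that is finite everywhere
    ([tuple_measure_unique_mgf]); this identifies the laws of the increments.
    The event that the smallest maximizer of a continuous random field lies in
    a box is measurable ([measurable_inf_argsup_in_box]), so that marks are
    random variables on the space of paths. The Laplace functional of
    independent Poisson processes ([laplace_poisson]), with the marks
    integrated out given the points ([independent_marks]), yields the void
    probabilities. *)

(** * Integrals of real functions *)
Section dominated_real.
Context d (T : measurableType d) (R : realType) (mu : {measure set T -> \bar R}).

Lemma integrableRZ (r : R) (f : T -> R) : mu.-integrable setT (EFin \o f) ->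
  mu.-integrable setT (EFin \o (fun x => r * f x)).
Proof.
move=> fi; rewrite (_ : EFin \o _ = (fun x => r%:E * (EFin \o f) x)%E) //.
exact: integrableZl.
Qed.

Lemma integrableRD (f g : T -> R) : mu.-integrable setT (EFin \o f) ->
  mu.-integrable setT (EFin \o g) ->
  mu.-integrable setT (EFin \o (fun x => f x + g x)).
Proof.
move=> fi gi; rewrite (_ : EFin \o _ = ((EFin \o f) \+ (EFin \o g))%E) //.
exact: integrableD.
Qed.

Lemma integrableRB (f g : T -> R) : mu.-integrable setT (EFin \o f) ->
  mu.-integrable setT (EFin \o g) ->
  mu.-integrable setT (EFin \o (fun x => f x - g x)).
Proof.
move=> fi gi; rewrite (_ : EFin \o _ = ((EFin \o f) \- (EFin \o g))%E) //.
exact: integrableB.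
Qed.

Lemma integrable_bounded (f : T -> R) (M : R) : (mu setT < +oo)%E ->
  measurable_fun setT f -> (forall x, `|f x| <= M) ->
  mu.-integrable setT (EFin \o f).
Proof.
move=> mufin mf fM; apply/integrableP; split; first exact/measurable_EFinP.
apply: (@le_lt_trans _ _ (\int[mu]_x (cst M%:E) x)%E).
  apply: ge0_le_integral => //.
  - by apply: measurableT_comp => //; exact/measurable_EFinP.
  - by move=> x _; rewrite lee_fin.
rewrite integral_cst //.
have [M0|M0] := ltP M 0; last by rewrite lte_mul_pinfty // lee_fin.
by rewrite (le_lt_trans _ (ltry 0)) // mule_le0_ge0 // lee_fin ltW.
Qed.

Lemma Rdominated_cvg (f_ : nat -> T -> R) (f g : T -> R) :
  (forall n, measurable_fun setT (f_ n)) ->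
  (forall x, f_ ^~ x @ \oo --> f x) ->
  mu.-integrable setT (EFin \o g) ->
  (forall n x, `|f_ n x| <= g x) ->
  (\int[mu]_x f_ n x)%R @[n --> \oo] --> (\int[mu]_x f x)%R.
Proof.
move=> mf_ f_f ig fg.
have mf : measurable_fun setT f by apply: (measurable_fun_cvg (h := f_)) => // x _; exact: f_f.
have fle x : `|f x| <= g x.
  have /cvg_lim <- // : `|f_ n x| @[n --> \oo] --> `|f x| by exact: cvg_norm.
  apply: limr_le; first by apply/cvg_ex; exists `|f x|; apply: cvg_norm.
  by apply: nearW => n; exact: fg.
have if_ n : mu.-integrable setT (EFin \o f_ n).
  apply: le_integrable ig => //; first exact/measurable_EFinP.
  by move=> x _; rewrite /= lee_fin (le_trans (fg n x)) // ler_norm.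
have iF : mu.-integrable setT (EFin \o f).
  apply: le_integrable ig => //; first exact/measurable_EFinP.
  by move=> x _; rewrite /= lee_fin (le_trans (fle x)) // ler_norm.
apply: fine_cvg; rewrite fineK; last exact: integrable_fin_num.
apply: (@dominated_cvg _ _ _ mu setT measurableT (fun n => EFin \o f_ n) _ (EFin \o g)) => //.
- by move=> n; exact/measurable_EFinP.
- by move=> x _; apply/fine_cvgP; split; [exact: nearW | exact: f_f].
- by move=> n x _; rewrite /= lee_fin.
Qed.

Lemma Rintegral_sum (I : Type) (s : seq I) (f : I -> T -> R) :
  (forall i, mu.-integrable setT (EFin \o f i)) ->
  mu.-integrable setT (EFin \o (fun x => \sum_(i <- s) f i x)) /\
  (\int[mu]_x (\sum_(i <- s) f i x))%R = \sum_(i <- s) (\int[mu]_x f i x)%R.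
Proof.
move=> fi; elim: s => [|i s [IH1 IH2]].
  split.
    rewrite (_ : EFin \o _ = cst 0%E); first exact: integrable0.
    by apply/funext => x /=; rewrite big_nil.
  by rewrite big_nil; under eq_Rintegral do rewrite big_nil; rewrite Rintegral_cst // mul0r.
split.
  under [X in EFin \o X]eq_fun do rewrite big_cons.
  exact: integrableRD.
by rewrite big_cons -IH2 -RintegralD //; apply: eq_Rintegral => x _; rewrite big_cons.
Qed.

End dominated_real.

Lemma Rintegral_probability_cst d (T : measurableType d) (R : realType)
  (P : probability T R) (r : R) : (\int[P]_w r)%R = r.
Proof. by rewrite Rintegral_cst //= (_ : fine (P setT) = 1) ?mulr1 // probability_setT. Qed.

(** * Measures determined by their Laplace transform *)
Section exponential_moments.
Context d (T : measurableType d) (R : realType) (mu : {measure set T -> \bar R}).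
Variable u : T -> R.
Hypothesis mu_u : measurable_fun setT u.
Hypothesis iexp : forall c, mu.-integrable setT (fun x => (expR (c * u x))%:E).

Let g x := expR (u x) + expR (- u x).

Let expR_abs x : expR `|u x| <= g x.
Proof.
rewrite /g; case: (ger0P (u x)) => _; first by rewrite lerDl expR_ge0.
by rewrite lerDr expR_ge0.
Qed.

Let ig : mu.-integrable setT (EFin \o g).
Proof.
have := iexp 1; under eq_fun do rewrite mul1r; move=> h1.
have := iexp (- 1); under eq_fun do rewrite mulN1r; move=> h2.
exact: integrableRD.
Qed.

Let pow_le x k : `|u x| ^+ k / k`!%:R <= expR `|u x|.
Proof.
case: k => [|k]; first by rewrite expr0 fact0 divr1 -expR0 ler_expR.
by apply: le_trans (expR_ge1Dxn k (normr_ge0 (u x))); rewrite lerDr.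
Qed.

Lemma integrable_pow k : mu.-integrable setT (EFin \o (fun x => u x ^+ k)).
Proof.
have := integrableRZ k`!%:R ig.
apply: le_integrable => //; first by apply/measurable_EFinP; exact: measurable_funX.
move=> x _; rewrite /= lee_fin normrX normrM (ger0_norm (ler0n _ _)).
rewrite mulrC -ler_pdivrMr ?ltr0n ?fact_gt0 // (le_trans (pow_le _ _)) //.
by rewrite (le_trans (expR_abs x)) // ler_norm.
Qed.

(** The partial sums of a power series whose coefficients are at most those of
    the exponential are dominated by [expR `|u|], which is integrable. *)
Lemma Rintegral_series (b : nat -> R) (F : R -> R) :
  (forall k, `|b k| <= (k`!%:R)^-1) ->
  (forall y, series (fun k => b k * y ^+ k) @ \oo --> F y) ->
  \sum_(0 <= k < n) b k * (\int[mu]_x (u x ^+ k))%R @[n --> \oo]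
    --> (\int[mu]_x F (u x))%R.
Proof.
move=> hb hF.
have ip k : mu.-integrable setT (EFin \o (fun x => b k * u x ^+ k)).
  exact/integrableRZ/integrable_pow.
have -> : (fun n => \sum_(0 <= k < n) b k * (\int[mu]_x (u x ^+ k))%R) =
          (fun n => \int[mu]_x (\sum_(0 <= k < n) b k * u x ^+ k))%R.
  apply/funext => n; rewrite (Rintegral_sum _ ip).2; apply: eq_bigr => k _.
  by rewrite RintegralZl //; exact: integrable_pow.
apply: (@Rdominated_cvg _ _ _ mu _ _ g) => //.
- move=> n; apply: measurable_sum => k; apply: measurable_funM => //.
  exact: measurable_funX.
- by move=> x; exact: hF.
move=> n x; apply: le_trans (expR_abs x).
apply: (@le_trans _ _ (series (exp_coeff `|u x|) n)).
  rewrite /series /=; apply: le_trans (ler_norm_sum _ _ _) _.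
  apply: ler_sum => k _; rewrite normrM normrX /exp_coeff /= mulrC.
  by rewrite ler_wpM2l // exprn_ge0.
rewrite /expR; apply: nondecreasing_cvgn_le; last exact: is_cvg_series_exp_coeff.
by apply: nondecreasing_series => k _ _; rewrite /exp_coeff /= divr_ge0 // exprn_ge0.
Qed.

End exponential_moments.

(** Dividing by [x ^+ k] and letting [x] tend to [0] isolates the first
    non-vanishing coefficient. *)
Lemma pseries_eq0 (R : realType) (a : nat -> R) :
  (forall x, series (fun k => a k * x ^+ k) @ \oo --> 0) -> forall k, a k = 0.
Proof.
move=> a0.
have [C [C0 aC]] : exists C, 0 < C /\ forall n, `|a n| <= C.
  have /cvg_series_cvg_0 : cvgn (series (fun k => a k * 1 ^+ k)).
    by apply/cvg_ex; exists 0; exact: a0.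
  move=> /cvgP /cvg_seq_bounded [M [Mr hM]].
  exists (Num.max 1 (M + 1)); split; first by rewrite lt_max ltr01.
  move=> n; have := hM (M + 1); rewrite ltrDl ltr01 => /(_ isT n I) /=.
  by rewrite expr1n mulr1 le_max => ->; rewrite orbT.
elim/ltn_ind => k IH; apply/eqP; rewrite -normr_le0.
(* so small that the tail, at most [2 * C * x ^+ k.+1], is half of the
   term of order [k] *)
pose x := `|a k| / (4 * C).
have x0 : 0 <= x by rewrite divr_ge0 // mulr_ge0 // ltW.
have x2 : x <= 2^-1.
  rewrite /x ler_pdivrMr; last by rewrite mulr_gt0.
  have := aC k; lra.
have geom n : (k.+1 <= n)%N -> \sum_(k.+1 <= i < n) x ^+ i <= 2 * x ^+ k.+1 - 2 * x ^+ n.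
  elim: n => // n IHn; rewrite leq_eqVlt => /predU1P[->|kn].
    by rewrite big_geq // subrr.
  rewrite big_nat_recr //= (le_trans (lerD (IHn kn) (lexx _))) // (exprS x n).
  have : 0 <= x ^+ n by exact: exprn_ge0.
  nra.
have key : `|a k| * x ^+ k <= 2 * C * x ^+ k.+1.
  suff H : forall e, 0 < e -> `|a k| * x ^+ k <= e + 2 * C * x ^+ k.+1.
    by apply/ler_addgt0Pl => e e0; exact: H.
  move=> e e0.
  have /cvgrPdist_lt /(_ e e0) [N _ hN] := a0 x.
  pose n := maxn N k.+1.
  have := hN n (leq_maxl _ _).
  rewrite /series /= sub0r normrN (big_cat_nat (n := k)) //=; last first.
    by rewrite (leq_trans (leqnSn k)) // leq_maxr.
  rewrite big_nat big1 ?add0r; last by move=> i /= ik; rewrite IH ?mul0r.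
  rewrite big_ltn ?leq_maxr // => hn.
  have hs : `|\sum_(k.+1 <= i < n) a i * x ^+ i| <= 2 * C * x ^+ k.+1.
    apply: le_trans (ler_norm_sum _ _ _) _.
    apply: (@le_trans _ _ (\sum_(k.+1 <= i < n) C * x ^+ i)).
      apply: ler_sum => i _; rewrite normrM normrX (ger0_norm x0).
      by rewrite ler_wpM2r // exprn_ge0.
    rewrite -mulr_sumr (mulrC 2) -mulrA ler_pM2l //.
    apply: le_trans (geom n (leq_maxr _ _)) _.
    by rewrite gerBl mulr_ge0 // exprn_ge0.
  rewrite -(ger0_norm (exprn_ge0 k x0)) -normrM.
  rewrite -[X in `|X|](addrK (\sum_(k.+1 <= i < n) a i * x ^+ i)).
  apply: le_trans (ler_normB _ _) _; apply: lerD => //; exact: ltW.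
have [->|ak0] := eqVneq (a k) 0; first by rewrite normr0.
have xp : 0 < x by rewrite divr_gt0 ?normr_gt0 // mulr_gt0.
move: key; rewrite exprS mulrA ler_pM2r ?exprn_gt0 // /x.
have -> : 2 * C * (`|a k| / (4 * C)) = `|a k| / 2 by field; rewrite gt_eqF.
lra.
Qed.

Section equal_exponential_moments.
Context d (T : measurableType d) d' (T' : measurableType d') (R : realType).
Variables (mu : {measure set T -> \bar R}) (nu : {measure set T' -> \bar R}).
Variables (u : T -> R) (v : T' -> R).
Hypotheses (mu_u : measurable_fun setT u) (mv : measurable_fun setT v).
Hypothesis iu : forall c, mu.-integrable setT (fun x => (expR (c * u x))%:E).
Hypothesis iv : forall c, nu.-integrable setT (fun x => (expR (c * v x))%:E).
Hypothesis uv : forall c, (\int[mu]_x expR (c * u x) = \int[nu]_x expR (c * v x))%R.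

(** The difference of the two exponential integrals at [c] is a power series in
    [c] whose coefficients are the differences of the moments, up to factorials. *)
Lemma moments_eq k : (\int[mu]_x (u x ^+ k) = \int[nu]_x (v x ^+ k))%R.
Proof.
pose a k := ((k`!%:R)^-1 * ((\int[mu]_x (u x ^+ k)) - (\int[nu]_x (v x ^+ k))))%R.
suff : a k = 0.
  move/eqP; rewrite mulf_eq0 invr_eq0 pnatr_eq0 gtn_eqF ?fact_gt0 //=.
  by rewrite subr_eq0 => /eqP.
apply: pseries_eq0 => c; rewrite -(subrr (\int[mu]_x expR (c * u x))%R).
have cb j : `|(j`!%:R)^-1| <= (j`!%:R)^-1 :> R by rewrite ger0_norm ?invr_ge0.
have expE (y : R) : series (fun k => (k`!%:R)^-1 * y ^+ k) @ \oo --> expR y.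
  have -> : (fun k => (k`!%:R)^-1 * y ^+ k) = exp_coeff y.
    by apply/funext => j; rewrite /exp_coeff /= mulrC.
  exact: is_cvg_series_exp_coeff.
have mcu : measurable_fun setT (fun x => c * u x) by exact: measurable_funM.
have mcv : measurable_fun setT (fun x => c * v x) by exact: measurable_funM.
have icu e : mu.-integrable setT (fun x => (expR (e * (c * u x)))%:E).
  by under eq_fun do rewrite mulrA; exact: iu.
have icv e : nu.-integrable setT (fun x => (expR (e * (c * v x)))%:E).
  by under eq_fun do rewrite mulrA; exact: iv.
have h1 := Rintegral_series mcu icu cb expE.
have h2 := Rintegral_series mcv icv cb expE.
rewrite {2}uv; apply: cvg_trans (cvgB h1 h2).
apply: near_eq_cvg; near=> n; rewrite /series !fctE /= -sumrB.
apply: eq_bigr => j _; rewrite /a -mulrBr -mulrA; congr (_ * _).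
have -> : (\int[mu]_x ((c * u x) ^+ j) = c ^+ j * \int[mu]_x (u x ^+ j))%R.
  rewrite -RintegralZl //; last exact: integrable_pow.
  by apply: eq_Rintegral => x _; rewrite exprMn.
have -> : (\int[nu]_x ((c * v x) ^+ j) = c ^+ j * \int[nu]_x (v x ^+ j))%R.
  rewrite -RintegralZl //; last exact: integrable_pow.
  by apply: eq_Rintegral => x _; rewrite exprMn.
by rewrite -mulrBr mulrC.
Unshelve. all: by end_near. Qed.

(** Cosine and sine can be integrated term by term, so their integrals are
    determined by the moments. *)
Lemma Rintegral_cos_eq : (\int[mu]_x cos (u x) = \int[nu]_x cos (v x))%R.
Proof.
pose b n : R := (~~ odd n)%:R * (-1) ^+ n./2 / n`!%:R.
have bb n : `|b n| <= (n`!%:R)^-1.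
  rewrite /b !normrM normr_nat normrX normrN1 expr1n mulr1 normfV normr_nat.
  by rewrite ler_piMl ?invr_ge0 //; case: odd.
have bE (y : R) : series (fun k => b k * y ^+ k) @ \oo --> cos y.
  have <- : cos_coeff y = (fun k => b k * y ^+ k) by exact: cos_coeffE.
  by rewrite unlock; exact: is_cvg_series_cos_coeff.
have h1 := Rintegral_series mu_u iu bb bE.
have h2 := Rintegral_series mv iv bb bE.
move: h2; have <- : (fun n => \sum_(0 <= k < n) b k * (\int[mu]_x (u x ^+ k))%R) =
    (fun n => \sum_(0 <= k < n) b k * (\int[nu]_x (v x ^+ k))%R).
  by apply/funext => n; apply: eq_bigr => j _; rewrite moments_eq.
exact: cvg_unique.
Qed.

Lemma Rintegral_sin_eq : (\int[mu]_x sin (u x) = \int[nu]_x sin (v x))%R.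
Proof.
pose b n : R := (odd n)%:R * (-1) ^+ n.-1./2 / n`!%:R.
have bb n : `|b n| <= (n`!%:R)^-1.
  rewrite /b !normrM normr_nat normrX normrN1 expr1n mulr1 normfV normr_nat.
  by rewrite ler_piMl ?invr_ge0 //; case: odd.
have bE (y : R) : series (fun k => b k * y ^+ k) @ \oo --> sin y.
  have <- : sin_coeff y = (fun k => b k * y ^+ k) by exact: sin_coeffE.
  by rewrite unlock; exact: is_cvg_series_sin_coeff.
have h1 := Rintegral_series mu_u iu bb bE.
have h2 := Rintegral_series mv iv bb bE.
move: h2; have <- : (fun n => \sum_(0 <= k < n) b k * (\int[mu]_x (u x ^+ k))%R) =
    (fun n => \sum_(0 <= k < n) b k * (\int[nu]_x (v x ^+ k))%R).
  by apply/funext => n; apply: eq_bigr => j _; rewrite moments_eq.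
exact: cvg_unique.
Qed.

End equal_exponential_moments.

Lemma cvg_natM_expr (R : realType) (q : R) : 0 <= q < 1 ->
  n%:R * q ^+ n @[n --> \oo] --> 0.
Proof.
move=> /andP[q0 q1]; pose r := Num.sqrt q.
have r0 : 0 <= r by exact: sqrtr_ge0.
have rq : r ^+ 2 = q by exact: sqr_sqrtr.
have r1 : r < 1 by rewrite -(@ltr_sqr _ r 1) ?nnegrE // rq expr1n.
have nr n : n%:R * r ^+ n <= (1 - r)^-1.
  apply: (@le_trans _ _ (\sum_(0 <= i < n) r ^+ i)).
    rewrite mulr_natl -[X in _ *+ X]subn0 -sumr_const_nat.
    by apply: ler_sum_nat => i /andP[_ ni]; exact: (ler_wiXn2l r0 (ltW r1) (ltnW ni)).
  case: n => [|n]; first by rewrite big_geq // invr_ge0 subr_ge0 ltW.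
  rewrite -(ler_pM2r (x := 1 - r)) ?subr_gt0 // mulVf ?subr_eq0 ?gt_eqF //.
  have : (1 - r) * \sum_(0 <= i < n.+1) r ^+ i = 1 - r ^+ n.+1.
    by rewrite big_mkord -[1 - r]opprB mulNr -subrX1 opprB.
  by rewrite mulrC => ->; rewrite gerBl exprn_ge0.
(* [q ^+ n] is the product of two factors [r ^+ n]; one absorbs [n], the other
   tends to [0] *)
apply: (@squeeze_cvgr _ _ _ _ (cst 0) (fun n => (1 - r)^-1 * r ^+ n)).
- near=> n; rewrite mulr_ge0 ?exprn_ge0 //= -rq -exprM mul2n -addnn exprD mulrA.
  by rewrite ler_wpM2r ?exprn_ge0.
- exact: cvg_cst.
- rewrite -[X in _ --> X](mulr0 (1 - r)^-1); apply: cvgMr.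
  by apply: cvg_expr; rewrite ger0_norm.
Unshelve. all: by end_near. Qed.

Lemma bernoulli_le (R : realType) (x : R) (k : nat) : 0 <= x <= 1 ->
  1 - k%:R * x <= (1 - x) ^+ k.
Proof.
move=> /andP[x0 x1]; elim: k => [|k IH]; first by rewrite mul0r subr0 expr0.
rewrite exprS (le_trans _ (ler_wpM2l _ IH)) ?subr_ge0 //.
rewrite -natr1; have : 0 <= k%:R * x ^+ 2 by rewrite mulr_ge0 ?exprn_ge0.
by rewrite expr2; nra.
Qed.

(** For [v < 1 / 2] the exponent [n * 2 ^ n] is negligible against [v ^- n];
    for [v >= 1 / 2] it is large enough to force the limit [0] even at the
    endpoint. *)
Lemma cvg_approx_step (R : realType) (v : R) : 0 <= v <= 1 ->
  (1 - v ^+ n) ^+ (n * 2 ^ n)%N @[n --> \oo] --> ((v < 2^-1)%R%:R : R).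
Proof.
move=> /andP[v0 v1].
have vn n : 0 <= v ^+ n <= 1 by rewrite exprn_ge0 //= exprn_ile1.
have KE n : (n * 2 ^ n)%N%:R * v ^+ n = n%:R * (2 * v) ^+ n :> R.
  by rewrite natrM natrX exprMn mulrA.
have [v2|v2] := ltP v 2^-1.
  apply: (@squeeze_cvgr _ _ _ _ (fun n => 1 - n%:R * (2 * v) ^+ n) (cst 1)).
  - near=> n; rewrite -KE bernoulli_le //=.
    by rewrite exprn_ile1 //; have /andP[] := vn n; lra.
  - rewrite -[X in _ --> X](subr0 1); apply: cvgB; first exact: cvg_cst.
    by apply: cvg_natM_expr; lra.
  - exact: cvg_cst.
apply: (@squeeze_cvgr _ _ _ _ (cst 0) (fun n => expR (- n%:R))).
- near=> n; have /andP[w0 w1] := vn n; rewrite exprn_ge0 ?subr_ge0 //=.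
  apply: (@le_trans _ _ (expR (- v ^+ n) ^+ (n * 2 ^ n))).
    by rewrite lerXn2r ?nnegrE ?subr_ge0 ?expR_ge0 // expR_ge1Dx.
  rewrite -expRM_natl mulrN KE ler_expR lerN2 ler_peMr // exprn_ege1 //; lra.
- exact: cvg_cst.
- exact: cvgn_expR.
Unshelve. all: by end_near. Qed.

Section tuple_measure_unique.
Context (R : realType) (n : nat).
Implicit Types (c : 'I_n -> R) (f g s : n.-tuple R -> R).

Let lin c (x : n.-tuple R) : R := \sum_(k < n) c k * tnth x k.

Let measurable_lin c : measurable_fun setT (lin c).
Proof.
apply: measurable_sum => k; apply: measurable_funM => //.
exact: measurable_tnth.
Qed.

(** An algebra of bounded functions, on which the two measures agree because
    they agree on the moments of each linear form. *)
Inductive trigpoly : (n.-tuple R -> R) -> Prop :=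
| trigpoly_cos c b : trigpoly (fun x => cos (lin c x + b))
| trigpolyD f g : trigpoly f -> trigpoly g -> trigpoly (fun x => f x + g x)
| trigpolyZ r f : trigpoly f -> trigpoly (fun x => r * f x).

Lemma trigpolyM f g : trigpoly f -> trigpoly g -> trigpoly (fun x => f x * g x).
Proof.
move=> + tg; elim=> {f} [c b|f1 f2 _ IH1 _ IH2|r f _ IH]; first last.
- by under eq_fun do rewrite -mulrA; exact: trigpolyZ.
- by under eq_fun do rewrite mulrDl; exact: trigpolyD.
elim: tg => {g} [c' b'|f1 f2 _ IH1 _ IH2|r f _ IH]; first last.
- by under eq_fun do rewrite mulrCA; exact: trigpolyZ.
- by under eq_fun do rewrite mulrDr; exact: trigpolyD.
have -> : (fun x => cos (lin c x + b) * cos (lin c' x + b')) =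
   (fun x => 2^-1 * (cos (lin (fun k => c k + c' k) x + (b + b')) +
                     cos (lin (fun k => c k - c' k) x + (b - b')))).
  apply/funext => x.
  have -> : lin (fun k => c k + c' k) x + (b + b') = (lin c x + b) + (lin c' x + b').
    rewrite /lin addrACA -big_split /=; congr (_ + _).
    by apply: eq_bigr => k _; rewrite mulrDl.
  have -> : lin (fun k => c k - c' k) x + (b - b') = (lin c x + b) - (lin c' x + b').
    rewrite /lin opprD addrACA -sumrB; congr (_ + _).
    by apply: eq_bigr => k _; rewrite mulrBl.
  move: (lin c x + b) (lin c' x + b') => A B.
  by rewrite cosD cosB; field.
by apply/trigpolyZ/trigpolyD; exact: trigpoly_cos.
Qed.

Lemma trigpoly_cst (r : R) : trigpoly (cst r).
Proof.
have -> : cst r = (fun x => r * cos (lin (fun=> 0) x + 0)).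
  apply/funext => x; rewrite /lin big1 ?addr0 ?cos0 ?mulr1 // => k _.
  by rewrite mul0r.
by apply: trigpolyZ; exact: trigpoly_cos.
Qed.

Lemma trigpolyX f k : trigpoly f -> trigpoly (fun x => f x ^+ k).
Proof.
move=> tf; elim: k => [|k IH].
  by under eq_fun do rewrite expr0; exact: trigpoly_cst.
by under eq_fun do rewrite exprS; exact: trigpolyM.
Qed.

Lemma trigpoly_sin_coord (k : 'I_n) (a L : R) :
  trigpoly (fun x => sin ((tnth x k - a) / L)).
Proof.
have -> : (fun x : n.-tuple R => sin ((tnth x k - a) / L)) =
    (fun x => cos (lin (fun i => (i == k)%:R / L) x + (- (a / L) - pi / 2))).
  apply/funext => x; rewrite addrA cosBpihalf /lin (bigD1 k) //= big1.
    by rewrite eqxx addr0 mulrBl mul1r [in RHS]mulrC.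
  by move=> i /negbTE ->; rewrite !mul0r.
exact: trigpoly_cos.
Qed.

Lemma trigpoly_measurable f : trigpoly f -> measurable_fun setT f.
Proof.
elim=> {f} [c b|f g _ mf _ mg|r f _ mf].
- apply: (measurableT_comp (f := cos)); last exact: measurable_funD.
  by apply: continuous_measurable_fun; exact: continuous_cos.
- exact: measurable_funD.
- exact: measurable_funM.
Qed.

Lemma trigpoly_bounded f : trigpoly f -> exists M, forall x, `|f x| <= M.
Proof.
elim=> {f} [c b|f g _ [M hM] _ [N hN]|r f _ [M hM]].
- by exists 1 => x; exact: cos_max.
- by exists (M + N) => x; rewrite (le_trans (ler_normD _ _)) // lerD.
- by exists (`|r| * M) => x; rewrite normrM ler_wpM2l.
Qed.

Variables (mu nu : {measure set (n.-tuple R) -> \bar R}).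
Hypothesis mgf_mu : forall c, mu.-integrable setT (fun x => (expR (lin c x))%:E).
Hypothesis mgf_nu : forall c, nu.-integrable setT (fun x => (expR (lin c x))%:E).
Hypothesis mgf_eq :
  forall c, (\int[mu]_x expR (lin c x) = \int[nu]_x expR (lin c x))%R.

Let fin_of (m : {measure set (n.-tuple R) -> \bar R}) :
  (forall c, m.-integrable setT (fun x => (expR (lin c x))%:E)) ->
  (m setT < +oo)%E.
Proof.
move=> /(_ (fun=> 0)) /integrableP[_]; rewrite (eq_integral (cst 1%E)).
  by rewrite integral_cst // mul1e.
move=> x _; rewrite /lin big1 ?expR0 /= ?normr1 // => k _.
by rewrite mul0r.
Qed.

Let mu_fin := fin_of mgf_mu.
Let nu_fin := fin_of mgf_nu.

Let linZ r c x : r * lin c x = lin (fun k => r * c k) x.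
Proof. by rewrite /lin mulr_sumr; apply: eq_bigr => k _; rewrite mulrA. Qed.

Let trigpoly_eq s : trigpoly s -> (\int[mu]_x s x = \int[nu]_x s x)%R.
Proof.
have intb f (m : {measure set (n.-tuple R) -> \bar R}) : (m setT < +oo)%E ->
    trigpoly f -> m.-integrable setT (EFin \o f).
  move=> mfin tf; have [M hM] := trigpoly_bounded tf.
  by apply: (integrable_bounded mfin _ hM); exact: trigpoly_measurable.
elim=> {s} [c b|f g tf IHf tg IHg|r f tf IH].
- have iu e : mu.-integrable setT (fun x => (expR (e * lin c x))%:E).
    by under eq_fun do rewrite linZ; exact: mgf_mu.
  have iv e : nu.-integrable setT (fun x => (expR (e * lin c x))%:E).
    by under eq_fun do rewrite linZ; exact: mgf_nu.
  have uv e : (\int[mu]_x expR (e * lin c x) = \int[nu]_x expR (e * lin c x))%R.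
    under eq_Rintegral do rewrite linZ.
    by under [RHS]eq_Rintegral do rewrite linZ; exact: mgf_eq.
  have C := Rintegral_cos_eq (measurable_lin c) (measurable_lin c) iu iv uv.
  have S := Rintegral_sin_eq (measurable_lin c) (measurable_lin c) iu iv uv.
  have mcos : measurable_fun setT (fun x => cos (lin c x)).
    apply: (measurableT_comp (f := cos)) => //.
    by apply: continuous_measurable_fun; exact: continuous_cos.
  have msin : measurable_fun setT (fun x => sin (lin c x)).
    apply: (measurableT_comp (f := sin)) => //.
    by apply: continuous_measurable_fun; exact: continuous_sin.
  have key (m : {measure set (n.-tuple R) -> \bar R}) : (m setT < +oo)%E ->
    (\int[m]_x cos (lin c x + b) = cos b * (\int[m]_x cos (lin c x)) -
      sin b * (\int[m]_x sin (lin c x)))%R.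
    move=> mfin.
    have ic : m.-integrable setT (EFin \o (fun x => cos (lin c x))).
      by apply: (integrable_bounded mfin mcos) => x; exact: cos_max.
    have isn : m.-integrable setT (EFin \o (fun x => sin (lin c x))).
      by apply: (integrable_bounded mfin msin) => x; exact: sin_max.
    rewrite -!RintegralZl // -RintegralB //; [|exact: integrableRZ..].
    by apply: eq_Rintegral => x _; rewrite cosD mulrC (mulrC (sin b)).
  by rewrite !key // C S.
- by rewrite !RintegralD ?IHf ?IHg //; exact: intb.
- by rewrite !RintegralZl ?IH //; exact: intb.
Qed.

(** This class is stable under bounded pointwise limits and under products with
    trigonometric polynomials; it contains the indicators of boxes. *)
Let good f := [/\ measurable_fun setT f, exists M, forall x, `|f x| <= M &
  forall s, trigpoly s -> (\int[mu]_x (f x * s x) = \int[nu]_x (f x * s x))%R].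

Let goodM f s : good f -> trigpoly s -> good (fun x => f x * s x).
Proof.
move=> [mf [M hM] fE] ts; have [N hN] := trigpoly_bounded ts; split.
- by apply: measurable_funM => //; exact: trigpoly_measurable.
- by exists (M * N) => x; rewrite normrM ler_pM.
- move=> t tt; under eq_Rintegral do rewrite -mulrA.
  by under [RHS]eq_Rintegral do rewrite -mulrA; apply: fE; exact: trigpolyM.
Qed.

Let good_cvg (f_ : nat -> n.-tuple R -> R) f M : (forall k, good (f_ k)) ->
  (forall k x, `|f_ k x| <= M) -> (forall x, f_ ^~ x @ \oo --> f x) -> good f.
Proof.
move=> gf fM ff.
have mf : measurable_fun setT f.
  by apply: (measurable_fun_cvg (h := f_)) => [k|x _]; [case: (gf k)|exact: ff].
split => //.
  exists M => x.
  have /cvg_lim <- // : `|f_ k x| @[k --> \oo] --> `|f x| by apply: cvg_norm; exact: ff.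
  apply: limr_le; first by apply/cvg_ex; exists `|f x|; apply: cvg_norm; exact: ff.
  by apply: nearW => k; exact: fM.
move=> s ts; have [N hN] := trigpoly_bounded ts.
have key (m : {measure set (n.-tuple R) -> \bar R}) : (m setT < +oo)%E ->
    (\int[m]_x (f_ k x * s x))%R @[k --> \oo] --> (\int[m]_x (f x * s x))%R.
  move=> mfin.
  apply: (@Rdominated_cvg _ _ _ m _ _ (cst (M * N))).
  - move=> k; apply: measurable_funM; first by case: (gf k).
    exact: trigpoly_measurable.
  - by move=> x; apply: cvgM; [exact: ff|exact: cvg_cst].
  - by apply: (integrable_bounded (M := `|M * N|) mfin).
  - by move=> k x; rewrite normrM ler_pM.
have h1 := key _ mu_fin; have h2 := key _ nu_fin.
have E : (fun k => \int[mu]_x (f_ k x * s x))%R =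
         (fun k => \int[nu]_x (f_ k x * s x))%R.
  by apply/funext => k; case: (gf k) => _ _; apply.
rewrite E in h1; exact: cvg_unique h1 h2.
Qed.

(** [sin ((x_k - a) / L)] has the sign of [x_k - a] for large [L], and the
    indicator of a positive sine is a limit of trigonometric polynomials by
    [cvg_approx_step]. *)
Let good_pos f k a : good f -> good (fun x => f x * (a < tnth x k)%R%:R).
Proof.
move=> gf; have [_ [M hM] _] := gf.
have bM (b : bool) x : `|f x * b%:R| <= M.
  by rewrite normrM normr_nat (le_trans _ (hM x)) // ler_piMr //; case: b.
have gsin L : good (fun x => f x * (0 < sin ((tnth x k - a) / L))%R%:R).
  pose v (x : n.-tuple R) := (1 - sin ((tnth x k - a) / L)) / 2.
  have v01 x : 0 <= v x <= 1.
    have := sin_le1 ((tnth x k - a) / L); have := sin_geN1 ((tnth x k - a) / L).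
    by rewrite /v; lra.
  apply: (@good_cvg (fun j x => f x * (1 - v x ^+ j) ^+ (j * 2 ^ j)) _ M).
  - move=> j; apply: goodM => //; apply: trigpolyX.
    under eq_fun do rewrite -mulN1r; apply: trigpolyD; first exact: trigpoly_cst.
    apply/trigpolyZ/trigpolyX; rewrite /v.
    under eq_fun do rewrite mulrC; apply: trigpolyZ.
    under eq_fun do rewrite -mulN1r; apply: trigpolyD; first exact: trigpoly_cst.
    by apply: trigpolyZ; exact: trigpoly_sin_coord.
  - move=> j x; rewrite normrM (le_trans _ (hM x)) // ler_piMr //.
    have /andP[v0 v1] := v01 x.
    have w0 : 0 <= v x ^+ j by exact: exprn_ge0.
    have w1 : v x ^+ j <= 1 by exact: exprn_ile1.
    by rewrite normrX exprn_ile1 // ger0_norm; lra.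
  - move=> x; apply: cvgM; first exact: cvg_cst.
    have -> : (0 < sin ((tnth x k - a) / L)) = (v x < 2^-1) by rewrite /v; apply/idP/idP; lra.
    exact: cvg_approx_step.
apply: (@good_cvg (fun j x => f x * (0 < sin ((tnth x k - a) / j.+1%:R))%R%:R) _ M) => //.
move=> x; apply: cvgM; first exact: cvg_cst.
apply: cvg_near_cst; near=> j.
have hj : `|tnth x k - a| / j.+1%:R < pi.
  rewrite ltr_pdivrMr // -ltr_pdivrMl ?pi_gt0 // mulrC.
  apply: (@lt_le_trans _ _ j%:R); last by rewrite ler_nat.
  by near: j; exact: nbhs_infty_gtr.
congr (nat_of_bool _)%:R; apply/idP/idP; last first.
  rewrite -subr_gt0 => ax; apply: sin_gt0_pi.
  by rewrite divr_gt0 //= (le_lt_trans _ hj) // ler_pM2r ?invr_gt0 // ler_norm.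
apply: contraTT; rewrite -!leNgt => xa.
have xa0 : tnth x k - a <= 0 by rewrite subr_le0.
rewrite -oppr_ge0 -sinN sin_ge0_pi // -mulNr divr_ge0 ?oppr_ge0 //=.
by rewrite -(ler0_norm xa0) ltW.
Unshelve. all: by end_near. Qed.

Let box (a : 'I_n -> R) := [set x : n.-tuple R | forall k, a k < tnth x k].

Let box_eq a : mu (box a) = nu (box a).
Proof.
pose ind (l : seq 'I_n) (x : n.-tuple R) : R := \prod_(k <- l) (a k < tnth x k)%R%:R.
have gind l : good (ind l).
  elim: l => [|k l IH].
    have -> : ind [::] = cst 1 by apply/funext => x; rewrite /ind big_nil.
    split => //; first by exists 1 => x; rewrite normr1.
    move=> s ts; under eq_Rintegral do rewrite mul1r.
    by under [RHS]eq_Rintegral do rewrite mul1r; exact: trigpoly_eq.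
  have -> : ind (k :: l) = (fun x => ind l x * (a k < tnth x k)%R%:R).
    by apply/funext => x; rewrite /ind big_cons mulrC.
  exact: good_pos.
have mbox : measurable (box a).
  have -> : box a = \big[setI/setT]_(k < n) ((@tnth n R)^~ k @^-1` `]a k, +oo[%classic).
    rewrite -bigcap_seq; apply/seteqP; split => x /=.
      by move=> bx k _ /=; rewrite in_itv /= bx.
    by move=> bx k; have := bx k; rewrite /= mem_index_enum in_itv /= andbT; exact.
  apply: bigsetI_measurable => k _; rewrite -[X in measurable X]setTI.
  by apply: measurable_tnth => //; exact: measurable_itv.
have indE x : ind (index_enum _) x = \1_(box a) x.
  rewrite indicE /ind; have [xb|xb] := boolP (x \in box a).
    by rewrite big1 // => k _; move: xb; rewrite inE => /(_ k) ->.
  have [k /negbTE hk] : exists k, ~~ (a k < tnth x k).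
    apply/existsP; move: xb; apply: contraR; rewrite negb_exists => /forallP h.
    by rewrite inE => k; have := h k; rewrite negbK.
  by rewrite (bigD1 k) //= hk mul0r.
have E (m : {measure set (n.-tuple R) -> \bar R}) :
    (\int[m]_x (ind (index_enum _) x * (cst 1 x)) = fine (m (box a)))%R.
  transitivity (\int[m]_x \1_(box a) x)%R.
    by apply: eq_Rintegral => x _; rewrite mulr1 indE.
  by rewrite /Rintegral integral_indic // setIT.
have fb (m : {measure set (n.-tuple R) -> \bar R}) : (m setT < +oo)%E ->
    m (box a) \is a fin_num.
  by move=> mfin; rewrite ge0_fin_numE // (le_lt_trans _ mfin) // le_measure ?inE.
have [_ _ h] := gind (index_enum _); have := h _ (trigpoly_cst 1).
rewrite !E => EE.
by rewrite -(fineK (fb mu mu_fin)) -(fineK (fb nu nu_fin)) EE.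
Qed.

Let coord_lt_nat (y : n.-tuple R) : exists j : nat, forall i, - tnth y i < j%:R.
Proof.
exists (\max_i Num.bound `|tnth y i|) => i.
apply: (@lt_le_trans _ _ (Num.bound `|tnth y i|)%:R); last first.
  by rewrite ler_nat; exact: (leq_bigmax (F := fun i => Num.bound `|tnth y i|)).
by apply: le_lt_trans (archi_boundP (normr_ge0 _)); rewrite -normrN ler_norm.
Qed.

Let measurable_box : measurable = <<s [set B | exists a, B = box a] >>.
Proof.
apply/seteqP; split; last first.
  apply: smallest_sub; first exact: sigma_algebra_measurable.
  move=> _ [a ->].
  have -> : box a = \big[setI/setT]_(k < n) ((@tnth n R)^~ k @^-1` `]a k, +oo[%classic).
    rewrite -bigcap_seq; apply/seteqP; split => x /=.
      by move=> bx k _ /=; rewrite in_itv /= bx.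
    by move=> bx k; have := bx k; rewrite /= mem_index_enum in_itv /= andbT; exact.
  apply: bigsetI_measurable => k _; rewrite -[X in measurable X]setTI.
  by apply: measurable_tnth => //; exact: measurable_itv.
pose G := [set B | exists a, B = box a].
suff mid : measurable_fun setT (id : g_sigma_algebraType G -> n.-tuple R).
  by move=> B mB; have := mid measurableT B mB; rewrite setTI.
apply/measurable_fun_tnthP => k.
apply: (measurability (RGenOInfty.G (R := R))).
  exact: RGenOInfty.measurableE.
move=> _ [_ [x ->] <-]; rewrite setTI.
rewrite (_ : _ @^-1` _ = \bigcup_j box (fun i => if i == k then x else - j%:R)).
  apply: bigcup_measurable => j _; apply: sub_sigma_algebra.
  by eexists.
  apply/seteqP; split => y /=.
    rewrite in_itv /= andbT => xy.
    have [j hj] := coord_lt_nat y.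
    by exists j => // i; case: eqVneq => [->//|_]; rewrite ltrNl.
  by move=> [j _ /(_ k)]; rewrite eqxx in_itv /= andbT.
Qed.

(** The open upper orthants are stable under intersection and generate, and the
    measures agree on them by [good_pos]. *)
Lemma tuple_measure_unique_mgf (B : set (n.-tuple R)) :
  measurable B -> mu B = nu B.
Proof.
apply: (measure_unique [set B | exists a, B = box a]
  (fun j => box (fun=> - j%:R))).
- exact: measurable_box.
- move=> _ _ [a ->] [b ->]; exists (fun k => Num.max (a k) (b k)).
  apply/seteqP; split => x /=.
    by move=> [xa xb] k; rewrite gt_max xa xb.
  by move=> h; split=> k; have := h k; rewrite gt_max => /andP[].
- by move=> j; eexists.
- apply/seteqP; split => // y _.
  have [j hj] := coord_lt_nat y.
  by exists j => // i; rewrite ltrNl.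
- by move=> _ [a ->]; exact: box_eq.
- move=> j; apply: le_lt_trans mu_fin; apply: le_measure; rewrite ?inE //.
  by rewrite measurable_box; apply: sub_sigma_algebra; eexists.
Qed.

End tuple_measure_unique.

(** * Densities and images of measures *)
Section ge0_measurable_induction.
Local Open Scope ereal_scope.
Context d (T : measurableType d) (R : realType).
Variable Phi : (T -> \bar R) -> Prop.

(** The induction principle behind every identity between integrals that is
    checked on indicators. *)
Lemma ge0_measurable_ind :
  (forall A, measurable A -> Phi (fun x => (\1_A x)%:E)) ->
  (forall f g, measurable_fun setT f -> measurable_fun setT g ->
     (forall x, 0 <= f x) -> (forall x, 0 <= g x) ->
     Phi f -> Phi g -> Phi (fun x => f x + g x)) ->
  (forall r f, (0 <= r)%R -> measurable_fun setT f -> (forall x, 0 <= f x) ->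
     Phi f -> Phi (fun x => r%:E * f x)) ->
  (forall f_ : (T -> \bar R)^nat, (forall n, measurable_fun setT (f_ n)) ->
     (forall n x, 0 <= f_ n x) ->
     (forall x, {homo f_ ^~ x : m n / (m <= n)%N >-> m <= n}) ->
     (forall n, Phi (f_ n)) -> Phi (fun x => limn (f_ ^~ x))) ->
  forall f, measurable_fun setT f -> (forall x, 0 <= f x) -> Phi f.
Proof.
move=> Pind PD PZ Plim f mf f0.
pose f_ := nnsfun_approx measurableT mf.
have -> : f = fun x => limn (fun n => (f_ n x)%:E).
  apply/funext => x; apply/esym/cvg_lim => //.
  by apply: cvg_nnsfun_approx => //.
apply: (Plim (fun n x => (f_ n x)%:E)).
- by move=> n; exact/measurable_EFinP/measurable_funP.
- by move=> n x; rewrite lee_fin.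
- by move=> x m n mn; rewrite lee_fin; exact/lefP/nd_nnsfun_approx.
move=> n; move: (f_ n) => g.
have -> : (fun x => (g x)%:E) =
    (fun x => \sum_(r <- fset_set (range g)) (r * \1_(g @^-1` [set r]) x)%:E).
  by apply/funext => x; rewrite {1}fimfunE fsbig_finite //= sumEFin.
have : forall r, r \in (fset_set (range g) : seq R) -> (0 <= r)%R.
  move=> r rg; have : r \in fset_set (range g) by [].
  by rewrite in_fset_set // inE => -[x _ <-].
elim: (fset_set (range g) : seq R) => [|r l IH] hl.
  have -> : (fun x : T => \sum_(r <- [::]) (r * \1_(g @^-1` [set r]) x)%:E) =
      (fun x => (\1_set0 x)%:E).
    by apply/funext => x; rewrite big_nil indicE in_set0.
  exact: Pind.
have mi s : measurable_fun setT (fun x => (\1_(g @^-1` [set s]) x)%:E : \bar R).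
  by apply/measurable_EFinP; exact: measurable_indic.
have r0 : (0 <= r)%R by apply: hl; rewrite inE eqxx.
have ms s : measurable_fun setT (fun x => (s * \1_(g @^-1` [set s]) x)%:E : \bar R).
  by apply/measurable_EFinP/measurable_funM => //; exact: measurable_indic.
under eq_fun do rewrite big_cons; apply: PD => //.
- exact: emeasurable_sum.
- by move=> x; rewrite lee_fin mulr_ge0.
- move=> x; rewrite big_seq; apply: sume_ge0 => s sl.
  by rewrite lee_fin mulr_ge0 // hl // inE sl orbT.
- under eq_fun do rewrite EFinM; apply: PZ => //.
  exact: Pind.
- by apply: IH => s sl; apply: hl; rewrite inE sl orbT.
Qed.

End ge0_measurable_induction.

Section density.
Local Open Scope ereal_scope.
Context d (T : measurableType d) (R : realType) (mu : {measure set T -> \bar R}).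
Variables (D : T -> R) (mD : measurable_fun setT D) (D0 : forall x, (0 <= D x)%R).

(** The proofs are arguments so that the measure structure can be inferred. *)
Definition density_measure of measurable_fun setT D & forall x, (0 <= D x)%R :=
  fun A => \int[mu]_(x in A) (D x)%:E.

Local Notation nu := (density_measure mD D0).

Let nu0 : nu set0 = 0. Proof. by rewrite /density_measure integral_set0. Qed.

Let nu_ge0 A : 0 <= nu A.
Proof. by apply: integral_ge0 => x _; rewrite lee_fin. Qed.

Let nu_sigma_additive : semi_sigma_additive nu.
Proof.
move=> A mA tA mUA; rewrite /density_measure ge0_integral_bigcup //; last 2 first.
- by apply: measurable_funTS; exact/measurable_EFinP.
- by move=> x _; rewrite lee_fin.
apply: is_cvg_ereal_nneg_natsum_cond => n _ _.
by apply: integral_ge0 => x _; rewrite lee_fin.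
Qed.

HB.instance Definition _ := isMeasure.Build _ _ _ nu nu0 nu_ge0 nu_sigma_additive.

Lemma ge0_integral_density_measure (nu' : {measure set T -> \bar R}) f :
  (forall A, measurable A -> nu' A = nu A) ->
  measurable_fun setT f -> (forall x, 0 <= f x) ->
  \int[nu']_x f x = \int[mu]_x (f x * (D x)%:E).
Proof.
move=> nuE; have mED : measurable_fun setT (EFin \o D) by exact/measurable_EFinP.
have D0e x : 0 <= (D x)%:E by rewrite lee_fin.
move: f; apply: (@ge0_measurable_ind _ _ _
  (fun f => \int[nu']_x f x = \int[mu]_x (f x * (D x)%:E))).
- move=> A mA; rewrite integral_indic // setIT nuE //.
  rewrite /density_measure integral_mkcond; apply: eq_integral => x _.
  rewrite /= patchE indicE; case: (x \in A); first by rewrite mul1e.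
  by rewrite mul0e.
- move=> f g mf mg f0 g0 IHf IHg; rewrite ge0_integralD // IHf IHg.
  rewrite -ge0_integralD //; first last.
  + exact: emeasurable_funM.
  + by move=> x _; rewrite mule_ge0.
  + exact: emeasurable_funM.
  + by move=> x _; rewrite mule_ge0.
  by apply: eq_integral => x _; rewrite ge0_muleDl.
- move=> r f r0 mf f0 IH; rewrite ge0_integralZl_EFin // IH -ge0_integralZl_EFin //.
  + by apply: eq_integral => x _; rewrite muleA.
  + by move=> x _; rewrite mule_ge0.
  + exact: emeasurable_funM.
- move=> f_ mf f0 nd IH; rewrite monotone_convergence //.
  under eq_fun do rewrite IH; rewrite -monotone_convergence //; first last.
  + by move=> x _ m n mn; rewrite lee_wpmul2r // nd.
  + by move=> n x _; rewrite mule_ge0.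
  + by move=> n; exact: emeasurable_funM.
  apply: eq_integral => x _; rewrite limeMr //.
  by apply: ereal_nondecreasing_is_cvgn; exact: nd.
Qed.

End density.

Section image.
Local Open Scope ereal_scope.
Context d d' (T : measurableType d) (T' : measurableType d') (R : realType).
Variables (mu : {measure set T -> \bar R}) (f : T -> T').
Hypothesis mf : measurable_fun setT f.

Definition image_measure : {measure set T' -> \bar R} :=
  measure_function_pushforward__canonical__measure_function_Measure mu mf.

Lemma image_measureE A : image_measure A = mu (f @^-1` A).
Proof. by []. Qed.

Lemma ge0_integral_image_measure (g : T' -> \bar R) :
  measurable_fun setT g -> (forall x, 0 <= g x) ->
  \int[image_measure]_x g x = \int[mu]_x g (f x).
Proof. by move=> mg g0; rewrite /image_measure ge0_integral_pushforward. Qed.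

End image.

(** * Gaussian variables *)
Section expR_quotient.
Context (R : realType).
Implicit Types x y : R.

Lemma expRB1_le y : `|expR y - 1| <= `|y| * expR `|y|.
Proof.
have h1 := expR_ge1Dx y; have h2 := expR_ge1Dx (- y).
have E0 := expR_gt0 y.
have [y0|y0] := leP 0 y.
  rewrite (ger0_norm y0) ger0_norm; last lra.
  have := ler_wpM2l (ltW E0) h2; rewrite -expRD subrr expR0; nra.
rewrite (ltr0_norm y0) ltr0_norm; last by rewrite subr_lt0 expR_lt1.
have : 1 <= expR (- y) by rewrite -expR0 ler_expR; lra.
by nra.
Qed.

Lemma expRB1B_le y : `|expR y - 1 - y| <= y ^+ 2 * expR `|y|.
Proof.
have h1 := expR_ge1Dx y; have h2 := expR_ge1Dx (- y).
have E0 := expR_gt0 y.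
have h3 := ler_wpM2l (ltW E0) h2; rewrite -expRD subrr expR0 in h3.
rewrite (ger0_norm (x := _ - y)); last lra.
have [y0|y0] := leP 0 y; first by rewrite (ger0_norm y0); nra.
rewrite (ltr0_norm y0); have : 1 <= expR (- y) by rewrite -expR0 ler_expR; lra.
by nra.
Qed.

Lemma cvg_expR_quot (r_ x_ : nat -> R) x : (forall n, 0 < r_ n) ->
  r_ @ \oo --> 0 -> x_ @ \oo --> x ->
  (r_ n)^-1 * (expR (r_ n * x_ n) - 1) @[n --> \oo] --> x.
Proof.
move=> r0 rr xx.
pose e n := r_ n * (x_ n ^+ 2 * expR `|r_ n * x_ n|).
have ee : e n @[n --> \oo] --> 0.
  rewrite -(mul0r (x ^+ 2 * expR `|0 * x|)); apply: cvgM => //; apply: cvgM.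
    by rewrite expr2; under eq_fun do rewrite expr2; exact: cvgM.
  apply: continuous_cvg; first exact: continuous_expR.
  by apply: cvg_norm; exact: cvgM.
have b n : `|(r_ n)^-1 * (expR (r_ n * x_ n) - 1) - x_ n| <= e n.
  have -> : (r_ n)^-1 * (expR (r_ n * x_ n) - 1) - x_ n =
     (r_ n)^-1 * (expR (r_ n * x_ n) - 1 - r_ n * x_ n).
    by rewrite [RHS]mulrBr mulKf // gt_eqF.
  have ri : 0 <= (r_ n)^-1 by rewrite invr_ge0 ltW.
  rewrite normrM (ger0_norm ri) mulrC ler_pdivrMr //.
  by apply: le_trans (expRB1B_le _) _; rewrite /e exprMn expr2; lra.
apply: (@squeeze_cvgr _ _ _ _ (fun n => x_ n - e n) (fun n => x_ n + e n)).
- by near=> n; have := b n; rewrite ler_norml; lra.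
- by rewrite -[X in _ --> X](subr0 x); exact: cvgB.
- by rewrite -[X in _ --> X](addr0 x); exact: cvgD.
Unshelve. all: by end_near. Qed.

End expR_quotient.

Section moments_from_exponentials.
Context d (T : measurableType d) (R : realType) (P : probability T R).
Variables (X : T -> R) (mX : measurable_fun setT X).
Hypothesis iexp : forall c, P.-integrable setT (fun w => (expR (c * X w))%:E).

(* exponent [4]: the second difference quotient is at most
   [|X| ^ 2 * exp (3 |X|)], and [|X| ^ 2 <= exp |X|] *)
Let dom w := expR (4 * X w) + expR (- 4 * X w).

Let idom : P.-integrable setT (EFin \o dom).
Proof. by apply/integrableRD; exact: iexp. Qed.

Let expR_abs4 w : expR (4 * `|X w|) <= dom w.
Proof.
rewrite /dom; case: (ger0P (X w)) => _; first by rewrite lerDl expR_ge0.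
by rewrite mulrN -mulNr lerDr expR_ge0.
Qed.

Let abs_le (x : R) : `|x| <= expR `|x|.
Proof. by have := expR_ge1Dx `|x|; lra. Qed.

Let r (n : nat) : R := n.+1%:R^-1.

Let r0 n : 0 < r n. Proof. by rewrite invr_gt0. Qed.

Let r1 n : r n <= 1. Proof. by rewrite invf_le1 ?ler1n. Qed.

Let rN : r @ \oo --> 0. Proof. exact: cvg_harmonic. Qed.

Let scale_le n (x : R) : `|r n * x| <= `|x|.
Proof. by rewrite normrM (ger0_norm (ltW (r0 n))) ler_piMl. Qed.

Let diff_le n (x : R) : `|(r n)^-1 * (expR (r n * x) - 1)| <= `|x| * expR `|x|.
Proof.
have ri : 0 <= (r n)^-1 by rewrite invr_ge0 ltW.
rewrite normrM (ger0_norm ri).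
apply: le_trans (ler_wpM2l ri (expRB1_le _)) _.
rewrite normrM (ger0_norm (ltW (r0 n))) -mulrA mulKf ?gt_eqF //.
rewrite ler_wpM2l // ler_expR; have := scale_le n x.
by rewrite normrM (ger0_norm (ltW (r0 n))).
Qed.

(** Both moments are read off difference quotients of the Laplace transform at
    [0], which are dominated by [exp (4 |X|)]. *)
Lemma moments_of_gaussian_mgf (m s : R) :
  (forall c, (\int[P]_w expR (c * X w))%R = expR (c * m + (c * s) ^+ 2 / 2)) ->
  (\int[P]_w X w)%R = m /\ (m = 0 -> (\int[P]_w (X w ^+ 2))%R = s ^+ 2).
Proof.
move=> hM.
have icX c : P.-integrable setT (EFin \o (fun w => expR (c * X w))) by exact: iexp.
have i1 (c : R) : P.-integrable setT (EFin \o (fun=> c)).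
  exact: (finite_measure_integrable_cst P c measurableT).
have mE c : measurable_fun setT (fun w => expR (c * X w)).
  by apply: measurableT_comp => //; exact: measurable_funM.
have ri n : (r n)^-1 != 0 by rewrite invr_eq0 gt_eqF.
have rn n : r n != 0 by rewrite gt_eqF.
split.
  have h1 : (\int[P]_w ((r n)^-1 * (expR (r n * X w) - 1)))%R @[n --> \oo] -->
       (\int[P]_w X w)%R.
    apply: (@Rdominated_cvg _ _ _ P _ _ dom) => //.
    - by move=> n; apply: measurable_funM => //; exact: measurable_funB.
    - by move=> w; apply: cvg_expR_quot => //; exact: cvg_cst.
    - move=> n w; apply: le_trans (diff_le _ _) _; apply: le_trans (expR_abs4 w).
      apply: le_trans (ler_wpM2r (expR_ge0 _) (abs_le _)) _.
      by rewrite -expRD ler_expR; have := normr_ge0 (X w); lra.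
  have E n : (\int[P]_w ((r n)^-1 * (expR (r n * X w) - 1)))%R =
      (r n)^-1 * (expR (r n * (m + r n * (s ^+ 2 / 2))) - 1).
    rewrite RintegralZl //; last exact: integrableRB.
    rewrite RintegralB // hM Rintegral_probability_cst.
    by congr (_ * (expR _ - 1)); field.
  have h2 : (r n)^-1 * (expR (r n * (m + r n * (s ^+ 2 / 2))) - 1) @[n --> \oo] --> m.
    apply: cvg_expR_quot => //; rewrite -[X in _ --> X]addr0.
    apply: cvgD; first exact: cvg_cst.
    by rewrite -(mul0r (s ^+ 2 / 2)); apply: cvgM => //; exact: cvg_cst.
  rewrite (_ : (fun n => _) = (fun n =>
    (r n)^-1 * (expR (r n * (m + r n * (s ^+ 2 / 2))) - 1))) in h1; last exact/funext.
  exact: (cvg_unique _ h1 h2).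
move=> m0.
pose F n x := ((r n)^-1 * (expR (r n * x) - 1)) ^+ 2 * expR (- (r n * x)).
have FE n x : F n x = (r n) ^- 2 * (expR (r n * x) + expR (- r n * x) + -2).
  rewrite /F exprMn exprVn -mulrA mulNr; congr (_ * _).
  have h : expR (r n * x) * expR (- (r n * x)) = 1 by rewrite -expRD subrr expR0.
  rewrite expr2; ring: h.
have h1 : (\int[P]_w F n (X w))%R @[n --> \oo] --> (\int[P]_w (X w ^+ 2))%R.
  apply: (@Rdominated_cvg _ _ _ P _ _ dom) => //.
  - move=> n; apply: measurable_funM.
      by apply/measurable_funX/measurable_funM => //; exact: measurable_funB.
    by apply: measurableT_comp => //; under eq_fun do rewrite -mulNr; exact: measurable_funM.
  - move=> w; rewrite -[X in _ --> X]mulr1; apply: cvgM.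
      rewrite expr2; under eq_fun do rewrite expr2.
      by apply: cvgM; apply: cvg_expR_quot => //; exact: cvg_cst.
    rewrite -(@expR0 R) -oppr0 -(mul0r (X w)).
    apply: continuous_cvg; first exact: continuous_expR.
    by apply: cvgN; apply: cvgM => //; exact: cvg_cst.
  - move=> n w; apply: le_trans (expR_abs4 w).
    rewrite /F normrM normrX (ger0_norm (expR_ge0 _)).
    have hE : expR (- (r n * X w)) <= expR `|X w|.
      by rewrite ler_expR (le_trans _ (scale_le n (X w))) // -normrN ler_norm.
    have h2 : `|(r n)^-1 * (expR (r n * X w) - 1)| ^+ 2 <= (`|X w| * expR `|X w|) ^+ 2.
      by rewrite lerXn2r ?nnegrE ?mulr_ge0 ?expR_ge0.
    apply: le_trans (ler_pM _ _ h2 hE) _; rewrite ?exprn_ge0 ?expR_ge0 //.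
    have hx : `|X w| ^+ 2 <= expR `|X w|.
      have x0 := normr_ge0 (X w).
      have hq := expR_ge1Dx (`|X w| / 4).
      have : `|X w| <= expR (`|X w| / 4) ^+ 2.
        apply: (@le_trans _ _ ((1 + `|X w| / 4) ^+ 2)); last first.
          by rewrite lerXn2r ?nnegrE ?expR_ge0 //; lra.
        have := sqr_ge0 (1 - `|X w| / 4); nra.
      move=> hle; apply: (@le_trans _ _ ((expR (`|X w| / 4) ^+ 2) ^+ 2)).
        by rewrite lerXn2r ?nnegrE ?exprn_ge0 ?expR_ge0.
      by rewrite -exprM -expRM_natl ler_expR; lra.
    rewrite exprMn -mulrA; apply: le_trans (ler_wpM2r _ hx) _.
      by rewrite mulr_ge0 ?exprn_ge0 ?expR_ge0.
    by rewrite -expRM_natl -!expRD ler_expR; have := normr_ge0 (X w); lra.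
have E n : (\int[P]_w F n (X w))%R =
    2 * ((r n ^+ 2)^-1 * (expR (r n ^+ 2 * (s ^+ 2 / 2)) - 1)).
  under eq_Rintegral do rewrite FE.
  have i2 : P.-integrable setT (EFin \o (fun w => expR (r n * X w) + expR (- r n * X w))).
    exact: integrableRD.
  rewrite RintegralZl //; last exact: integrableRD.
  rewrite RintegralD // RintegralD // !hM Rintegral_probability_cst m0.
  have -> : r n * 0 + (r n * s) ^+ 2 / 2 = r n ^+ 2 * (s ^+ 2 / 2) by field.
  have -> : - r n * 0 + (- r n * s) ^+ 2 / 2 = r n ^+ 2 * (s ^+ 2 / 2) by field.
  by ring.
have h2 : 2 * ((r n ^+ 2)^-1 * (expR (r n ^+ 2 * (s ^+ 2 / 2)) - 1)) @[n --> \oo] --> s ^+ 2.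
  rewrite [X in _ --> X](_ : s ^+ 2 = 2 * (s ^+ 2 / 2)); last by field.
  apply: cvgM; first exact: cvg_cst.
  apply: (@cvg_expR_quot R (fun n => r n ^+ 2) (fun=> s ^+ 2 / 2)).
  - by move=> n; rewrite exprn_gt0.
  - by rewrite -(mul0r (0 : R)); under eq_fun do rewrite expr2; exact: cvgM.
  - exact: cvg_cst.
rewrite (_ : (fun n => _) = (fun n =>
  2 * ((r n ^+ 2)^-1 * (expR (r n ^+ 2 * (s ^+ 2 / 2)) - 1)))) in h1; last exact/funext.
exact: (cvg_unique _ h1 h2).
Qed.

End moments_from_exponentials.

Lemma normal_peak_div (R : realType) (s w : R) : 0 < w ->
  normal_peak (s / w) = w * normal_peak s.
Proof.
move=> w0; rewrite /normal_peak.
have -> : (s / w) ^+ 2 * pi *+ 2 = w^-1 ^+ 2 * (s ^+ 2 * pi *+ 2).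
  by field; rewrite gt_eqF.
by rewrite sqrtrM ?sqr_ge0 // sqrtr_sqr ger0_norm ?invr_ge0 ?(ltW w0) // invfM invrK.
Qed.

Section gaussian_variable_integrals.
Context d (T : measurableType d) (R : realType) (P : probability T R).
Variables (X : T -> R) (mX : measurable_fun setT X).
Local Notation leb := (@lebesgue_measure R).

Let X' : {RV P >-> measurableTypeR R} :=
  HB.pack X (isMeasurableFun.Build _ _ T (measurableTypeR R) X mX).

Lemma ge0_integral_normal_law m s (f : R -> \bar R) :
  (forall B : set R, measurable B -> P (X @^-1` B) = normal_prob m s B) ->
  measurable_fun setT f -> (forall x, 0 <= f x)%E ->
  (\int[P]_w f (X w) = \int[leb]_x (f x * (normal_pdf m s x)%:E))%E.
Proof.
move=> law mf f0.
transitivity (\int[distribution P X']_x f x)%E.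
  by rewrite ge0_integral_distribution.
exact: (@ge0_integral_density_measure _ (measurableTypeR R) R leb _
  (measurable_normal_pdf m s) (normal_pdf_ge0 m s) (distribution P X') f law mf f0).
Qed.

Lemma ge0_integral_dirac_law m (f : R -> \bar R) :
  (forall B : set R, measurable B -> P (X @^-1` B) = \d_m B) ->
  measurable_fun setT f -> (forall x, 0 <= f x)%E ->
  (\int[P]_w f (X w) = f m)%E.
Proof.
move=> law mf f0.
pose X1 : {RV P >-> R} := HB.pack X (isMeasurableFun.Build _ _ _ _ _ mX).
transitivity (\int[distribution P X1]_x f x)%E.
  by rewrite ge0_integral_distribution.
rewrite (eq_measure_integral \d_m); last by move=> A mA _; exact: law.
by rewrite integral_dirac // diracT mul1e.
Qed.

(** Completing the square turns an exponential times a normal density into a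
    multiple of another normal density, whose total mass is [1]. *)
Lemma gaussian_variable_exp : gaussian_variable P X ->
  exists m s : R,
    [/\ 0 <= s,
      forall c, (\int[P]_w (expR (c * X w))%:E = (expR (c * m + (c * s) ^+ 2 / 2))%:E)%E &
      m = 0 ->
        (\int[P]_w (expR (- (X w ^+ 2) / 2))%:E = ((Num.sqrt (1 + s ^+ 2))^-1)%:E)%E].
Proof.
have mexp c : measurable_fun setT (fun x : R => (expR (c * x))%:E : \bar R).
  by apply/measurable_EFinP; apply: measurableT_comp => //; exact: measurable_funM.
have msq : measurable_fun setT (fun x : R => (expR (- (x ^+ 2) / 2))%:E : \bar R).
  apply/measurable_EFinP; apply: measurableT_comp => //; apply: measurable_funM => //.
  by apply: measurableT_comp => //; exact: measurable_funX.
have pdfE m s x : 0 < s -> normal_pdf m s x =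
    normal_peak s * expR (- (x - m) ^+ 2 / (s ^+ 2 *+ 2)).
  by move=> s0; rewrite /normal_pdf gt_eqF.
have scaleE (k m s : R) : 0 <= k ->
    (\int[leb]_x ((k * normal_pdf m s x)%:E) = k%:E)%E.
  move=> k0; under eq_integral do rewrite EFinM.
  rewrite ge0_integralZl_EFin //; first by rewrite integral_normal_pdf mule1.
  - by move=> x _; rewrite lee_fin normal_pdf_ge0.
  - by apply/measurable_EFinP; exact: measurable_normal_pdf.
move=> [[m [s [s0 law]]]|[m law]].
- have sn0 : s != 0 by rewrite gt_eqF.
  exists m, s; split; first exact: ltW.
    move=> c; rewrite (ge0_integral_normal_law law (f := fun y => (expR (c * y))%:E)) //.
    rewrite -(scaleE (expR (c * m + (c * s) ^+ 2 / 2)) (m + c * s ^+ 2) s) ?expR_ge0 //.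
    apply: eq_integral => x _; rewrite -EFinM !pdfE // !(mulrCA _ (normal_peak s)) -!expRD.
    by congr (_ * expR _)%:E; field.
  move=> m0; rewrite (ge0_integral_normal_law (f := fun y => (expR (- (y ^+ 2) / 2))%:E) law) //.
  have q0 : 0 < 1 + s ^+ 2 by rewrite ltr_pwDl // sqr_ge0.
  pose t := s / Num.sqrt (1 + s ^+ 2).
  have w0 : 0 < Num.sqrt (1 + s ^+ 2) by rewrite sqrtr_gt0.
  have t0 : 0 < t by rewrite divr_gt0.
  rewrite -(scaleE (Num.sqrt (1 + s ^+ 2))^-1 0 t); last by rewrite invr_ge0 ltW.
  apply: eq_integral => x _; rewrite -EFinM !pdfE // m0 !(mulrCA _ (normal_peak _)) -!expRD.
  have t2 : t ^+ 2 = s ^+ 2 / (1 + s ^+ 2) by rewrite /t expr_div_n sqr_sqrtr // ltW.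
  have -> : normal_peak t = Num.sqrt (1 + s ^+ 2) * normal_peak s by exact: normal_peak_div.
  rewrite t2 mulrA; congr (_ * expR _)%:E; last by field; rewrite sn0 gt_eqF.
  by field; rewrite gt_eqF.
- exists m, 0; split => //.
    move=> c; rewrite (ge0_integral_dirac_law law (f := fun y => (expR (c * y))%:E)) //.
    by rewrite mulr0 expr0n mul0r addr0.
  move=> m0.
  rewrite (ge0_integral_dirac_law law (f := fun y => (expR (- (y ^+ 2) / 2))%:E)) //.
  by rewrite m0 expr0n /= oppr0 mul0r expR0 addr0 sqrtr1 invr1.
Qed.

(** The parameter [s ^+ 2] of [gaussian_variable_exp] is the second moment. *)
Lemma gaussian_variable_centred : gaussian_variable P X -> (\int[P]_w X w)%R = 0 ->
  let v := (\int[P]_w (X w ^+ 2))%R in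
  [/\ 0 <= v, P.-integrable setT (EFin \o (fun w => X w ^+ 2)),
   forall c, (\int[P]_w (expR (c * X w))%:E = (expR (c ^+ 2 * v / 2))%:E)%E &
   (\int[P]_w (expR (- (X w ^+ 2) / 2))%:E = ((Num.sqrt (1 + v))^-1)%:E)%E].
Proof.
move=> /gaussian_variable_exp[m [s [s0 hM hS]]] mean v.
have iexp c : P.-integrable setT (fun w => (expR (c * X w))%:E).
  apply/integrableP; split.
    by apply/measurable_EFinP; apply: measurableT_comp => //; exact: measurable_funM.
  rewrite (eq_integral (fun w => (expR (c * X w))%:E)).
    by rewrite hM ltry.
  by move=> w _; rewrite /= ger0_norm ?expR_ge0.
have hM' c : (\int[P]_w expR (c * X w))%R = expR (c * m + (c * s) ^+ 2 / 2).
  by rewrite /Rintegral hM.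
have [mE vE] := moments_of_gaussian_mgf mX iexp hM'.
have m0 : m = 0 by rewrite -mE.
have {}vE : v = s ^+ 2 by exact: vE.
split.
- by rewrite vE sqr_ge0.
- exact: integrable_pow.
- by move=> c; rewrite hM m0 mulr0 add0r exprMn vE.
- by rewrite hS // vE.
Qed.

End gaussian_variable_integrals.

(** * Exponentials of a Gaussian field *)
Section gaussian_field_exponentials.
Context dO (O : measurableType dO) (R : realType) (P : probability O R) (d : nat).
Variables (W : 'rV[R]_d -> {RV P >-> R}).
Hypotheses (W_gaussian : gaussian_field W) (W_mean : has_mean_zero W).

Let gauss1 t : gaussian_variable P (W t).
Proof.
have := W_gaussian (fun _ : 'I_1 => t) (fun=> 1).
rewrite (_ : (fun w => _) = W t) //.
by apply/funext => w; rewrite big_ord1 mul1r.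
Qed.

Let Rmean t : (\int[P]_w W t w)%R = 0.
Proof. by rewrite /Rintegral -[X in fine X]expectation_def W_mean. Qed.

Let isq t : P.-integrable setT (EFin \o (fun w => W t w ^+ 2)).
Proof. by have [] := gaussian_variable_centred (measurable_funPT (W t)) (gauss1 t) (Rmean t). Qed.

Lemma gaussian_field_integrable t : P.-integrable setT (EFin \o W t).
Proof.
have i1 : P.-integrable setT (EFin \o (fun=> 1)).
  exact: (finite_measure_integrable_cst P 1 measurableT).
apply: le_integrable (integrableRD i1 (isq t)) => //.
  by apply/measurable_EFinP.
move=> w _; rewrite /= lee_fin [leRHS]ger0_norm; last by rewrite addr_ge0 // sqr_ge0.
rewrite ler_norml; have := sqr_ge0 (W t w - 1); have := sqr_ge0 (W t w + 1).
by rewrite !expr2; nra.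
Qed.

Lemma gaussian_field_integrableM s t :
  P.-integrable setT (EFin \o (fun w => W s w * W t w)).
Proof.
apply: le_integrable (integrableRD (isq s) (isq t)) => //.
  by apply/measurable_EFinP; exact: measurable_funM.
move=> w _; rewrite /= lee_fin [leRHS]ger0_norm; last by rewrite addr_ge0 // sqr_ge0.
by rewrite ler_norml; have := sqr_ge0 (W s w - W t w);
   have := sqr_ge0 (W s w + W t w); nra.
Qed.

Definition field_cov (s t : 'rV[R]_d) : R := (\int[P]_w (W s w * W t w))%R.
Local Notation C := field_cov.

Lemma field_covC s t : C s t = C t s.
Proof. by apply: eq_Rintegral => w _; rewrite mulrC. Qed.

Section linear_combination.
Variables (n : nat) (t : 'I_n -> 'rV[R]_d) (c : 'I_n -> R).
Let L w := \sum_(k < n) c k * W (t k) w.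

Lemma measurable_lincomb : measurable_fun setT L.
Proof. by apply: measurable_sum => k; exact: measurable_funM. Qed.

Let icW k : P.-integrable setT (EFin \o (fun w => c k * W (t k) w)).
Proof. by apply: integrableRZ; exact: gaussian_field_integrable. Qed.

Let meanL : (\int[P]_w L w)%R = 0.
Proof.
rewrite (Rintegral_sum _ icW).2 big1 // => k _.
by rewrite RintegralZl ?Rmean ?mulr0 //; exact: gaussian_field_integrable.
Qed.

Lemma lincomb_sqr :
  (\int[P]_w (L w ^+ 2))%R = \sum_(k < n) \sum_(l < n) c k * c l * C (t k) (t l).
Proof.
have icc k l : P.-integrable setT
    (EFin \o (fun w => c k * c l * (W (t k) w * W (t l) w))).
  by apply: integrableRZ; exact: gaussian_field_integrableM.
transitivity (\int[P]_w (\sum_(k < n) \sum_(l < n) c k * c l * (W (t k) w * W (t l) w)))%R.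
  apply: eq_Rintegral => w _; rewrite expr2 {1}/L mulr_suml; apply: eq_bigr => k _.
  by rewrite /L mulr_sumr; apply: eq_bigr => l _; rewrite mulrACA.
have icl k := Rintegral_sum (index_enum (ordinal n)) (icc k).
rewrite (Rintegral_sum _ (fun k => (icl k).1)).2; apply: eq_bigr => k _.
rewrite (icl k).2; apply: eq_bigr => l _.
by rewrite RintegralZl //; exact: gaussian_field_integrableM.
Qed.

Lemma lincomb_centred : let v := (\int[P]_w (L w ^+ 2))%R in
  [/\ 0 <= v, P.-integrable setT (EFin \o (fun w => L w ^+ 2)),
   forall e, (\int[P]_w (expR (e * L w))%:E = (expR (e ^+ 2 * v / 2))%:E)%E &
   (\int[P]_w (expR (- (L w ^+ 2) / 2))%:E = ((Num.sqrt (1 + v))^-1)%:E)%E].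
Proof. exact: (gaussian_variable_centred measurable_lincomb (W_gaussian t c) meanL). Qed.

Lemma lincomb_exp : (\int[P]_w (expR (L w))%:E =
  (expR (2^-1 * \sum_(k < n) \sum_(l < n) c k * c l * C (t k) (t l)))%:E)%E.
Proof.
have [_ _ /(_ 1) + _] := lincomb_centred.
under eq_integral do rewrite mul1r.
by rewrite lincomb_sqr expr1n mul1r mulrC.
Qed.

End linear_combination.

Section stationary.
Variables (gamma sigma2 : 'rV[R]_d -> R).
Hypotheses (W_stationary : intrinsically_stationary W)
  (W_variogram : has_variogram W gamma) (W_variance : has_variance W sigma2).

Lemma field_cov_diag t : C t t = sigma2 t.
Proof.
have := W_variance t; rewrite /variance unlock W_mean /= unlock => /(congr1 fine) /= <-.
rewrite /C /Rintegral; congr fine; apply: eq_integral => w _ /=.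
by rewrite -[RHS]/(((W t w - 0) * (W t w - 0))%:E) !subr0.
Qed.

Lemma increment_sqr s t :
  (\int[P]_w ((W s w - W t w) ^+ 2))%R = C s s - 2 * C s t + C t t.
Proof.
have iM := gaussian_field_integrableM.
transitivity (\int[P]_w (W s w * W s w - 2 * (W s w * W t w) + W t w * W t w))%R.
  by apply: eq_Rintegral => w _; ring.
rewrite RintegralD // ?RintegralB // ?RintegralZl //.
- exact: integrableRZ.
- by apply: integrableRB => //; exact: integrableRZ.
Qed.

Let isq_incr s t : P.-integrable setT (EFin \o (fun w => (W s w - W t w) ^+ 2)).
Proof.
have iM := gaussian_field_integrableM.
rewrite (_ : (fun w => _) =
  (fun w => W s w * W s w - 2 * (W s w * W t w) + W t w * W t w)).
  by apply: integrableRD => //; apply: integrableRB => //; exact: integrableRZ.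
by apply/funext => w; ring.
Qed.

Let covariance_incr s t :
  covariance P (fun w => W s w - W t w) (fun w => W s w - W t w) =
  ((\int[P]_w ((W s w - W t w) ^+ 2))%R)%:E.
Proof.
have E0 : 'E_P[fun w => (W s w - W t w)%R]%E = 0%E.
  rewrite unlock integralB_EFin //; try exact: gaussian_field_integrable.
  by rewrite -!expectation_def !W_mean subee.
have -> : ((\int[P]_w ((W s w - W t w) ^+ 2))%R)%:E =
    (\int[P]_w ((W s w - W t w) ^+ 2)%:E)%E.
  by rewrite /Rintegral fineK //; exact: (integrable_fin_num measurableT (isq_incr s t)).
rewrite unlock E0 unlock; apply: eq_integral => w _.
by rewrite -[LHS]/(((W s w - W t w - 0) * (W s w - W t w - 0))%:E) !subr0 expr2.
Qed.

(** Intrinsic stationarity moves the increment between [t] and [s] to the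
    increment between [0] and [s - t]. *)
Lemma field_cov_variogram s t : C s s - 2 * C s t + C t t = 2 * gamma (s - t).
Proof.
rewrite -increment_sqr.
have gE h : (\int[P]_w ((W h w - W 0 w) ^+ 2))%R = 2 * gamma h.
  have := W_variogram h; rewrite unlock => /(congr1 fine) /=.
  have fin := integrable_fin_num measurableT (isq_incr h 0).
  by rewrite fineM //= => ->; rewrite mulVKf // pnatr_eq0.
rewrite -gE.
have [_ _ /(_ 0 0 t)] := W_stationary (s - t).
by rewrite !add0r subrKC !covariance_incr => -[].
Qed.

(** The exponent of the Laplace transform of the increments
    [V (t_k + s) - V s] under the measure with density [exp (V s)], where
    [V = W - sigma2 / 2]. *)
Definition tilted_exponent n (t : 'I_n -> 'rV[R]_d) (c : 'I_n -> R) : R :=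
  - (1 - \sum_(k < n) c k) * (\sum_(k < n) c k * gamma (t k))
  - 2^-1 * \sum_(k < n) \sum_(l < n) c k * c l * gamma (t k - t l).

(** The terms in [sigma2] and in the covariances cancel, so that neither the
    point [s] nor the variance of the field is left. *)
Lemma tilted_laplace n (t : 'I_n -> 'rV[R]_d) (c : 'I_n -> R) (s : 'rV[R]_d) :
  let V x w := W x w - sigma2 x / 2 in
  (\int[P]_w (expR (V s w) * expR (\sum_(k < n) c k * (V (t k + s) w - V s w)))%:E =
   (expR (tilted_exponent t c))%:E)%E.
Proof.
move=> V.
pose S := \sum_(k < n) c k.
pose t' (i : 'I_n.+1) := if unlift ord0 i is Some k then t k + s else s.
pose c' (i : 'I_n.+1) := if unlift ord0 i is Some k then c k else 1 - S.
pose e := - sigma2 s / 2 - \sum_(k < n) c k * ((sigma2 (t k + s) - sigma2 s) / 2).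
(* up to the constant [e] the exponent is a linear combination of the field at
   [s], with coefficient [1 - S], and at the points [t k + s] *)
have LE w : V s w + \sum_(k < n) c k * (V (t k + s) w - V s w) =
    e + \sum_(i < n.+1) c' i * W (t' i) w.
  rewrite big_ord_recl {1}/c' {1}/t' unlift_none.
  have -> : \sum_(i < n) c' (lift ord0 i) * W (t' (lift ord0 i)) w =
      \sum_(k < n) c k * W (t k + s) w.
    by apply: eq_bigr => k _; rewrite /c' /t' liftK.
  have -> : \sum_(k < n) c k * (V (t k + s) w - V s w) =
     \sum_(k < n) c k * W (t k + s) w - S * W s w -
     \sum_(k < n) c k * ((sigma2 (t k + s) - sigma2 s) / 2).
    rewrite /S mulr_suml -!sumrB; apply: eq_bigr => k _; rewrite /V; lra.
  rewrite /V /e; lra.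
under eq_integral do rewrite -expRD LE expRD EFinM.
rewrite ge0_integralZl_EFin ?expR_ge0 //; last first.
  apply/measurable_EFinP; apply: measurableT_comp => //.
  exact: measurable_lincomb.
rewrite lincomb_exp -EFinM -expRD; congr (expR _)%:E.
have cov_s k : C (t k + s) s = (C (t k + s) (t k + s) + C s s) / 2 - gamma (t k).
  by have := field_cov_variogram (t k + s) s; rewrite addrK; lra.
have cov_tt k l : C (t k + s) (t l + s) =
    (C (t k + s) (t k + s) + C (t l + s) (t l + s)) / 2 - gamma (t k - t l).
  by have := field_cov_variogram (t k + s) (t l + s);
     rewrite opprD addrACA subrr addr0; lra.
pose B := \sum_(k < n) c k * C (t k + s) (t k + s).
pose G1 := \sum_(k < n) c k * gamma (t k).
pose G2 := \sum_(k < n) \sum_(l < n) c k * c l * gamma (t k - t l).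
have sum_s : \sum_(k < n) c k * C (t k + s) s = (B + S * C s s) / 2 - G1.
  rewrite /B /S /G1 mulr_suml -big_split /= mulr_suml -sumrB.
  by apply: eq_bigr => k _; rewrite cov_s; lra.
have sum_tt : \sum_(k < n) \sum_(l < n) c k * c l * C (t k + s) (t l + s) = S * B - G2.
  have -> : S * B = 2^-1 * (S * B) + 2^-1 * (B * S) by lra.
  rewrite /S /B !mulr_suml !mulr_sumr -big_split -sumrB /=.
  apply: eq_bigr => k _; rewrite !mulr_sumr -big_split -sumrB /=.
  by apply: eq_bigr => l _; rewrite cov_tt; lra.
have cross : \sum_(k < n.+1) \sum_(l < n.+1) c' k * c' l * C (t' k) (t' l) =
    (1 - S) ^+ 2 * C s s + 2 * (1 - S) * ((B + S * C s s) / 2 - G1) + (S * B - G2).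
  rewrite -sum_s -sum_tt big_ord_recl big_ord_recl.
  rewrite {1 2}/c' {1 2}/t' unlift_none.
  have -> : \sum_(i < n) c' ord0 * c' (lift ord0 i) * C (t' ord0) (t' (lift ord0 i)) =
      (1 - S) * \sum_(k < n) c k * C (t k + s) s.
    rewrite mulr_sumr; apply: eq_bigr => k _.
    by rewrite /c' /t' unlift_none liftK field_covC mulrA.
  have -> : \sum_(i < n) \sum_(l < n.+1) c' (lift ord0 i) * c' l * C (t' (lift ord0 i)) (t' l) =
     (1 - S) * \sum_(k < n) c k * C (t k + s) s +
     \sum_(k < n) \sum_(l < n) c k * c l * C (t k + s) (t l + s).
    rewrite mulr_sumr -big_split /=; apply: eq_bigr => k _.
    rewrite big_ord_recl; congr (_ + _).
      by rewrite /c' /t' unlift_none liftK mulrCA mulrA.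
    by apply: eq_bigr => l _; rewrite /c' /t' !liftK.
  rewrite expr2; lra.
rewrite cross /tilted_exponent -/S -/G1 -/G2 /e.
have -> : \sum_(k < n) c k * ((sigma2 (t k + s) - sigma2 s) / 2) = (B - S * sigma2 s) / 2.
  rewrite /B /S mulr_suml -sumrB mulr_suml.
  by apply: eq_bigr => k _; rewrite field_cov_diag; lra.
by rewrite field_cov_diag; field.
Qed.

End stationary.

End gaussian_field_exponentials.

(** * The field seen from a point under its exponential density *)
Lemma integrable_ge0_finite d (T : measurableType d) (R : realType)
    (mu : {measure set T -> \bar R}) (f : T -> R) :
  measurable_fun setT f -> (forall x, 0 <= f x) ->
  (\int[mu]_x (f x)%:E < +oo)%E -> mu.-integrable setT (EFin \o f).
Proof.
move=> mf f0 fin; apply/integrableP; split; first exact/measurable_EFinP.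
by rewrite (eq_integral (EFin \o f)) // => x _; rewrite /= ger0_norm.
Qed.

Section tilted_field.
Context dO (O : measurableType dO) (R : realType) (P : probability O R) (d : nat).
Variables (W : 'rV[R]_d -> {RV P >-> R}) (sigma2 : 'rV[R]_d -> R).

Definition drifted (t : 'rV[R]_d) (w : O) : R := W t w - sigma2 t / 2.

Lemma measurable_drifted t : measurable_fun setT (drifted t).
Proof. exact: measurable_funB. Qed.

Let mexp s : measurable_fun setT (fun w => expR (drifted s w)).
Proof. by apply: measurableT_comp => //; exact: measurable_drifted. Qed.

Let exp_ge0 s w : 0 <= expR (drifted s w). Proof. exact: expR_ge0. Qed.

(** The law of the field seen from the point [s]: by [tilted_laplace] the
    increments from [s] have the same law under all these measures. *)
Definition tilt (s : 'rV[R]_d) : {measure set O -> \bar R} :=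
  density_measure P (mexp s) (exp_ge0 s).

Lemma ge0_integral_tilt s f : measurable_fun setT f -> (forall w, 0 <= f w)%E ->
  (\int[tilt s]_w f w = \int[P]_w (f w * (expR (drifted s w))%:E))%E.
Proof. by move=> mf f0; apply: ge0_integral_density_measure. Qed.

Definition increments n (t : 'I_n -> 'rV[R]_d) (s : 'rV[R]_d) (w : O) : n.-tuple R :=
  [tuple drifted (t k + s) w - drifted s w | k < n].

Lemma measurable_increments n (t : 'I_n -> 'rV[R]_d) s :
  measurable_fun setT (increments t s).
Proof.
apply/measurable_fun_tnthP => k.
rewrite (_ : _ \o _ = (fun w => drifted (t k + s) w - drifted s w)).
  by apply: measurable_funB; exact: measurable_drifted.
by apply/funext => w /=; rewrite tnth_mktuple.
Qed.

End tilted_field.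

Section tilted_law.
Context (R : realType) (d : nat) (gamma : 'rV[R]_d -> R).

Let measurable_explin n (c : 'I_n -> R) :
  measurable_fun setT (fun x : n.-tuple R => (expR (\sum_(k < n) c k * tnth x k))%:E).
Proof.
apply/measurable_EFinP; apply: measurableT_comp => //.
by apply: measurable_sum => k; apply: measurable_funM => //; exact: measurable_tnth.
Qed.

Let laplace dO (O : measurableType dO) (P : probability O R)
    (W : 'rV[R]_d -> {RV P >-> R}) sigma2
    (Wg : gaussian_field W) (Wm : has_mean_zero W) (Ws : intrinsically_stationary W)
    (Wv : has_variogram W gamma) (Wr : has_variance W sigma2)
    n (t : 'I_n -> 'rV[R]_d) (c : 'I_n -> R) s :
  (\int[image_measure (tilt W sigma2 s) (measurable_increments W sigma2 t s)]_x
     (expR (\sum_(k < n) c k * tnth x k))%:E = (expR (tilted_exponent gamma t c))%:E)%E.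
Proof.
have e0 (x : n.-tuple R) : (0 <= (expR (\sum_(k < n) c k * tnth x k))%:E :> \bar R)%E.
  by rewrite lee_fin expR_ge0.
rewrite ge0_integral_image_measure //; last exact: measurable_explin.
rewrite (@ge0_integral_tilt _ _ _ _ _ W sigma2 s (fun w => (expR (\sum_(k < n) c k *
  tnth (increments W sigma2 t s w) k))%:E)) //; last first.
  apply: measurableT_comp (measurable_explin c) _; exact: measurable_increments.
rewrite -(tilted_laplace Wg Wm Ws Wv Wr t c s); apply: eq_integral => w _.
rewrite -EFinM mulrC; congr (_ * expR _)%:E; apply: eq_bigr => k _.
by rewrite tnth_mktuple.
Qed.

Lemma tilt_finite dO (O : measurableType dO) (P : probability O R)
    (W : 'rV[R]_d -> {RV P >-> R}) sigma2
    (Wg : gaussian_field W) (Wm : has_mean_zero W) (Ws : intrinsically_stationary W)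
    (Wv : has_variogram W gamma) (Wr : has_variance W sigma2) s :
  (tilt W sigma2 s setT < +oo)%E.
Proof.
have := tilted_laplace Wg Wm Ws Wv Wr (fun k : 'I_0 => 0) (fun=> 0) s.
move=> h; suff -> : tilt W sigma2 s setT = (expR (tilted_exponent gamma
    (fun k : 'I_0 => 0) (fun=> 0)))%:E by rewrite ltry.
rewrite -h; apply: eq_integral => w _.
by rewrite big_ord0 expR0 mulr1.
Qed.

(** The Laplace transforms of [tilted_laplace] are finite and do not involve the
    field, so [tuple_measure_unique_mgf] applies across probability spaces. *)
Lemma tilted_law dO (O : measurableType dO) (P : probability O R)
    (W : 'rV[R]_d -> {RV P >-> R}) sigma2
    (Wg : gaussian_field W) (Wm : has_mean_zero W) (Ws : intrinsically_stationary W)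
    (Wv : has_variogram W gamma) (Wr : has_variance W sigma2)
    dO' (O' : measurableType dO') (P' : probability O' R)
    (W' : 'rV[R]_d -> {RV P' >-> R}) sigma2'
    (Wg' : gaussian_field W') (Wm' : has_mean_zero W') (Ws' : intrinsically_stationary W')
    (Wv' : has_variogram W' gamma) (Wr' : has_variance W' sigma2')
    n (t : 'I_n -> 'rV[R]_d) s s' (B : set (n.-tuple R)) : measurable B ->
  tilt W sigma2 s (increments W sigma2 t s @^-1` B) =
  tilt W' sigma2' s' (increments W' sigma2' t s' @^-1` B).
Proof.
move=> mB.
rewrite -(image_measureE (tilt W sigma2 s) (measurable_increments W sigma2 t s)).
rewrite -(image_measureE (tilt W' sigma2' s') (measurable_increments W' sigma2' t s')).
apply: tuple_measure_unique_mgf mB.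
- move=> c; apply: integrable_ge0_finite; first by apply/measurable_EFinP; exact: measurable_explin.
    by move=> x; exact: expR_ge0.
  by rewrite (laplace Wg Wm Ws Wv Wr) ltry.
- move=> c; apply: integrable_ge0_finite; first by apply/measurable_EFinP; exact: measurable_explin.
    by move=> x; exact: expR_ge0.
  by rewrite (laplace Wg' Wm' Ws' Wv' Wr') ltry.
- move=> c; rewrite /Rintegral (laplace Wg Wm Ws Wv Wr) (laplace Wg' Wm' Ws' Wv' Wr').
  by [].
Qed.

End tilted_law.

(** * Continuity of the variance *)
Section variance_continuous.
Context (R : realType) (d : nat).

Lemma cvg_seq_rV (f : 'rV[R]_d -> R) (p : 'rV[R]_d) (l : R) :
  (forall u : nat -> 'rV[R]_d, u n @[n --> \oo] --> p -> f (u n) @[n --> \oo] --> l) ->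
  f x @[x --> p] --> l.
Proof.
move=> H; have FF : Filter (nbhs p) by exact: nbhs_filter.
apply/(@cvgrPdist_le _ _ _ (nbhs p) FF) => e e0; apply: contrapT => hn.
have hx : forall n : nat, exists x : 'rV[R]_d, ball p n.+1%:R^-1 x /\ e < `|l - f x|.
  move=> n; apply: contrapT => /forallNP h; apply: hn.
  apply/nbhs_ballP; exists n.+1%:R^-1 => /=; first by rewrite invr_gt0.
  by move=> x px; have /not_andP[//|/negP] := h x; rewrite -leNgt.
pose u n := sval (cid (hx n)).
have hu n : ball p n.+1%:R^-1 (u n) /\ e < `|l - f (u n)| by rewrite /u; case: cid.
have : u n @[n --> \oo] --> p.
  apply/cvg_ballP => r r0; have /cvgrPdist_le/(_ r r0) := @cvg_harmonic R.
  apply: filterS => n; rewrite sub0r normrN ger0_norm ?invr_ge0 // => hr.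
  by apply: (le_ball hr); have [] := hu n.
move=> /H /cvgrPdist_le /(_ e e0) [N _ /(_ N (leqnn N))] /=.
by have [_] := hu N; rewrite ltNge => /negP.
Qed.

Context dO (O : measurableType dO) (P : probability O R).
Variables (W : 'rV[R]_d -> {RV P >-> R}) (sigma2 : 'rV[R]_d -> R).
Hypotheses (W_gaussian : gaussian_field W) (W_mean : has_mean_zero W)
  (W_variance : has_variance W sigma2) (W_continuous : sample_continuous W).

Let v s t := (\int[P]_w ((W s w - W t w) ^+ 2))%R.

Let v_exp s t : 0 <= v s t /\
  (\int[P]_w expR (- ((W s w - W t w) ^+ 2) / 2))%R = (Num.sqrt (1 + v s t))^-1.
Proof.
pose p (k : 'I_2) := if k == ord0 then s else t.
pose c (k : 'I_2) : R := if k == ord0 then 1 else -1.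
have LE : (fun w => \sum_(k < 2) c k * W (p k) w) = (fun w => W s w - W t w).
  by apply/funext => w; rewrite !big_ord_recl big_ord0 /= mul1r mulN1r addr0.
have := lincomb_centred W_gaussian W_mean p c.
have -> : (\int[P]_w ((\sum_(k < 2) c k * W (p k) w) ^+ 2))%R = v s t.
  by apply: eq_Rintegral => w _; rewrite -[\sum_(k < 2) _]/((fun w => \sum_(k < 2) c k * W (p k) w) w) LE.
move=> [v0 _ _ h]; split => //.
rewrite /Rintegral -[RHS]/(fine ((Num.sqrt (1 + v s t))^-1)%:E) -h; congr fine.
by apply: eq_integral => w _; rewrite -[\sum_(k < 2) _]/((fun w => \sum_(k < 2) c k * W (p k) w) w) LE.
Qed.

(** The increments of [W] tend to [0] pointwise, so the bounded functional
    [exp (- x ^ 2 / 2)] of them tends to [1] in mean; for a centred Gaussian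
    variable this functional determines the variance. *)
Lemma variance_continuous : continuous sigma2.
Proof.
move=> t; apply: cvg_seq_rV => u ut.
have Wu w : W (u n) w @[n --> \oo] --> W t w.
  have h := @W_continuous w t; exact: (cvg_comp u (fun x => W x w) ut h).
have v0 : v (u n) t @[n --> \oo] --> 0.
  have h1 : (\int[P]_w expR (- ((W (u n) w - W t w) ^+ 2) / 2))%R @[n --> \oo]
      --> (\int[P]_w (cst 1 w))%R.
    apply: (@Rdominated_cvg _ _ _ P _ _ (cst 1)) => //.
    - move=> n; apply: measurableT_comp => //; apply: measurable_funM => //.
      apply: measurableT_comp => //; apply: measurable_funX; exact: measurable_funB.
    - move=> w; rewrite -[X in _ --> X](@expR0 R).
      apply: continuous_cvg; first exact: continuous_expR.
      rewrite -(mul0r (2^-1 : R)); apply: cvgM; last exact: cvg_cst.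
      rewrite -oppr0; apply: cvgN; rewrite -(mul0r (0 : R)).
      under eq_fun do rewrite expr2.
      by apply: cvgM; rewrite -(subrr (W t w)); apply: cvgB => //; exact: cvg_cst.
    - exact: (finite_measure_integrable_cst P 1 measurableT).
    - move=> n w; rewrite ger0_norm ?expR_ge0 // -expR0 ler_expR.
      by rewrite mulNr oppr_le0 mulr_ge0 ?sqr_ge0.
  rewrite Rintegral_probability_cst in h1.
  rewrite (_ : (fun n => _) = (fun n => (Num.sqrt (1 + v (u n) t))^-1)) in h1; last first.
    by apply/funext => n; case: (v_exp (u n) t).
  rewrite (_ : (fun n => _) = (fun n => ((Num.sqrt (1 + v (u n) t))^-1 ^+ 2)^-1 - 1)); last first.
    apply/funext => n; case: (v_exp (u n) t) => v0 _.
    by rewrite exprVn invrK sqr_sqrtr ?addr_ge0 //; lra.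
  rewrite -(subrr 1); apply: cvgB; last exact: cvg_cst.
  rewrite -[X in _ --> X]invr1; apply: cvgV => //.
  by rewrite -[X in _ --> X](mul1r 1); under eq_fun do rewrite expr2; exact: cvgM.
have s0 x : 0 <= sigma2 x.
  rewrite -(field_cov_diag W_mean W_variance); apply: Rintegral_ge0 => w _.
  by rewrite -expr2 sqr_ge0.
have iM := gaussian_field_integrableM W_gaussian W_mean.
have bound e s : 0 < e -> `|sigma2 t - sigma2 s| <= e * sigma2 t + (1 + e^-1) * v s t.
  move=> e0.
  have E x : sigma2 x = (\int[P]_w (W x w * W x w))%R.
    by rewrite -(field_cov_diag W_mean W_variance).
  have vE : v s t = (\int[P]_w (W s w * W s w - 2 * (W s w * W t w) + W t w * W t w))%R.
    by apply: eq_Rintegral => w _; ring.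
  have i3 : P.-integrable setT (EFin \o (fun w =>
      W s w * W s w - 2 * (W s w * W t w) + W t w * W t w)).
    by apply: integrableRD => //; apply: integrableRB => //; exact: integrableRZ.
  rewrite !E vE -RintegralB // -!RintegralZl // -RintegralD //; [|exact: integrableRZ..].
  apply: le_trans (le_normr_Rintegral _ _) _ => //; first exact: integrableRB.
  apply: le_Rintegral => //.
  - by rewrite (_ : EFin \o _ = (fun w => `|(W t w * W t w - W s w * W s w)%:E|)%E) //;
      apply: integrable_abse; exact: integrableRB.
  - by apply: integrableRD; exact: integrableRZ.
  move=> w _; move: (W s w) (W t w) => a b.
  have ei : 0 < e^-1 by rewrite invr_gt0.
  have p1 : e * b ^+ 2 - 2 * b * (a - b) + e^-1 * (a - b) ^+ 2 = e^-1 * (e * b - (a - b)) ^+ 2.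
    by field; rewrite gt_eqF.
  have p2 : e * b ^+ 2 + 2 * b * (a - b) + e^-1 * (a - b) ^+ 2 = e^-1 * (e * b + (a - b)) ^+ 2.
    by field; rewrite gt_eqF.
  have q1 : 0 <= e^-1 * (e * b - (a - b)) ^+ 2 by rewrite mulr_ge0 ?sqr_ge0 // ltW.
  have q2 : 0 <= e^-1 * (e * b + (a - b)) ^+ 2 by rewrite mulr_ge0 ?sqr_ge0 // ltW.
  rewrite -p1 in q1; rewrite -p2 in q2; have q3 := sqr_ge0 (a - b).
  by rewrite ler_norml; apply/andP; split; lra.
apply/cvgrPdist_le => e e0.
(* [e' * sigma2 t <= e / 2]; the coefficient of [v] is then fixed, and [v] is
   made small along the sequence *)
pose e' := e / (2 * (sigma2 t + 1)).
have e'0 : 0 < e' by rewrite divr_gt0 // mulr_gt0 // ltr_wpDl.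
have hb : 0 < 1 + e'^-1 by rewrite addr_gt0 // invr_gt0.
move/cvgrPdist_le : v0 => /(_ (e / (2 * (1 + e'^-1)))) [].
  by rewrite divr_gt0 // mulr_gt0.
move=> N _ hN; exists N => // n /hN /=; rewrite sub0r normrN ger0_norm; last by case: (v_exp (u n) t).
move=> hv; apply: le_trans (bound e' (u n) e'0) _.
have h1 : e' * sigma2 t <= e / 2.
  have st0 : 0 < sigma2 t + 1 by rewrite ltr_wpDl.
  have -> : e' * sigma2 t = e / 2 * (sigma2 t / (sigma2 t + 1)).
    by rewrite /e'; field; rewrite gt_eqF.
  by rewrite ler_piMr ?divr_ge0 ?(ltW e0) // ler_pdivrMr // mul1r lerDl.
have h2 : (1 + e'^-1) * v (u n) t <= e / 2.
  apply: le_trans (ler_wpM2l (ltW hb) hv) _.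
  rewrite le_eqVlt; apply/orP; left; apply/eqP; field.
  by rewrite (gt_eqF e'0) /= gt_eqF // addr_gt0.
lra.
Qed.

End variance_continuous.

(** * The space of continuous paths *)
Section path_space.
Context (R : realType) (d : nat).

Definition path : Type := {f : 'rV[R]_d -> R | continuous f}.

HB.instance Definition _ := gen_eqMixin path.
HB.instance Definition _ := gen_choiceMixin path.
Let continuous_zero : continuous (fun _ : 'rV[R]_d => 0 : R).
Proof. exact: cst_continuous. Qed.

HB.instance Definition _ := isPointed.Build path (exist _ _ continuous_zero).

(** Generators of the sigma-algebra that makes all evaluations measurable. *)
Definition evaluation_sets : set (set path) :=
  [set A | exists t (B : set R), measurable B /\ A = [set f | B (sval f t)]].

Definition pathM := g_sigma_algebraType evaluation_sets.

Lemma measurable_evaluation t : measurable_fun setT (fun f : pathM => sval f t).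
Proof.
by move=> _ B mB; rewrite setTI; apply: sub_sigma_algebra; exists t, B.
Qed.

Lemma measurable_fun_path dO (O : measurableType dO) (g : O -> pathM) :
  (forall t, measurable_fun setT (fun w => sval (g w) t)) -> measurable_fun setT g.
Proof.
move=> mg; apply: (measurability (evaluation_sets : set (set pathM))) => //.
move=> _ [_ [t [B [mB ->]]] <-]; exact: mg.
Qed.

Lemma path_preimage_sigma_of dO (O : measurableType dO) (X : 'rV[R]_d -> O -> R)
    (g : O -> pathM) :
  (forall t, exists f : R -> R, measurable_fun setT f /\
    forall w, sval (g w) t = f (X t w)) ->
  forall A, measurable A -> sigma_of setT X (g @^-1` A).
Proof.
move=> gX A mA.
pose O' := g_sigma_algebraType
  (\bigcup_(t in setT) preimage_set_system setT (X t) measurable).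
have mX t : measurable_fun setT (X t : O' -> R).
  by move=> _ B mB; apply: sub_sigma_algebra; exists t => //; exists B.
have mg : measurable_fun setT (g : O' -> pathM).
  apply: measurable_fun_path => t; have [f [mf gf]] := gX t.
  rewrite (_ : (fun w => _) = f \o X t); first exact: measurableT_comp.
  by apply/funext => w; exact: gf.
by have := mg measurableT A mA; rewrite setTI.
Qed.

Let cylinder n (t : 'I_n -> 'rV[R]_d) (B : set (n.-tuple R)) : set pathM :=
  [set f : path | B [tuple sval f (t k) | k < n]].

Let measurable_cylinder n t (B : set (n.-tuple R)) :
  measurable B -> measurable (cylinder t B).
Proof.
move=> mB.
have mt : measurable_fun setT (fun f : pathM => [tuple sval f (t k) | k < n]).
  apply/measurable_fun_tnthP => k.
  rewrite (_ : _ \o _ = fun f : pathM => sval f (t k)); first exact: measurable_evaluation.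
  by apply/funext => f /=; rewrite tnth_mktuple.
by have := mt measurableT B mB; rewrite setTI.
Qed.

(** The cylinder sets generate and are stable under intersection, by
    concatenating their index tuples. *)
Lemma path_measure_unique (m1 m2 : {measure set pathM -> \bar R}) :
  (m1 setT < +oo)%E ->
  (forall n (t : 'I_n -> 'rV[R]_d) (B : set (n.-tuple R)), measurable B ->
    m1 [set f : path | B [tuple sval f (t k) | k < n]] =
    m2 [set f : path | B [tuple sval f (t k) | k < n]]) ->
  forall A, measurable A -> m1 A = m2 A.
Proof.
move=> fin m12.
pose G : set (set pathM) := [set A | exists n t B, measurable B /\ A = @cylinder n t B].
apply: (measure_unique G (fun=> setT)) => //.
- apply/seteqP; split; last first.
    apply: smallest_sub; first exact: sigma_algebra_measurable.
    by move=> _ [n [t [B [mB ->]]]]; exact: measurable_cylinder.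
  apply: smallest_sub; first exact: smallest_sigma_algebra.
  move=> _ [t [B [mB ->]]]; apply: sub_sigma_algebra.
  exists 1%N, (fun=> t), [set x | B (tnth x ord0)]; split.
    by have := @measurable_tnth _ R 1 ord0 measurableT B mB; rewrite setTI.
  by apply/seteqP; split => f /=; rewrite /cylinder /= tnth_mktuple.
- move=> _ _ [n1 [t1 [B1 [mB1 ->]]]] [n2 [t2 [B2 [mB2 ->]]]].
  pose t (k : 'I_(n1 + n2)) := match fintype.split k with inl i => t1 i | inr j => t2 j end.
  pose p1 (x : (n1 + n2).-tuple R) := [tuple tnth x (lshift n2 k) | k < n1].
  pose p2 (x : (n1 + n2).-tuple R) := [tuple tnth x (rshift n1 k) | k < n2].
  exists (n1 + n2)%N, t, (p1 @^-1` B1 `&` p2 @^-1` B2); split.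
    have m1' : measurable_fun setT p1.
      apply/measurable_fun_tnthP => k.
      rewrite (_ : _ \o _ = fun x : (n1 + n2).-tuple R => tnth x (lshift n2 k)).
        exact: measurable_tnth.
      by apply/funext => f /=; rewrite tnth_mktuple.
    have m2' : measurable_fun setT p2.
      apply/measurable_fun_tnthP => k.
      rewrite (_ : _ \o _ = fun x : (n1 + n2).-tuple R => tnth x (rshift n1 k)).
        exact: measurable_tnth.
      by apply/funext => f /=; rewrite tnth_mktuple.
    apply: measurableI.
      by have := m1' measurableT B1 mB1; rewrite setTI.
    by have := m2' measurableT B2 mB2; rewrite setTI.
  have e1 (f : path) : p1 [tuple sval f (t k) | k < n1 + n2] = [tuple sval f (t1 k) | k < n1].
    by apply: eq_from_tnth => k; rewrite !tnth_mktuple /t (unsplitK (inl k)).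
  have e2 (f : path) : p2 [tuple sval f (t k) | k < n1 + n2] = [tuple sval f (t2 k) | k < n2].
    by apply: eq_from_tnth => k; rewrite !tnth_mktuple /t (unsplitK (inr k)).
  by apply/seteqP; split => f /=; rewrite /cylinder /= e1 e2.
- move=> _; exists 0%N, (fun=> 0), setT; split => //.
- by rewrite bigcup_const //; exists 0%N.
- by move=> _ [n [t [B [mB ->]]]]; exact: m12.
Qed.

Variables (sigma2 : 'rV[R]_d -> R) (sigma2_cont : continuous sigma2).

Section drifted_path.
Context dO (O : measurableType dO) (P : probability O R).
Variables (W : 'rV[R]_d -> {RV P >-> R}) (W_continuous : sample_continuous W).
Local Notation V := (drifted W sigma2).

Lemma continuous_drifted w : continuous (fun t => V t w).
Proof.
have h1 := @W_continuous w; move=> t.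
apply: (@cvgB _ _ _ (nbhs t) _ (fun t => W t w) (fun t => sigma2 t / 2)).
  exact: h1.
by apply: cvgM; [exact: sigma2_cont|exact: cvg_cst].
Qed.

Definition drifted_path (w : O) : pathM := exist _ _ (@continuous_drifted w).

Lemma measurable_drifted_path : measurable_fun setT drifted_path.
Proof. by apply: measurable_fun_path => t; exact: measurable_drifted. Qed.

Lemma drifted_path_sigma_of A : measurable A ->
  sigma_of setT (fun t => W t : O -> R) (drifted_path @^-1` A).
Proof.
apply: path_preimage_sigma_of => t.
by exists (fun x => x - sigma2 t / 2); split => //; exact: measurable_funB.
Qed.

Lemma continuous_shifted s w : continuous (fun t : 'rV[R]_d => V (t + s) w).
Proof.
have h := @continuous_drifted w; move=> t.
apply: (cvg_comp (fun t : 'rV[R]_d => t + s) (fun t => V t w)); last exact: h.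
have F : Filter (nbhs t) by exact: nbhs_filter.
by apply: (@cvgD _ 'rV[R]_d _ (nbhs t) F idfun (fun=> s));
  [exact: cvg_id|exact: cvg_cst].
Qed.

Definition shifted_path s (w : O) : pathM := exist _ _ (@continuous_shifted s w).

Lemma continuous_increment s w : continuous (fun t : 'rV[R]_d => V (t + s) w - V s w).
Proof.
have h := @continuous_shifted s w; move=> t.
apply: (@cvgB _ _ _ (nbhs t) _ (fun t => V (t + s) w) (fun _ => V s w)).
  exact: h.
exact: cvg_cst.
Qed.

Definition increment_path s (w : O) : pathM := exist _ _ (@continuous_increment s w).

Lemma measurable_increment_path s : measurable_fun setT (increment_path s).
Proof.
by apply: measurable_fun_path => t; apply: measurable_funB; exact: measurable_drifted.
Qed.

End drifted_path.

Lemma drifted_path_law dO (O : measurableType dO) (P : probability O R)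
    (W : 'rV[R]_d -> {RV P >-> R}) (cW : sample_continuous W)
    dO' (O' : measurableType dO') (P' : probability O' R)
    (W' : 'rV[R]_d -> {RV P' >-> R}) (cW' : sample_continuous W') :
  eq_fdd P (fun t => W t : O -> R) P' (fun t => W' t : O' -> R) ->
  forall A, measurable A -> P (drifted_path cW @^-1` A) = P' (drifted_path cW' @^-1` A).
Proof.
move=> [_ _ WW'] A mA.
rewrite -(image_measureE P (measurable_drifted_path cW)).
rewrite -(image_measureE P' (measurable_drifted_path cW')).
apply: path_measure_unique mA.
  rewrite image_measureE; apply: le_lt_trans (ltry 1).
  by apply: probability_le1; rewrite preimage_setT.
move=> n t B mB; rewrite !image_measureE.
pose shift (x : n.-tuple R) := [tuple tnth x k - sigma2 (t k) / 2 | k < n].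
have mshift : measurable_fun setT shift.
  apply/measurable_fun_tnthP => k.
  rewrite (_ : _ \o _ = fun x : n.-tuple R => tnth x k - sigma2 (t k) / 2).
    by apply: measurable_funB => //; exact: measurable_tnth.
  by apply/funext => x /=; rewrite tnth_mktuple.
have mB' : measurable (shift @^-1` B).
  by have := mshift measurableT B mB; rewrite setTI.
have := WW' n t _ mB'; congr (_ = _); congr (_ _); apply/seteqP; split => w /=.
- rewrite (_ : shift _ = [tuple drifted W sigma2 (t k) w | k < n]) //.
  by apply: eq_from_tnth => k; rewrite !tnth_mktuple.
- rewrite (_ : shift _ = [tuple drifted W sigma2 (t k) w | k < n]) //.
  by apply: eq_from_tnth => k; rewrite !tnth_mktuple.
- rewrite (_ : shift _ = [tuple drifted W' sigma2 (t k) w | k < n]) //.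
  by apply: eq_from_tnth => k; rewrite !tnth_mktuple.
- rewrite (_ : shift _ = [tuple drifted W' sigma2 (t k) w | k < n]) //.
  by apply: eq_from_tnth => k; rewrite !tnth_mktuple.
Qed.

(** Shift invariance of the measure governing the drifted paths: adding a
    constant to a path multiplies [H] by an exponential weight, so the value of
    [H] at the path seen from [s] is an integral of the increments from [s]
    against the tilted measure at [s]. *)
Lemma drifted_path_shift dO (O : measurableType dO) (P : probability O R)
    (W : 'rV[R]_d -> {RV P >-> R}) (gamma : 'rV[R]_d -> R) (cW : sample_continuous W)
    (Wg : gaussian_field W) (Wm : has_mean_zero W) (Ws : intrinsically_stationary W)
    (Wv : has_variogram W gamma) (Wr : has_variance W sigma2)
    (H : pathM -> \bar R) (mH : measurable_fun setT H) (H0 : forall f, (0 <= H f)%E)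
    (HZ : forall (f g : path) (c : R), (forall t, sval g t = sval f t + c) ->
      H g = ((expR c)%:E * H f)%E) (s s' : 'rV[R]_d) :
  (\int[P]_w H (shifted_path cW s w) = \int[P]_w H (shifted_path cW s' w))%E.
Proof.
have key x : (\int[P]_w H (shifted_path cW x w) =
    \int[image_measure (tilt W sigma2 x) (measurable_increment_path cW x)]_f H f)%E.
  rewrite ge0_integral_image_measure // (@ge0_integral_tilt _ _ _ _ _ W sigma2 x
    (fun w => H (increment_path cW x w))) //; last first.
    by apply: (measurableT_comp mH); exact: measurable_increment_path.
  apply: eq_integral => w _; rewrite muleC; apply: HZ => t /=.
  by rewrite subrK.
rewrite !key; apply: eq_measure_integral => A mA _; apply: path_measure_unique mA.
  by rewrite image_measureE preimage_setT; exact: (tilt_finite Wg Wm Ws Wv Wr).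
move=> n t B mB; rewrite !image_measureE.
exact: (tilted_law Wg Wm Ws Wv Wr Wg Wm Ws Wv Wr).
Qed.

End path_space.

(** * Lexicographic minima *)
Section lexicographic_order.
Context (R : realType) (d : nat).
Implicit Types (s t h : 'rV[R]_d) (Z : set 'rV[R]_d).

Lemma lexi_le_anti s t : lexi_le s t -> lexi_le t s -> s = t.
Proof.
move=> st ts; have E : ([tuple s ord0 l | l < d] : d.-tuplelexi R) =
    [tuple t ord0 l | l < d] by apply/le_anti/andP.
by apply/rowP => l; have := congr1 (fun x => tnth x l) E; rewrite !tnth_mktuple.
Qed.

Lemma lexi_leD s t h : lexi_le s t -> lexi_le (s + h) (t + h).
Proof.
move=> /lexi_tupleP[k hk]; apply/lexi_tupleP; exists k => i ik.
have := hk i ik; rewrite !tnth_mktuple !mxE => -[h1 h2]; split; first by rewrite lerD2r.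
by rewrite -h2; apply/eqP/eqP => [/addIr //|->].
Qed.

Lemma lexi_ltP s t : ~~ lexi_le t s ->
  exists2 k : 'I_d, (forall i : 'I_d, (i < k)%N -> s ord0 i = t ord0 i) & s ord0 k < t ord0 k.
Proof.
rewrite /lexi_le -ltNge => /ltxi_tupleP[k hk]; exists k => [i ik|].
  have [_ /esym] := hk i (ltnW ik); rewrite !tnth_mktuple neq_ltn ik /= => /esym/eqP.
  by [].
have [h1 h2] := hk k (leqnn k); rewrite !tnth_mktuple eqxx in h1 h2.
by rewrite lt_neqAle h2 h1.
Qed.

Lemma lexi_lt_first s t (k : 'I_d) :
  (forall i : 'I_d, (i < k)%N -> s ord0 i = t ord0 i) -> s ord0 k < t ord0 k ->
  ~~ lexi_le t s.
Proof.
move=> eq_st lt_st; rewrite /lexi_le -ltNge; apply/ltxi_tupleP; exists k => i.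
rewrite !tnth_mktuple leq_eqVlt => /predU1P[/val_inj ->|ik].
  by rewrite eqxx; split; [exact: ltW|exact: lt_eqF].
by rewrite neq_ltn ik eq_st //; split => //; exact: eqxx.
Qed.

(** After [d] steps only the lexicographic minimum is left. Each step preserves
    compactness, which gives existence, and can be enforced by a penalty, which
    gives measurability. *)
Fixpoint coord_min Z (k : nat) : set 'rV[R]_d :=
  if k is k'.+1 then
    [set s | coord_min Z k' s /\ forall t, coord_min Z k' t ->
       forall i : 'I_d, i = k' :> nat -> s ord0 i <= t ord0 i]
  else Z.

Lemma coord_min_sub Z k : coord_min Z k `<=` Z.
Proof. by elim: k => [//|k IH] s [/IH]. Qed.

Lemma coord_min_lexi_min Z : coord_min Z d = lexi_min Z.
Proof.
have le_le k s t : coord_min Z k s -> Z t ->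
    (forall i : 'I_d, (i < k)%N -> t ord0 i = s ord0 i) -> coord_min Z k t.
  elim: k => [//|k IH] [sk smin] Zt ts; split.
    by apply: IH => // i ik; apply: ts; exact: ltnW.
  by move=> u uk i ik; rewrite ts ?ik //; exact: smin.
apply/seteqP; split => s.
  move=> sd; split; first exact: coord_min_sub sd.
  move=> t Zt; apply: contraPT sd => /lexi_ltP[k eq_k lt_k] sd.
  have sub j : (j <= d)%N -> coord_min Z j s.
    by move=> /subnK jd; move: sd; rewrite -jd; elim: (d - j)%N => // i IH [/IH].
  have [sk smin] := sub k.+1 (ltn_ord k).
  have tk : coord_min Z k t by exact: (le_le _ s).
  by have := smin t tk k erefl; rewrite leNgt lt_k.
move=> [Zs smin].
suff : forall k, coord_min Z k s by exact.
elim=> [//|k IH]; split => // t tk i ik.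
rewrite leNgt; apply/negP => lt_ts.
have agree j : coord_min Z j s -> coord_min Z j t ->
    forall l : 'I_d, (l < j)%N -> t ord0 l = s ord0 l.
  elim: j => [//|j IHj] [sj sm] [tj tm] l; rewrite ltnS leq_eqVlt => /predU1P[lj|lj].
    by apply/eqP; rewrite eq_le tm // sm.
  exact: IHj.
have /smin : Z t by exact: coord_min_sub tk.
apply/negP/(@lexi_lt_first _ _ i) => // l; rewrite ik => lk.
exact: (agree k).
Qed.

Lemma compact_norm_le (r : R) : compact [set s : 'rV[R]_d | `|s| <= r].
Proof.
apply: bounded_closed_compact.
  by exists r; split; [exact: num_real|move=> x rx y /= yr; exact: le_trans yr (ltW rx)].
have -> : [set s : 'rV[R]_d | `|s| <= r] = Num.norm @^-1` [set x | x <= r] by [].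
by apply: preimage_closed; [move=> x _; exact: norm_continuous|exact: closed_le].
Qed.

Lemma coord_min_compact Z k : compact Z -> Z !=set0 ->
  compact (coord_min Z k) /\ coord_min Z k !=set0.
Proof.
move=> cZ nZ; elim: k => [//|k [cZk nZk]] /=.
have [kd|kd] := ltnP k d; last first.
  rewrite (_ : [set s | _] = coord_min Z k) //; apply/seteqP; split => [s []//|s sk].
  by split => // t _ i ik; move: (ltn_ord i); rewrite ik ltnNge kd.
pose l := Ordinal kd.
have [s sZ smin] : exists2 s, s \in coord_min Z k &
    forall t, t \in coord_min Z k -> s ord0 l <= t ord0 l.
  apply: (compact_EVT_min (f := fun s : 'rV[R]_d => s ord0 l)) => //.
  by apply: continuous_subspaceT; exact: coord_continuous.
rewrite inE in sZ.
have E : [set s | coord_min Z k s /\ forall t, coord_min Z k t ->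
       forall i : 'I_d, i = k :> nat -> s ord0 i <= t ord0 i] =
    coord_min Z k `&` (fun t : 'rV[R]_d => t ord0 l) @^-1` [set x | x <= s ord0 l].
  apply/seteqP; split => t /=.
    by move=> [tk tmin]; split => //; exact: tmin.
  move=> [tk tl]; split => // u uk i ik.
  have -> : i = l by apply/val_inj.
  by apply: le_trans tl _; apply: smin; rewrite inE.
rewrite E; split.
  apply: compact_closedI => //; apply: preimage_closed; last exact: closed_le.
  by move=> x _; exact: coord_continuous.
by exists s; split => //=.
Qed.

Lemma lexi_min_exists Z : compact Z -> Z !=set0 -> lexi_min Z !=set0.
Proof. by move=> cZ nZ; rewrite -coord_min_lexi_min; case: (coord_min_compact d cZ nZ). Qed.

Lemma lexi_min_unique Z s t : lexi_min Z s -> lexi_min Z t -> s = t.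
Proof. by move=> [Zs smin] [Zt tmin]; apply: lexi_le_anti; [exact: smin|exact: tmin]. Qed.

End lexicographic_order.

(** * Zero sets of random fields *)
Section random_zero_set.
Context dO (O : measurableType dO) (R : realType) (d : nat).
Implicit Types (g : 'rV[R]_d -> O -> R) (w : O) (s t : 'rV[R]_d).

Definition rational_point (n : nat) : 'rV[R]_d :=
  map_mx ratr (odflt 0 (choice.unpickle n : option 'rV[rat]_d)).

Lemma rational_point_dense (f : 'rV[R]_d -> R) s (e : R) : continuous f -> 0 < e ->
  exists n, `|f s - f (rational_point n)| < e.
Proof.
move=> cf e0; have /cvgrPdist_lt/(_ e e0)/nbhs_ballP[r /= r0 hr] := cf s.
have hq (j : 'I_d) : exists q : rat, ratr q \in `]s ord0 j - r, s ord0 j + r[.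
  by apply: rat_in_itvoo; lra.
pose v : 'rV[rat]_d := \row_j sval (cid (hq j)).
exists (choice.pickle v); rewrite /rational_point choice.pickleK /=; apply: hr; split => // i j.
rewrite !mxE ord1; case: (cid (hq j)) => q /=; rewrite in_itv /= => hq'.
by rewrite /ball /= ltr_norml; lra.
Qed.

Lemma measurable_of_sublevels (m : O -> R) :
  (forall b, measurable [set w | m w <= b]) -> measurable_fun setT m.
Proof.
move=> mb; apply: (measurability (RGenOInfty.G (R := R))).
  exact: RGenOInfty.measurableE.
move=> _ [_ [x ->] <-]; rewrite setTI.
rewrite (_ : _ @^-1` _ = ~` [set w | m w <= x]); first exact: measurableC.
by apply/seteqP; split => w /=; rewrite in_itv /= andbT ltNge => /negP.
Qed.

(** The linear growth, uniform in [w], confines all zeros to a fixed ball. *)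
Definition coercive_field g :=
  [/\ forall s, measurable_fun setT (g s), forall w, continuous (g ^~ w),
      forall s w, 0 <= g s w & exists r, forall s w, `|s| - r <= g s w].

Definition zeros g w : set 'rV[R]_d := [set s | g s w = 0].

Lemma zeros_compact g w : coercive_field g -> compact (zeros g w).
Proof.
move=> [_ cg g0 [r gr]].
rewrite (_ : zeros g w = [set s | `|s| <= r] `&` (g ^~ w) @^-1` [set x | x = 0]).
  apply: compact_closedI; first exact: compact_norm_le.
  by apply: preimage_closed; [move=> x _; exact: cg|exact: closed_eq].
apply/seteqP; split => s /=; rewrite /zeros /=; last by case.
by move=> gs; split => //; have := gr s w; rewrite gs; lra.
Qed.

(** By coercivity and compactness a zero exists as soon as the infimum over
    the rational points is [0]. *)
Lemma measurable_has_zero g : coercive_field g -> measurable [set w | zeros g w !=set0].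
Proof.
move=> [mg cg g0 [r gr]].
rewrite (_ : [set w | _] =
  \bigcap_k \bigcup_n [set w | g (rational_point n) w < k.+1%:R^-1]).
  apply: bigcapT_measurable => k; apply: bigcupT_measurable => n.
  rewrite -[X in measurable X]setTI; apply: measurable_fun_ltr => //.
apply/seteqP; split => w /=.
  move=> [s sz] k _.
  have k0 : 0 < k.+1%:R^-1 :> R by rewrite invr_gt0.
  have [n] := rational_point_dense s (cg w) k0.
  by rewrite [g s w]sz sub0r normrN ger0_norm // => hn; exists n.
move=> hw; pose A := [set s : 'rV[R]_d | `|s| <= r + 1].
have qA k n : g (rational_point n) w < k.+1%:R^-1 -> A (rational_point n).
  move=> hn; rewrite /A /=; have := gr (rational_point n) w.
  have k1 : k.+1%:R^-1 <= 1 :> R by rewrite invf_le1 ?ler1n.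
  by rewrite lerBlDl => /le_trans; apply; rewrite lerD2l ltW // (lt_le_trans hn).
have [s sA smin] : exists2 s, s \in A & forall t, t \in A -> g s w <= g t w.
  apply: (compact_EVT_min (f := g ^~ w)).
  - by have [n _ /qA hn] := hw 0%N I; exists (rational_point n).
  - exact: compact_norm_le.
  - by apply: continuous_subspaceT; exact: cg.
exists s; apply/eqP; rewrite eq_le g0 andbT; apply/ler_addgt0Pl => e e0; rewrite addr0.
have /cvgrPdist_lt/(_ e e0)[k _ /(_ k (leqnn k))] := @cvg_harmonic R.
rewrite /= sub0r normrN ger0_norm ?invr_ge0 // => ke.
have [n _ /= hn] := hw k I.
apply: le_trans (ltW (lt_trans hn ke)); apply: smin; rewrite inE; exact: qA hn.
Qed.

Let coord_cont (l : 'I_d) : continuous (fun t : 'rV[R]_d => t ord0 l).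
Proof. exact: coord_continuous. Qed.

Definition min_coord g (l : 'I_d) w : R := inf [set s ord0 l | s in zeros g w].

Let min_coord_attained g l w : coercive_field g -> zeros g w !=set0 ->
  exists s, [/\ zeros g w s, forall t, zeros g w t -> s ord0 l <= t ord0 l &
    min_coord g l w = s ord0 l].
Proof.
move=> cg nz.
have [s sZ smin] : exists2 s, s \in zeros g w &
    forall t, t \in zeros g w -> s ord0 l <= t ord0 l.
  apply: (compact_EVT_min (f := fun s : 'rV[R]_d => s ord0 l)) => //.
    exact: zeros_compact.
  by apply: continuous_subspaceT; exact: coord_continuous.
rewrite inE in sZ.
have {}smin t : zeros g w t -> s ord0 l <= t ord0 l by move=> ?; apply: smin; rewrite inE.
exists s; split => //; apply/eqP; rewrite eq_le; apply/andP; split.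
  apply: ge_inf; last by exists s.
  by exists (s ord0 l) => _ [t /smin ? <-].
by apply: lb_le_inf; [exists (s ord0 l), s|move=> _ [t /smin ? <-]].
Qed.

(** The minimal coordinate is at most [b] when [g] has a zero in a half-space,
    that is, when the sum of [g] and of a penalty that vanishes exactly on this
    half-space has a zero. *)
Lemma measurable_min_coord g l : coercive_field g -> measurable_fun setT (min_coord g l).
Proof.
move=> cg; apply: measurable_of_sublevels => b.
pose pen (s : 'rV[R]_d) := `|s ord0 l - b| + (s ord0 l - b).
have pen0 s : 0 <= pen s by rewrite -lerBlDr sub0r -normrN ler_norm.
have penE s : (pen s == 0) = (s ord0 l <= b).
  rewrite /pen addr_eq0 -subr_le0; apply/eqP/idP => [h|h]; last by rewrite ler0_norm.
  by rewrite -oppr_ge0 -h.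
pose gb s w := g s w + pen s.
have cgb : coercive_field gb.
  have [mg ctg g0 [r gr]] := cg; split.
  - by move=> s; apply: measurable_funD.
  - move=> w s.
    have hb : (fun t : 'rV[R]_d => t ord0 l - b) @ s --> s ord0 l - b.
      apply: (@cvgB _ _ _ (nbhs s) _ (fun t : 'rV[R]_d => t ord0 l) (fun=> b)).
        exact: coord_cont.
      exact: cvg_cst.
    apply: (@cvgD _ _ _ (nbhs s) _ (g ^~ w) pen); first exact: ctg.
    by apply: (@cvgD _ _ _ (nbhs s) _ (fun t => `|t ord0 l - b|)) => //; exact: cvg_norm.
  - by move=> s w; rewrite addr_ge0.
  - by exists r => s w; apply: (le_trans (gr s w)); rewrite lerDl.
pose N := [set w | zeros g w !=set0].
(* without zeros the infimum is that of the empty set, which is [0] *)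
rewrite (_ : [set w | _] = (N `&` [set w | zeros gb w !=set0]) `|` (~` N `&` [set _ | 0 <= b])).
  have mN : measurable N by exact: measurable_has_zero.
  apply: measurableU; apply: measurableI => //; first exact: measurable_has_zero.
    exact: measurableC.
  have [b0|b0] := leP 0 b; first by rewrite (_ : [set _ | _] = setT) //; apply/seteqP; split.
  by rewrite (_ : [set _ | _] = set0) //; apply/seteqP; split.
apply/seteqP; split => w /=.
  have [Nw|Nw] := pselect (N w).
    have [s [sz smin ->]] := min_coord_attained l cg Nw.
    move=> sb; left; split => //; exists s; rewrite /zeros /gb /= [g s w]sz add0r.
    by apply/eqP; rewrite penE.
  move=> mb; right; split => //.
  move: mb; rewrite /min_coord (_ : [set _ | _ in _] = set0) ?inf0 //.
  by apply/seteqP; split => // x [s sz _]; apply: Nw; exists s.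
move=> [[Nw [t]]|[Nw b0]].
  have [mg ctg g0 _] := cg.
  have [s [sz smin ->]] := min_coord_attained l cg Nw.
  rewrite /zeros /gb /= => /eqP; rewrite paddr_eq0 // penE => /andP[/eqP tz].
  by apply: le_trans; exact: smin.
rewrite /min_coord (_ : [set _ | _ in _] = set0) ?inf0 //.
by apply/seteqP; split => // x [s sz _]; apply: Nw; exists s.
Qed.

(** Successive penalization realizes [coord_min] among random zero sets. *)
Lemma coord_min_zeros g k : coercive_field g ->
  exists g', coercive_field g' /\ forall w, zeros g' w = coord_min (zeros g w) k.
Proof.
move=> cg; elim: k => [|k [h [ch hE]]]; first by exists g.
have [kd|kd] := ltnP k d; last first.
  exists h; split => // w; rewrite hE /=; apply/seteqP; split => [s sk|s []//].
  by split => // t _ i ik; move: (ltn_ord i); rewrite ik ltnNge kd.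
pose l := Ordinal kd.
have [mh cth h0 [r hr]] := ch.
exists (fun s w => h s w + `|s ord0 l - min_coord h l w|); split.
  split.
  - move=> s; apply: measurable_funD => //; apply: measurableT_comp => //.
    by apply: measurable_funB => //; exact: measurable_min_coord.
  - move=> w s.
    apply: (@cvgD _ _ _ (nbhs s) _ (h ^~ w) (fun t => `|t ord0 l - min_coord h l w|)).
      exact: cth.
    apply: cvg_norm.
    apply: (@cvgB _ _ _ (nbhs s) _ (fun t : 'rV[R]_d => t ord0 l) (fun=> min_coord h l w)).
      exact: coord_cont.
    exact: cvg_cst.
  - by move=> s w; rewrite addr_ge0.
  - by exists r => s w; apply: (le_trans (hr s w)); rewrite lerDl.
move=> w; apply/seteqP; split => s /=; rewrite -hE.
  rewrite {1}/zeros /= => /eqP; rewrite paddr_eq0 // normr_eq0 subr_eq0.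
  move=> /andP[/eqP sz /eqP sl]; split => // t tz i ik.
  have -> : i = l by apply/val_inj.
  have nz : zeros h w !=set0 by exists s.
  have [u [uz umin mu]] := min_coord_attained l ch nz.
  by rewrite sl mu; exact: umin.
move=> [sz smin]; rewrite /zeros /= [h s w]sz add0r.
have nz : zeros h w !=set0 by exists s.
have [u [uz umin ->]] := min_coord_attained l ch nz.
apply/eqP; rewrite normr_eq0 subr_eq0 eq_le umin // andbT.
exact: smin.
Qed.

(** The field given by [coord_min_zeros] has the smallest zero of [g] as its only
    zero, so the coordinates of this point are minimal coordinates. *)
Lemma measurable_lexi_min_zeros g : coercive_field g ->
  exists m : O -> 'rV[R]_d, (forall l, measurable_fun setT (fun w => m w ord0 l)) /\
    forall w, zeros g w !=set0 -> lexi_min (zeros g w) (m w).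
Proof.
move=> cg; have [h [ch hE]] := coord_min_zeros d cg.
exists (fun w => \row_l min_coord h l w); split.
  move=> l; under eq_fun do rewrite mxE; exact: measurable_min_coord.
move=> w nz.
have [s sm] : lexi_min (zeros g w) !=set0.
  by apply: lexi_min_exists => //; exact: zeros_compact.
have zE : zeros h w = [set s].
  rewrite hE coord_min_lexi_min; apply/seteqP; split => [t tm|_ ->//].
  exact: lexi_min_unique tm sm.
rewrite (_ : \row_l _ = s) //; apply/rowP => l; rewrite mxE.
have [|u [uz _ ->]] := min_coord_attained (w := w) l ch; first by rewrite zE; exists s.
by move: uz; rewrite zE => ->.
Qed.

End random_zero_set.

(** * The smallest maximizer of a random field *)
Section random_argsup.
Context dO (O : measurableType dO) (R : realType) (d : nat).
Variables (V : 'rV[R]_d -> O -> R).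
Hypotheses (mV : forall t, measurable_fun setT (V t))
  (cV : forall w, continuous (V ^~ w)).

(** [atan] makes the supremum finite without moving the maximizers. *)
Let top w := sup (range (fun n => atan (V (rational_point R d n) w))).

Let catan w : continuous (fun s => atan (V s w)).
Proof.
by move=> s; apply: continuous_comp; [exact: cV|exact: continuous_atan].
Qed.

Let atan_le (x : R) : atan x <= pi / 2. Proof. by rewrite ltW // atan_ltpi2. Qed.

Let top_ub w : ubound (range (fun n => atan (V (rational_point R d n) w))) (pi / 2).
Proof. by move=> _ [n _ <-]. Qed.

Let le_top s w : atan (V s w) <= top w.
Proof.
apply/ler_addgt0Pr => e e0.
have [n hn] := rational_point_dense s (@catan w) e0.
have : atan (V (rational_point R d n) w) <= top w.
  apply: ub_le_sup; last by exists n.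
  by exists (pi / 2); exact: top_ub.
by move: hn; rewrite ltr_norml; lra.
Qed.

Let measurable_top : measurable_fun setT top.
Proof.
apply: measurable_of_sublevels => b.
rewrite (_ : [set w | _] = \bigcap_n [set w | atan (V (rational_point R d n) w) <= b]).
  apply: bigcapT_measurable => n; rewrite -[X in measurable X]setTI.
  apply: measurable_fun_ler => //.
  apply: (measurableT_comp (f := atan)) => //.
  by apply: continuous_measurable_fun => x; exact: continuous_atan.
apply/seteqP; split => w /= h.
  by move=> n _; apply: le_trans h; exact: le_top.
apply: sup_le_ub; first by exists (atan (V (rational_point R d 0) w)); exists 0%N.
by move=> _ [n _ <-]; exact: h.
Qed.

Let argsupE s w : argsup (V ^~ w) s <-> top w - atan (V s w) = 0.
Proof.
split => [h|/eqP].
  apply/eqP; rewrite subr_eq0 eq_le le_top andbT.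
  apply: sup_le_ub; first by exists (atan (V (rational_point R d 0) w)); exists 0%N.
  by move=> _ [n _ <-]; apply: le_atan; exact: h.
rewrite subr_eq0 => /eqP h t; rewrite leNgt; apply/negP => /lt_atan.
by rewrite ltNge -h le_top.
Qed.

(** The penalty vanishes exactly on the ball of radius [n] and makes [g n]
    coercive: the zeros of [g n] are the maximizers in this ball. *)
Let pen (n : nat) (s : 'rV[R]_d) : R := `| `|s| - n%:R | + (`|s| - n%:R).
Let g n (s : 'rV[R]_d) w := (top w - atan (V s w)) + pen n s.

Let pen_ge0 n s : 0 <= pen n s.
Proof. by rewrite /pen; have := ler_norm (- (`|s| - n%:R)); rewrite normrN; lra. Qed.

Let pen_eq0 n s : (pen n s == 0) = (`|s| <= n%:R).
Proof.
rewrite /pen addr_eq0 -[RHS]subr_le0; apply/eqP/idP => [h|h]; last by rewrite ler0_norm.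
by rewrite -oppr_ge0 -h.
Qed.

Let coercive_g n : coercive_field (g n).
Proof.
split.
- move=> s; apply: measurable_funD => //; apply: measurable_funB => //.
  apply: (measurableT_comp (f := atan)) => //.
  by apply: continuous_measurable_fun => x; exact: continuous_atan.
- move=> w s.
  apply: (@cvgD _ _ _ (nbhs s) _ (fun s => top w - atan (V s w)) (pen n)).
    apply: (@cvgB _ _ _ (nbhs s) _ (fun=> top w) (fun s => atan (V s w))).
      exact: cvg_cst.
    exact: catan.
  have h : (fun t : 'rV[R]_d => `|t| - n%:R) @ s --> `|s| - n%:R.
    apply: (@cvgB _ _ _ (nbhs s) _ (fun t : 'rV[R]_d => `|t|) (fun=> n%:R)).
      exact: norm_continuous.
    exact: cvg_cst.
  apply: (@cvgD _ _ _ (nbhs s) _ (fun t : 'rV[R]_d => `| `|t| - n%:R |)) => //.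
  exact: cvg_norm.
- by move=> s w; rewrite addr_ge0 // subr_ge0.
- exists n%:R => s w; rewrite /g /pen addrA lerDr addr_ge0 // subr_ge0.
  exact: le_top.
Qed.

Let zeros_g n w : zeros (g n) w = argsup (V ^~ w) `&` [set s | `|s| <= n%:R].
Proof.
apply/seteqP; split => s.
  rewrite /zeros /= => /eqP; rewrite paddr_eq0 ?subr_ge0 ?le_top // pen_eq0.
  by move=> /andP[/eqP h sn]; split => //; apply/argsupE.
move=> [/argsupE h sn]; rewrite /zeros /= /g h add0r.
by apply/eqP; rewrite pen_eq0.
Qed.

(** The smallest maximizers in the balls of radius [n] are eventually constant
    exactly when there is a smallest maximizer. *)
Let measurable_lexi_min_in (B : set 'rV[R]_d) :
  (forall m : O -> 'rV[R]_d, (forall l, measurable_fun setT (fun w => m w ord0 l)) ->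
     measurable [set w | B (m w)]) ->
  measurable [set w | lexi_min (argsup (V ^~ w)) `&` B !=set0].
Proof.
move=> mB.
have /choice[m hm] : forall n, exists m : O -> 'rV[R]_d,
    (forall l, measurable_fun setT (fun w => m w ord0 l)) /\
    forall w, zeros (g n) w !=set0 -> lexi_min (zeros (g n) w) (m w).
  by move=> n; exact: measurable_lexi_min_zeros.
pose N n := [set w | zeros (g n) w !=set0].
rewrite (_ : [set w | _] = \bigcup_n ((\bigcap_k
   (N (n + k)%N `&` [set w | m (n + k)%N w = m n w])) `&` [set w | B (m n w)])).
  apply: bigcupT_measurable => n; apply: measurableI; last by apply: mB; case: (hm n).
  apply: bigcapT_measurable => k; apply: measurableI.
    exact: measurable_has_zero.
  rewrite (_ : [set w | _] = \big[setI/setT]_(l < d) [set w | m (n + k)%N w ord0 l = m n w ord0 l]).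
    apply: bigsetI_measurable => l _.
    rewrite (_ : [set w | _] =
       (fun w => m (n + k)%N w ord0 l - m n w ord0 l) @^-1` [set 0]).
      rewrite -[X in measurable X]setTI; apply: measurable_funB => //.
        by case: (hm (n + k)%N).
      by case: (hm n).
    apply/seteqP; split => w /=; first by move=> ->; rewrite subrr.
    by move/eqP; rewrite subr_eq0 => /eqP.
  rewrite -bigcap_seq; apply/seteqP; split => w /= h.
    by move=> l _ /=; rewrite h.
  by apply/rowP => l; apply: h; rewrite /= mem_index_enum.
apply/seteqP; split => w /=.
  move=> [s [[sA smin] Bs]].
  have sn k : `|s| <= (Num.bound `|s| + k)%:R.
    apply: (@le_trans _ _ (Num.bound `|s|)%:R); last by rewrite ler_nat leq_addr.
    by rewrite ltW // archi_boundP.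
  have zs k : zeros (g (Num.bound `|s| + k)) w s by rewrite zeros_g; split => //; exact: sn.
  have ms k : m (Num.bound `|s| + k)%N w = s.
    have nz : zeros (g (Num.bound `|s| + k)) w !=set0 by exists s.
    apply: (lexi_min_unique ((hm (Num.bound `|s| + k)%N).2 w nz)).
    by split => // t; rewrite zeros_g => -[/smin].
  have m0 := ms 0%N; rewrite addn0 in m0.
  exists (Num.bound `|s|) => //; split; last by rewrite /= m0.
  by move=> k _; split; [exists s; exact: zs|rewrite /= ms m0].
move=> [n _ [hk Bm]].
exists (m n w); split => //.
have hmk k : lexi_min (zeros (g (n + k)%N) w) (m n w).
  have [nz /= <-] := hk k I; exact: (hm (n + k)%N).2.
split; first by have [] := hmk 0%N; rewrite zeros_g => -[].
move=> t tA; have [_] := hmk (Num.bound `|t|); apply; rewrite zeros_g; split => //=.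
rewrite (@le_trans _ _ (Num.bound `|t|)%:R) // ?ler_nat ?leq_addl //.
by rewrite ltW // archi_boundP.
Qed.

Lemma measurable_inf_argsup_in_box p :
  measurable [set w | half_open_box p (inf_argsup (V ^~ w))].
Proof.
have m1 : measurable [set w | lexi_min (argsup (V ^~ w)) `&` setT !=set0].
  by apply: measurable_lexi_min_in => m _; exact: measurableT.
have m2 : measurable [set w | lexi_min (argsup (V ^~ w)) `&` half_open_box p !=set0].
  apply: measurable_lexi_min_in => m mm.
  rewrite (_ : [set w | _] = \big[setI/setT]_(l < d)
     ((fun w => m w ord0 l) @^-1` `]- (p ord0 l / 2), p ord0 l / 2]%classic)).
    apply: bigsetI_measurable => l _; rewrite -[X in measurable X]setTI.
    by apply: mm => //; exact: measurable_itv.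
  rewrite -bigcap_seq; apply/seteqP; split => w /= h.
    by move=> l _ /=; rewrite in_itv /=; exact: h.
  by move=> l; have := h l; rewrite /= mem_index_enum in_itv /= => /(_ isT).
(* the default value [0] is taken on the complement of the first event *)
rewrite (_ : [set w | _] =
  [set w | lexi_min (argsup (V ^~ w)) `&` half_open_box p !=set0] `|`
  (~` [set w | lexi_min (argsup (V ^~ w)) `&` setT !=set0] `&`
     [set _ | half_open_box p 0])).
  apply: measurableU => //; apply: measurableI; first exact: measurableC.
  have [h|h] := pselect (half_open_box p 0).
    by rewrite (_ : [set _ | _] = setT) //; apply/seteqP; split.
  by rewrite (_ : [set _ | _] = set0) //; apply/seteqP; split.
apply/seteqP; split => w /=; rewrite /inf_argsup.
  case: xgetP => [s _ sm bs|nm b0]; first by left; exists s.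
  by right; split => // -[s [/nm]].
move=> [[s [sm bs]]|[nm b0]].
  by rewrite (xget_unique 0 sm) // => t tm; exact: lexi_min_unique tm sm.
by rewrite xgetPN // => s sm; apply: nm; exists s.
Qed.

End random_argsup.

Section argsup_shift.
Context (R : realType) (d : nat).
Implicit Types (f : 'rV[R]_d -> R) (s t h : 'rV[R]_d).

Lemma argsup_shift f h s : argsup (fun t => f (t + h)) s <-> argsup f (s + h).
Proof.
split => H t; last exact: H.
by have := H (t - h); rewrite subrK.
Qed.

(** Outside a ball [f] is below [f 0], so the maximizers form a nonempty compact
    set. *)
Lemma lexi_min_argsup_exists f : continuous f -> tends_to_ninfty_at_infinity f ->
  lexi_min (argsup f) !=set0.
Proof.
move=> cf fN; have [r hr] := fN (f 0).
pose A := [set s : 'rV[R]_d | `|s| <= Num.max r 0].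
have A0 : A 0 by rewrite /A /= normr0 le_max lexx orbT.
have [s sA smax] : exists2 s, s \in A & forall t, t \in A -> f t <= f s.
  apply: compact_EVT_max; [by exists 0|exact: compact_norm_le|].
  exact: continuous_subspaceT.
have outA t : ~ A t -> f t < f 0.
  by move=> /negP; rewrite -ltNge gt_max => /andP[/hr].
have amax : argsup f s.
  move=> t; have [tA|/outA ft] := pselect (A t); first by apply: smax; rewrite inE.
  by apply: le_trans (ltW ft) _; apply: smax; rewrite inE.
apply: lexi_min_exists; last by exists s.
have -> : argsup f = A `&` f @^-1` [set x | f s <= x].
  apply/seteqP; split => t /=.
    move=> ta; split; last exact: ta.
    by apply: contrapT => /outA; rewrite ltNge ta.
  by move=> [_ st] u; apply: le_trans st; exact: amax.
apply: compact_closedI; first exact: compact_norm_le.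
by apply: preimage_closed; [move=> x _; exact: cf|exact: closed_ge].
Qed.

Lemma inf_argsup_shift f h : lexi_min (argsup f) !=set0 ->
  inf_argsup (fun t => f (t + h)) = inf_argsup f - h.
Proof.
move=> [s sm].
have -> : inf_argsup f = s by apply: xget_unique => // t tm; exact: lexi_min_unique tm sm.
have hm : lexi_min (argsup (fun t => f (t + h))) (s - h).
  have [sA smin] := sm; split; first by apply/argsup_shift; rewrite subrK.
  move=> t /argsup_shift /smin /lexi_leD - /(_ (- h)); rewrite addrK.
  by [].
by apply: xget_unique => // t tm; exact: lexi_min_unique tm hm.
Qed.

Lemma argsup_addc f f' c : (forall t, f' t = f t + c) -> argsup f' = argsup f.
Proof.
move=> fE; apply/seteqP; split => s H t; have := H t; first by rewrite !fE lerD2r.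
by rewrite !fE lerD2r.
Qed.

End argsup_shift.

(** * Expectations of independent products *)
Section independent_products.
Local Open Scope ereal_scope.
Context dO (O : measurableType dO) (R : realType) (P : probability O R).
Variables (K : eqType) (F : K -> set (set O)) (A : K -> nat -> set O) (a : K -> nat -> R).
Hypotheses (a0 : forall k n, (0 <= a k n)%R) (FA : forall k n, F k (A k n)).
Hypothesis mF : forall k B, F k B -> measurable B.

Let f k w : \bar R := \sum_(n <oo) (a k n * \1_(A k n) w)%:E.

Let f0 k w : 0 <= f k w.
Proof. by apply: nneseries_ge0 => n _ _; rewrite lee_fin mulr_ge0. Qed.

Let mterm k n : measurable_fun setT (fun w => (a k n * \1_(A k n) w)%:E : \bar R).
Proof.
apply/measurable_EFinP; apply: measurable_funM => //; apply: measurable_indic.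
exact: mF (FA k n).
Qed.

Let mf k : measurable_fun setT (f k).
Proof.
apply: ge0_emeasurable_sum => //.
by move=> n w _ _; rewrite lee_fin mulr_ge0.
Qed.

Hypothesis f1 : forall k w, f k w <= 1.

Let prod_le1 (L : seq K) w : \prod_(k <- L) f k w <= 1.
Proof.
elim: L => [|k L IH]; first by rewrite big_nil.
rewrite big_cons -[leRHS]mule1; apply: lee_pmul => //.
by apply: prode_ge0 => l _; exact: f0.
Qed.

Let c k := \sum_(n <oo) ((a k n)%:E * P (A k n)).

Let c0 k : 0 <= c k.
Proof. by apply: nneseries_ge0 => n _ _; rewrite mule_ge0 // lee_fin. Qed.

Let c_fin k : c k \is a fin_num.
Proof.
rewrite ge0_fin_numE //; apply: le_lt_trans (ltry 1).
have -> : c k = \int[P]_w f k w.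
  rewrite integral_nneseries //; last by move=> n w _; rewrite lee_fin mulr_ge0.
  apply: eq_eseriesr => n _; under eq_integral do rewrite EFinM.
  have mA : measurable (A k n) by exact: mF (FA k n).
  rewrite ge0_integralZl_EFin //; last by apply/measurable_EFinP; exact: measurable_indic.
  by rewrite integral_indic // setIT.
apply: (@le_trans _ _ (\int[P]_w (cst 1) w)).
  by apply: ge0_le_integral.
by rewrite integral_cst // mul1e; exact: probability_le1.
Qed.

Let mprod (L : seq K) : measurable_fun setT (fun w => \prod_(k <- L) f k w).
Proof.
elim: L => [|k L IH]; first by under eq_fun do rewrite big_nil; exact: measurable_cst.
by under eq_fun do rewrite big_cons; exact: emeasurable_funM.
Qed.

Let prod0 (L : seq K) w : 0 <= \prod_(k <- L) f k w.
Proof. by apply: prode_ge0 => k _; exact: f0. Qed.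

(** One factor at a time is expanded into its level sets, which are moved to
    the family of events to which the product rule applies. *)
Lemma integral_prod_independent (L : seq K) : uniq L ->
  (forall B, (forall k, k \in L -> F k (B k)) ->
     P (\big[setI/setT]_(k <- L) B k) = \prod_(k <- L) P (B k)) ->
  \int[P]_w (\prod_(k <- L) f k w) =
  \prod_(k <- L) \sum_(n <oo) ((a k n)%:E * P (A k n)).
Proof.
move=> uL rule.
suff gen (L1 L2 : seq K) (B : K -> set O) : perm_eq (L1 ++ L2) L ->
    (forall k, k \in L2 -> F k (B k)) ->
    \int[P]_w (\prod_(k <- L1) f k w * (\1_(\big[setI/setT]_(k <- L2) B k) w)%:E) =
    \prod_(k <- L1) (\sum_(n <oo) ((a k n)%:E * P (A k n))) * \prod_(k <- L2) P (B k).
  have := gen L [::] (fun=> setT); rewrite cats0 => /(_ (perm_refl _)).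
  rewrite !big_nil mule1 => <- //; apply: eq_integral => w _.
  by rewrite indicT mule1.
elim: L1 L2 B => [|k L1 IH] L2 B pL FB.
  have mB : measurable (\big[setI/setT]_(k <- L2) B k).
    rewrite big_seq; apply: bigsetI_measurable => k kL.
    by apply: mF; exact: FB.
  rewrite big_nil mul1e; under eq_integral do rewrite big_nil mul1e.
  rewrite integral_indic // setIT (perm_big L) //= rule; last first.
    by move=> k; rewrite -(perm_mem pL) /=; exact: FB.
  by rewrite -(perm_big _ pL).
have kL2 : k \notin L2.
  by move: uL; rewrite -(perm_uniq pL) /= mem_cat negb_or => /andP[/andP[_ ->]].
pose G w := \prod_(k <- L1) f k w * (\1_(\big[setI/setT]_(k <- L2) B k) w)%:E.
have mB : measurable (\big[setI/setT]_(k <- L2) B k).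
  by rewrite big_seq; apply: bigsetI_measurable => l lL; apply: mF; exact: FB.
have mG : measurable_fun setT G.
  apply: emeasurable_funM => //; apply/measurable_EFinP; exact: measurable_indic.
have G0 w : 0 <= G w by rewrite mule_ge0 // lee_fin.
transitivity (\int[P]_w \sum_(n <oo) ((a k n * \1_(A k n) w)%:E * G w)).
  apply: eq_integral => w _; rewrite big_cons -muleA -/(G w).
  have Gfin : G w \is a fin_num.
    by rewrite /G fin_numM // ge0_fin_numE // (le_lt_trans (prod_le1 _ _)) ?ltry.
  rewrite -(fineK Gfin) muleC -nneseriesZl; last by move=> n _; rewrite lee_fin mulr_ge0.
  by apply: eq_eseriesr => n _; rewrite muleC.
rewrite integral_nneseries //; first last.
- by move=> n w _; rewrite mule_ge0 // lee_fin mulr_ge0.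
- by move=> n; apply: emeasurable_funM.
pose C := \prod_(l <- L1) c l * \prod_(l <- L2) P (B l).
have Cfin : C \is a fin_num.
  apply: fin_numM.
    by elim/big_ind : _ => [|x y|i _]; [by []|exact: fin_numM|exact: c_fin].
  rewrite big_seq; elim/big_ind : _ => [|x y|l lL]; [by []|exact: fin_numM|].
  by rewrite fin_num_measure //; apply: mF; exact: FB.
rewrite big_cons -muleA -/C -(fineK Cfin) muleC -nneseriesZl; last first.
  by move=> n _; rewrite mule_ge0 // lee_fin.
apply: eq_eseriesr => n _; rewrite (fineK Cfin).
pose B' l := if l == k then A k n else B l.
have E w : (a k n * \1_(A k n) w)%:E * G w =
    (a k n)%:E * (\prod_(k <- L1) f k w * (\1_(\big[setI/setT]_(l <- k :: L2) B' l) w)%:E).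
  rewrite EFinM -muleA; congr (_ * _); rewrite /G muleCA; congr (_ * _).
  rewrite big_cons {1}/B' eqxx indicI -EFinM; congr (_ * _)%:E.
  congr (\1_ _ w); rewrite !big_seq; apply: eq_bigr => l lL.
  by rewrite /B'; case: eqVneq lL => // ->; rewrite (negbTE kL2).
under eq_integral do rewrite E.
rewrite ge0_integralZl_EFin //; last first.
  apply: emeasurable_funM => //; apply/measurable_EFinP; apply: measurable_indic.
  rewrite big_seq; apply: bigsetI_measurable => l; rewrite inE /B'.
  case: eqVneq => [_ _|_ /= lL]; first exact: mF (FA k n).
  by apply: mF; exact: FB.
  by move=> w _; rewrite mule_ge0 // lee_fin.
rewrite IH; last 2 first.
- by rewrite -(perm_catCA [:: k]) in pL *.
- move=> l; rewrite inE /B'; case: eqVneq => [-> _|_ /= lL]; first exact: FA.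
  exact: FB.
rewrite big_cons {1}/B' eqxx.
have -> : \prod_(l <- L2) P (B' l) = \prod_(l <- L2) P (B l).
  rewrite !big_seq; apply: eq_bigr => l lL.
  by rewrite /B'; case: eqVneq lL => // ->; rewrite (negbTE kL2).
by rewrite /C [RHS]muleC -!muleA; congr (_ * _); rewrite muleCA.
Qed.

End independent_products.

(** * Laplace functionals of Poisson processes *)
Lemma nat_nondecreasing_dichotomy (k : nat -> nat) :
  {homo k : m n / (m <= n)%N} ->
  (exists n, \forall N \near \oo, k N = n) \/
  (forall M, \forall N \near \oo, (M <= k N)%N).
Proof.
move=> hk; have [[M hM]|h] := pselect (exists M, forall N, (k N <= M)%N); last first.
  right => M; have [N hN] : exists N, (M <= k N)%N.
    apply: contrapT => /forallNP hN; apply: h; exists M => N.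
    by have := hN N; move=> /negP; rewrite -ltnNge => /ltnW.
  by exists N => // n /= Nn; exact: leq_trans hN (hk _ _ Nn).
left; pose Q n := `[< exists N, k N = n >].
have exQ : exists n, Q n by exists (k 0%N); apply/asboolP; exists 0%N.
have ubQ n : Q n -> (n <= M)%N by move=> /asboolP[N <-].
case: (ex_maxnP exQ ubQ) => n /asboolP[N kN] nmax.
exists n; exists N => // m /= Nm; apply/eqP; rewrite eqn_leq -{2}kN hk // andbT.
by apply: nmax; apply/asboolP; exists m.
Qed.

Section counting.
Local Open Scope ereal_scope.
Context dO (O : measurableType dO) (R : realType) (P : probability O R).
Variables (X : nat -> {RV P >-> R}).

Definition count_in (B : set R) (N : nat) (w : O) : nat :=
  (\sum_(i < N) (X i w \in B))%N.

Definition level_set (B : set R) (n : nat) : set O :=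
  [set w | point_process X B w = n%:R%:E].

(** [q] to the number of points in [B], with value [0] when there are
    infinitely many. *)
Definition power_count (q : R) (B : set R) (w : O) : \bar R :=
  \sum_(n <oo) (q ^+ n * \1_(level_set B n) w)%:E.

Let count_mono B w : {homo (count_in B) ^~ w : m n / (m <= n)%N}.
Proof.
move=> m n mn; rewrite /count_in -!(big_mkord xpredT (fun i => nat_of_bool (X i w \in B))).
by rewrite [leqRHS](big_cat_nat (n := m)) //= leq_addr.
Qed.

Lemma point_process_count B w :
  (fun N => (count_in B N w)%:R%:E : \bar R) @ \oo --> point_process X B w.
Proof.
have -> : (fun N => (count_in B N w)%:R%:E : \bar R) =
    (fun N => \sum_(0 <= i < N) \d_(X i w) B).
  apply/funext => N; rewrite /count_in natr_sum -sumEFin big_mkord.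
  by apply: eq_bigr => i _; rewrite diracE.
by apply: is_cvg_nneseries => n _ _.
Qed.

(** If the number of points in [B] is infinite, the powers tend to [0], the value
    of [power_count]. *)
Lemma power_count_cvg q B w : (0 <= q < 1)%R ->
  [/\ 0 <= power_count q B w, power_count q B w <= 1 &
  (fun N => (q ^+ count_in B N w)%R) @ \oo --> fine (power_count q B w)].
Proof.
move=> /andP[q0 q1].
have [[n hn]|hM] := nat_nondecreasing_dichotomy (count_mono B w).
  have ppE : point_process X B w = n%:R%:E.
    rewrite -(cvg_lim (@ereal_hausdorff R) (@point_process_count B w)).
    apply/cvg_lim => //; apply: cvg_near_cst.
    by apply: filterS hn => N ->.
  have -> : power_count q B w = (q ^+ n)%:E.
    rewrite /power_count (nneseriesD1 (n := n)) //; last first.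
      by move=> k _; rewrite lee_fin mulr_ge0 // exprn_ge0.
    rewrite eseries0 ?adde0; first by rewrite indicE mem_set // mulr1.
    move=> k _ /= kn; rewrite indicE memNset ?mulr0 // /level_set /= ppE => -[].
    by move/(mulrIn (oner_neq0 R))/esym => E; move: kn; rewrite E eqxx.
  split; rewrite ?lee_fin ?exprn_ge0 ?exprn_ile1 // ?ltW //.
  by apply: cvg_near_cst; apply: filterS hn => N ->.
have ppE : point_process X B w = +oo.
  rewrite -(cvg_lim (@ereal_hausdorff R) (@point_process_count B w)); apply/cvg_lim => //.
  apply/cvgeyPge => A; near=> N.
  rewrite lee_fin (@le_trans _ _ (Num.bound `|A|)%:R) //.
    by rewrite (le_trans (ler_norm _)) // ltW // archi_boundP.
  by rewrite ler_nat; near: N; exact: hM.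
have -> : power_count q B w = 0.
  rewrite /power_count eseries0 // => k _ _.
  by rewrite indicE memNset ?mulr0 // /level_set /= ppE.
split => //; apply/cvgrPdist_le => e e0.
have : (`|q| < 1)%R by rewrite ger0_norm.
move=> /cvg_expr /cvgrPdist_le /(_ e e0)[M _ hq].
apply: filterS (hM M) => N MN; exact: hq.
Unshelve. all: by end_near. Qed.

(** The generating function of the Poisson law. *)
Lemma poisson_power_series (q l : R) :
  \sum_(n <oo) ((q ^+ n)%:E * (l ^+ n / n`!%:R * expR (- l))%:E) =
  (expR (- ((1 - q) * l)))%:E.
Proof.
apply/cvg_lim => //.
have -> : (fun n => \sum_(0 <= i < n) (q ^+ i)%:E * (l ^+ i / i`!%:R * expR (- l))%:E) =
    (fun n => (expR (- l) * series (exp_coeff (q * l)) n)%R%:E).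
  apply/funext => n; rewrite /series /= mulr_sumr -sumEFin; apply: eq_bigr => i _.
  by rewrite -EFinM /exp_coeff /= exprMn; congr (_%:E); ring.
rewrite (_ : - ((1 - q) * l) = - l + q * l)%R; last by ring.
rewrite expRD; apply: cvg_EFin; first exact: nearW.
by apply: cvgMr; exact: is_cvg_series_exp_coeff.
Qed.

End counting.

Section independent_poisson.
Context dO (O : measurableType dO) (R : realType) (P : probability O R).
Variables (J : choiceType) (X : nat -> J -> {RV P >-> R}).
Variable Lambda : {measure set R -> \bar R}.
Hypothesis X_poisson : forall j, poisson_point_process (fun i => X i j) Lambda.
Hypothesis X_independent : mutually_independent P
  (fun j => sigma_of measurable (point_process (fun i => X i j))).

Local Notation pp j := (point_process (fun i => X i j)).

Lemma measurable_point_process j B : measurable B -> measurable_fun setT (pp j B).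
Proof.
move=> mB; apply: ge0_emeasurable_sum => // k _.
apply: (measurableT_comp (f := fun x : R => \d_x B : \bar R)) => //.
exact: measurable_fun_dirac.
Qed.

Let sigma_of_measurable j (D : set (set R)) A : D `<=` measurable ->
  sigma_of D (pp j) A -> measurable A.
Proof.
move=> DM; apply: smallest_sub; first exact: sigma_algebra_measurable.
move=> _ [B DB [C mC <-]]; exact: (measurable_point_process j (DM _ DB)).
Qed.

Let sigma_of_mono j (D D' : set (set R)) : D `<=` D' ->
  sigma_of D (pp j) `<=` sigma_of D' (pp j).
Proof.
move=> DD; apply: sub_smallest2r; first exact: smallest_sigma_algebra.
by apply: bigcup_sub => B /DD DB C hC; exists B.
Qed.

Let level_set_sigma j B n : sigma_of [set B] (pp j) (level_set (fun i => X i j) B n).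
Proof.
apply: sub_sigma_algebra; exists B => //; exists [set n%:R%:E].
  exact: emeasurable_set1.
by rewrite setTI.
Qed.

Variables (s : seq J) (r : J -> seq R) (h : J -> R -> R).
Hypotheses (us : uniq s) (ur : forall j, uniq (r j))
  (mh : forall j, measurable_fun setT (h j)).

Let cell (k : J * R) : set R := h k.1 @^-1` [set k.2].

Let mcell k : measurable (cell k).
Proof.
by have := mh k.1 measurableT (measurable_set1 k.2); rewrite setTI.
Qed.

Let F (k : J * R) := sigma_of [set cell k] (pp k.1).
Let L := [seq (j, v) | j <- s, v <- r j].

Let FM k A : F k A -> measurable A.
Proof. by apply: sigma_of_measurable => _ ->; exact: mcell. Qed.

Let product_rule_cells j (B : J * R -> set O) :
  (forall v, v \in r j -> F (j, v) (B (j, v))) ->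
  P (\big[setI/setT]_(v <- r j) B (j, v)) = (\prod_(v <- r j) P (B (j, v)))%E.
Proof.
move=> FB; have [_ _ ind] := X_poisson j.
pose C (k : 'I_(size (r j))) : set R := cell (j, tnth (in_tuple (r j)) k).
have tC : trivIset setT C.
  move=> k l _ _ [x [xk xl]]; apply: val_inj => /=.
  move: xk xl; rewrite /C /cell /= => -> /eqP.
  rewrite !(tnth_nth 0) /= nth_uniq //.
  by move/eqP.
have mC k : measurable (C k) by exact: mcell.
have := ind _ C mC tC (index_enum _) (fun k => B (j, tnth (in_tuple (r j)) k))
  (index_enum_uniq _).
rewrite (big_tnth _ _ (r j) xpredT (fun v => B (j, v))).
rewrite (big_tnth _ _ (r j) xpredT (fun v => P (B (j, v)))) => -> // k _.
by apply: FB; exact: mem_tnth.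
Qed.

Let product_rule (B : J * R -> set O) : (forall k, k \in L -> F k (B k)) ->
  P (\big[setI/setT]_(k <- L) B k) = (\prod_(k <- L) P (B k))%E.
Proof.
move=> FB; rewrite !big_allpairs_dep X_independent //.
  rewrite !big_seq; apply: eq_bigr => j js; apply: product_rule_cells => v vr.
  by apply: FB; apply/allpairsPdep; exists j, v.
move=> j js.
pose O' := g_sigma_algebraType (\bigcup_(B in measurable)
  preimage_set_system setT (pp j B) measurable).
suff : @measurable _ O' (\big[setI/setT]_(v <- r j) B (j, v)) by [].
rewrite big_seq; apply: bigsetI_measurable => v vr.
have : F (j, v) (B (j, v)) by apply: FB; apply/allpairsPdep; exists j, v.
by apply: sigma_of_mono => _ ->; exact: mcell.
Qed.

Variable l : J * R -> R.
Hypothesis Lambda_cell : forall k, k \in L -> Lambda (cell k) = (l k)%:E.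
Hypothesis r01 : forall j v, v \in r j -> 0 < v <= 1.

Let uL : uniq L.
Proof.
by apply: allpairs_uniq_dep => // -[j v] [j' v'] _ _ /= [-> ->].
Qed.

Let q (k : J * R) := if k \in L then 1 - k.2 else 0.

Let q01 k : 0 <= q k < 1.
Proof.
rewrite /q; case: ifPn => [/allpairsPdep[j [v [_ /r01 v01 ->]]]/=|_]; lra.
Qed.

(** The counts are independent across processes by hypothesis, and across the
    disjoint cells of one process because it is Poisson; the expectation is a
    product of generating functions. *)
Lemma laplace_power_counts :
  (\int[P]_w (\prod_(k <- L) fine (power_count (fun i => X i k.1) (q k) (cell k) w)))%R =
  expR (- \sum_(j <- s) \sum_(v <- r j) v * l (j, v)).
Proof.
pose a k n := q k ^+ n.
pose A k n := level_set (fun i => X i k.1) (cell k) n.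
have pc k w := power_count_cvg (fun i => X i k.1) (cell k) w (q01 k).
have fE k w : (\sum_(n <oo) (a k n * \1_(A k n) w)%:E)%E =
    power_count (fun i => X i k.1) (q k) (cell k) w by [].
have := @integral_prod_independent _ _ _ P _ F A a _ _ FM _ L uL product_rule.
rewrite /Rintegral => H.
have prodE w : (\prod_(k <- L) power_count (fun i => X i k.1) (q k) (cell k) w)%E =
   (\prod_(k <- L) fine (power_count (fun i => X i k.1) (q k) (cell k) w))%:E.
  rewrite -prodEFin; apply: eq_bigr => k _; rewrite fineK //.
  by have [p0 p1 _] := pc k w; rewrite ge0_fin_numE // (le_lt_trans p1) ?ltry.
under eq_integral do rewrite -prodE.
rewrite H; first last.
- by move=> k w; rewrite fE; case: (pc k w).
- by move=> k n; exact: level_set_sigma.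
- by move=> k n; rewrite exprn_ge0 //; case/andP: (q01 k).
rewrite big_seq (eq_bigr (fun k => (expR (- (k.2 * l k)))%:E)); last first.
  move=> k kL; rewrite -[RHS](_ : (expR (- ((1 - q k) * l k)))%:E = _); last first.
    by rewrite /q kL subKr.
  rewrite -poisson_power_series; apply: eq_eseriesr => n _; congr (_ * _)%E.
  by have [pois _ _] := X_poisson k.1; exact: (pois _ _ (mcell k) (Lambda_cell kL) n).
rewrite -big_seq prodEFin /= -expR_sum; congr expR.
by rewrite big_allpairs_dep /= -sumrN; apply: eq_bigr => j _; rewrite -sumrN.
Qed.

End independent_poisson.

Lemma cvg_prod_seq (R : realType) (I : Type) (s : seq I) (f : I -> nat -> R) (l : I -> R) :
  (forall i, f i @ \oo --> l i) ->
  (fun n => \prod_(i <- s) f i n) @ \oo --> \prod_(i <- s) l i.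
Proof.
move=> fl; elim: s => [|i s IH].
  by under eq_fun do rewrite big_nil; rewrite big_nil; exact: cvg_cst.
by under eq_fun do rewrite big_cons; rewrite big_cons; exact: cvgM.
Qed.

Lemma prod_itv01 (R : realType) (I : Type) (s : seq I) (f : I -> R) :
  (forall i, 0 <= f i <= 1) -> 0 <= \prod_(i <- s) f i <= 1.
Proof.
move=> f01; elim: s => [|i s /andP[p0 p1]]; first by rewrite big_nil ler01 lexx.
by have /andP[f0 f1] := f01 i; rewrite big_cons mulr_ge0 //= mulr_ile1.
Qed.

(** Exchange of two limits: [e <= q N <= q_ N n], and the right-hand side is close
    to [e] for a suitable [n] and all large [N]. *)
Lemma cvg_double_nonincreasing (R : realType) (q_ : nat -> nat -> R) (q e_ : nat -> R) (e : R) :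
  (forall n, q_ ^~ n @ \oo --> e_ n) -> e_ @ \oo --> e ->
  (forall N, q_ N @ \oo --> q N) -> (forall N n, q N <= q_ N n) ->
  (forall N n, e_ n <= q_ N n) -> (forall n, e <= e_ n) -> q @ \oo --> e.
Proof.
move=> qe ee qq qle ele le_e; apply/cvgrPdist_le => x x0.
have eq_ N : e <= q N.
  rewrite -(cvg_lim _ (qq N)) //; apply: limr_ge; first by apply/cvg_ex; exists (q N).
  by apply: nearW => n; exact: le_trans (le_e n) (ele N n).
have x2 : 0 < x / 2 by rewrite divr_gt0.
move/cvgrPdist_le/(_ _ x2) : ee => [n _ /(_ n (leqnn n)) hn].
move/cvgrPdist_le/(_ _ x2) : (qe n) => [M _ hM].
exists M => // N /hM /=; have := qle N n; have := eq_ N; have := le_e n; have := ele N n.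
move: hn => /=; rewrite !ler_norml; lra.
Qed.

Section laplace_functional.
Context dO (O : measurableType dO) (R : realType) (P : probability O R).
Variables (J : choiceType) (X : nat -> J -> {RV P >-> R}).
Variable Lambda : {measure set R -> \bar R}.
Hypothesis X_poisson : forall j, poisson_point_process (fun i => X i j) Lambda.
Hypothesis X_independent : mutually_independent P
  (fun j => sigma_of measurable (point_process (fun i => X i j))).
Variables (s : seq J) (us : uniq s).

(** If a point of the process [j] at [x] is removed with probability [h j x],
    independently of the others, this is the conditional probability, given the
    points, that none of the first [N] points of each process is removed. *)
Definition thinned (h : J -> R -> R) (N : nat) (w : O) : R :=
  \prod_(j <- s) \prod_(i < N) (1 - h j (X i j w)).

Lemma measurable_thinned h N : (forall j, measurable_fun setT (h j)) ->
  measurable_fun setT (thinned h N).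
Proof.
move=> mh; apply: measurable_prod => j _; apply: measurable_prod => i _.
by apply: measurable_funB => //; exact: measurableT_comp.
Qed.

Lemma thinned01 h N w : (forall j x, 0 <= h j x <= 1) -> 0 <= thinned h N w <= 1.
Proof.
move=> h01; apply: prod_itv01 => j; apply: prod_itv01 => i.
by have := h01 j (X i j w); lra.
Qed.

Let cells (h : {nnsfun R >-> R}) := [seq v <- (fset_set (range h) : seq R) | v != 0].

Let cellsP (h : {nnsfun R >-> R}) v : v \in cells h -> exists x, h x = v /\ 0 < v.
Proof.
rewrite mem_filter => /andP[v0 vh].
have : v \in fset_set (range h) by [].
rewrite in_fset_set // inE => -[x _ hx]; exists x; split => //.
by rewrite lt_neqAle eq_sym v0 -hx /=.
Qed.

Let cells_prod (h : {nnsfun R >-> R}) x :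
  1 - h x = \prod_(v <- cells h) (1 - v) ^+ (x \in h @^-1` [set v]).
Proof.
have uc : uniq (cells h) by rewrite filter_uniq // finmap.fset_uniq.
have in_cell v : (x \in h @^-1` [set v]) = (h x == v).
  by apply/idP/eqP => [|hv]; rewrite inE.
under eq_bigr do rewrite in_cell.
have [hx|hx] := boolP (h x \in cells h).
  rewrite (bigD1_seq (h x)) //= eqxx expr1 big1 ?mulr1 // => v.
  by rewrite eq_sym => /negbTE ->; rewrite expr0.
have hx0 : h x = 0.
  apply: contraNeq hx => hx; rewrite mem_filter hx /=.
  suff : h x \in fset_set (range h) by [].
  by rewrite in_fset_set // inE; exists x.
rewrite hx0 subr0 big_seq big1 // => v vh; have [y [_ v0]] := cellsP vh.
by rewrite lt_eqF // expr0.
Qed.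

(** For a simple function, [1 - h] is a product of powers of the [1 - v] over its
    values [v], the exponents being counts of points in disjoint cells. *)
Lemma laplace_simple (h : J -> {nnsfun R >-> R}) :
  (forall j x, h j x <= 1) -> (forall j, (\int[Lambda]_x (h j x)%:E < +oo)%E) ->
  (\int[P]_w thinned h N w)%R @[N --> \oo] -->
  expR (- \sum_(j <- s) fine (\int[Lambda]_x (h j x)%:E)%E).
Proof.
move=> h1 hfin.
pose r j := cells (h j).
have ur j : uniq (r j) by rewrite filter_uniq // finmap.fset_uniq.
pose cell (k : J * R) : set R := h k.1 @^-1` [set k.2].
have mcell k : measurable (cell k).
  have mh : measurable_fun setT (h k.1) by [].
  by have := mh measurableT _ (measurable_set1 k.2); rewrite setTI.
pose L := [seq (j, v) | j <- s, v <- r j].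
have intE j : (\int[Lambda]_x (h j x)%:E = \sum_(v <- r j) v%:E * Lambda (cell (j, v)))%E.
  rewrite integralT_nnsfun sintegralE fsbig_finite //= big_filter [RHS]big_mkcond /=.
  apply: eq_bigr => v _; case: eqVneq => //= ->; rewrite mul0e //.
have fin_cell j v : v \in r j -> Lambda (cell (j, v)) \is a fin_num.
  move=> vr; have [x [_ v0]] := cellsP vr; have := hfin j.
  rewrite intE (bigD1_seq v) //= => fin.
  have : (v%:E * Lambda (cell (j, v)) < +oo)%E.
    apply: le_lt_trans fin; rewrite leeDl //; apply: sume_ge0 => u _.
    exact: nnsfun_mulemu_ge0.
  rewrite ge0_fin_numE //; have := measure_ge0 Lambda (cell (j, v)).
  case: (Lambda (cell (j, v))) => [y| |] //=; rewrite ?ltry //.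
  by rewrite gt0_muley // lte_fin.
pose l (k : J * R) := fine (Lambda (cell k)).
have lE k : k \in L -> Lambda (cell k) = (l k)%:E.
  by move=> /allpairsPdep[j [v [_ vr ->]]]; rewrite /l fineK //; exact: fin_cell.
have r01 j v : v \in r j -> 0 < v <= 1.
  by move=> /cellsP[x [<- ->]]; rewrite h1.
have := laplace_power_counts X_poisson X_independent us ur (h := fun j => h j)
  (fun j => measurable_funPT (h j)) lE r01.
have -> : \sum_(j <- s) \sum_(v <- r j) v * l (j, v) =
    \sum_(j <- s) fine (\int[Lambda]_x (h j x)%:E)%E.
  apply: eq_bigr => j _; rewrite intE big_seq [in RHS]big_seq.
  rewrite (eq_bigr (fun v => (v * l (j, v))%:E)) ?sumEFin // => v vr.
  by rewrite EFinM /l fineK //; exact: fin_cell.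
move=> <-.
apply: (@Rdominated_cvg _ _ _ P _ _ (cst 1)).
- by move=> N; apply: measurable_thinned => j.
- move=> w.
  have -> : (fun N => thinned h N w) = (fun N => \prod_(k <- L)
     (if k \in L then 1 - k.2 else 0) ^+ count_in (fun i => X i k.1) (cell k) N w).
    apply/funext => N; rewrite [RHS]big_seq.
    rewrite (eq_bigr (fun k => (1 - k.2) ^+ count_in (fun i => X i k.1) (cell k) N w)); last first.
      by move=> k ->.
    rewrite -big_seq big_allpairs_dep /=; apply: eq_bigr => j _.
    rewrite (eq_bigr (fun i : 'I_N => \prod_(v <- cells (h j))
      (1 - v) ^+ (X i j w \in h j @^-1` [set v]))); last by move=> i _; exact: cells_prod.
    by rewrite exchange_big /=; apply: eq_bigr => v _; rewrite prodrXr.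
  apply: cvg_prod_seq => k.
  have k01 : 0 <= (if k \in L then 1 - k.2 else 0) < 1.
    by case: ifPn => [/allpairsPdep[j [v [_ /r01 v01 ->]]]/=|_]; lra.
  by have [_ _] := power_count_cvg (fun i => X i k.1) (cell k) w k01.
- exact: (finite_measure_integrable_cst P 1 measurableT).
- move=> N w; have /andP[t0 t1] : 0 <= thinned h N w <= 1.
    by apply: thinned01 => j x; rewrite h1 andbT.
  by rewrite ger0_norm.
Qed.

(** Approximating [h] from below by simple functions, the product decreases both
    in the number of points and along the approximation, so the limits can be
    exchanged. *)
Lemma laplace_poisson (h : J -> R -> R) :
  (forall j, measurable_fun setT (h j)) -> (forall j x, 0 <= h j x <= 1) ->
  (forall j, (\int[Lambda]_x (h j x)%:E < +oo)%E) ->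
  (\int[P]_w thinned h N w)%R @[N --> \oo] -->
  expR (- \sum_(j <- s) fine (\int[Lambda]_x (h j x)%:E)%E).
Proof.
move=> mh h01 hfin.
have mEh j : measurable_fun setT (EFin \o h j) by exact/measurable_EFinP.
have h0 j x : setT x -> (0 <= (EFin \o h j) x)%E by move=> _; rewrite lee_fin; have /andP[] := h01 j x.
pose a n j := nnsfun_approx measurableT (mEh j) n.
have a_cvg j x : (fun n => a n j x) @ \oo --> h j x.
  have := cvg_nnsfun_approx measurableT (mEh j) (h0 j) I (x := x).
  by move=> /fine_cvg.
have a_mono j x : {homo (fun n => a n j x) : m n / (m <= n)%N >-> m <= n}.
  by move=> m n mn; exact/lefP/nd_nnsfun_approx.
have a_le n j x : a n j x <= h j x.
  rewrite -(cvg_lim _ (a_cvg j x)) //; apply: nondecreasing_cvgn_le; first exact: a_mono.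
  by apply/cvg_ex; exists (h j x); exact: a_cvg.
have a01 n j x : 0 <= a n j x <= 1.
  by have /andP[_] := h01 j x; rewrite fun_ge0 /=; exact: le_trans.
have ma n j : measurable_fun setT (a n j : R -> R) by [].
have maE n j : measurable_fun [set: R] (EFin \o (a n j : R -> R)).
  exact: measurableT_comp (ma n j).
have int_le n j : (\int[Lambda]_x (a n j x)%:E <= \int[Lambda]_x (h j x)%:E)%E.
  apply: ge0_le_integral => //.
  - by move=> x _; rewrite lee_fin; have /andP[] := a01 n j x.
  - exact: maE.
  - exact: mEh.
  - by move=> x _; rewrite lee_fin.
have afin n j : (\int[Lambda]_x (a n j x)%:E < +oo)%E by exact: le_lt_trans (hfin j).
have ithin (g : J -> R -> R) : (forall j, measurable_fun setT (g j)) -> (forall j x, 0 <= g j x <= 1) ->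
    forall N, P.-integrable setT (EFin \o thinned g N).
  move=> mg g01 N.
  apply: (@integrable_bounded _ _ _ P _ 1); last first.
  - by move=> w; have /andP[t0 t1] := thinned01 N w g01; rewrite ger0_norm.
  - exact: measurable_thinned.
  - by apply: le_lt_trans (ltry 1); exact: probability_le1.
have thin_anti (g g' : J -> R -> R) N w : (forall j x, 0 <= g j x <= 1) -> (forall j x, 0 <= g' j x <= 1) ->
    (forall j x, g j x <= g' j x) -> thinned g' N w <= thinned g N w.
  move=> g01 g'01 gg; apply: ler_prod => j _; apply/andP; split.
    have : 0 <= \prod_(i < N) (1 - g' j (X i j w)) <= 1.
      by apply: prod_itv01 => i; have := g'01 j (X i j w); lra.
    by case/andP.
  apply: ler_prod => i _; have := g'01 j (X i j w); have := gg j (X i j w); lra.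
apply: (@cvg_double_nonincreasing _
  (fun N n => (\int[P]_w thinned (fun j => a n j) N w)%R) _
  (fun n => expR (- \sum_(j <- s) fine (\int[Lambda]_x (a n j x)%:E)%E))).
- move=> n; apply: laplace_simple => // j x; by case/andP: (a01 n j x).
- apply: continuous_cvg; first exact: continuous_expR.
  apply: cvgN; apply: cvg_big => [|j _]; first exact: add_continuous.
  apply: fine_cvg; rewrite fineK; last first.
    by rewrite ge0_fin_numE // integral_ge0 // => x _; exact: h0.
  rewrite (_ : (\int[Lambda]_x (h j x)%:E)%E =
      (\int[Lambda]_x limn (fun n => (a n j x)%:E))%E); last first.
    apply: eq_integral => x _; apply/esym/cvg_lim => //.
    exact: (cvg_nnsfun_approx measurableT (mEh j) (h0 j)).
  apply: cvg_monotone_convergence => //.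
  + by move=> n; exact: maE.
  + by move=> n x _; rewrite lee_fin.
  + by move=> x _ m n mn; rewrite lee_fin; exact: a_mono.
- move=> N; apply: (@Rdominated_cvg _ _ _ P _ _ (cst 1)).
  + by move=> n; apply: measurable_thinned.
  + move=> w; apply: cvg_prod_seq => j; apply: cvg_prod_seq => i.
    by apply: cvgB; [exact: cvg_cst|exact: a_cvg].
  + exact: (finite_measure_integrable_cst P 1 measurableT).
  + move=> n w; have /andP[t0 t1] := thinned01 N w (a01 n).
    by rewrite ger0_norm.
- move=> N n; apply: le_Rintegral => //; [exact: ithin|exact: ithin|].
  by move=> w _; exact: thin_anti.
- move=> N n.
  have anti : {homo (fun N => (\int[P]_w thinned (fun j => a n j) N w)%R) :
      m k / (m <= k)%N >-> k <= m}.
    move=> m k mk; apply: le_Rintegral => //; [exact: ithin|exact: ithin|].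
    move=> w _; apply: ler_prod => j _; apply/andP; split.
      have : 0 <= \prod_(i < k) (1 - a n j (X i j w)) <= 1.
        by apply: prod_itv01 => i; have := a01 n j (X i j w); lra.
      by case/andP.
    rewrite -!(big_mkord xpredT (fun i => 1 - a n j (X i j w))) [leLHS](big_cat_nat (n := m)) //=.
    have p1 : 0 <= \prod_(0 <= i < m) (1 - a n j (X i j w)) <= 1.
      by apply: prod_itv01 => i; have := a01 n j (X i j w); lra.
    have p2 : 0 <= \prod_(m <= i < k) (1 - a n j (X i j w)) <= 1.
      by apply: prod_itv01 => i; have := a01 n j (X i j w); lra.
    by case/andP: p1 => p10 p11; case/andP: p2 => p20 p21; rewrite ler_piMr.
  have cv := @laplace_simple (fun j => a n j) (fun j x => proj2 (andP (a01 n j x))) (afin n).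
  rewrite -(cvg_lim _ cv) //; apply: nonincreasing_cvgn_ge => //.
  by apply/cvg_ex; eexists; exact: cv.
- move=> n; rewrite ler_expR lerN2; apply: ler_sum => j _.
  apply: fine_le => //.
  + rewrite ge0_fin_numE //; apply: integral_ge0 => x _.
    by rewrite lee_fin; have /andP[] := a01 n j x.
  + by rewrite ge0_fin_numE // integral_ge0 // => x _; exact: h0.
Qed.

End laplace_functional.

(** * Independent marks *)
Section independent_law.
Local Open Scope ereal_scope.
Context dO (O : measurableType dO) (R : realType) (P : probability O R).
Context d1 (T1 : measurableType d1) d2 (T2 : measurableType d2).
Variables (X : {mfun O >-> T1}) (Y : {mfun O >-> T2}).
Hypothesis XY_independent : forall A B, measurable A -> measurable B ->
  P ((X @^-1` A) `&` (Y @^-1` B)) = P (X @^-1` A) * P (Y @^-1` B).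

Let XY w := (X w, Y w).

Let mXY : measurable_fun setT XY.
Proof. exact: measurable_fun_pair. Qed.

(** The joint law is the product measure, whose value on [D] is the integral of
    the measures of the sections. *)
Lemma independent_law (D : set (T1 * T2)) : measurable D ->
  P [set w | D (X w, Y w)] = \int[P]_w P [set w' | D (X w, Y w')].
Proof.
move=> mD.
have := @product_measure_unique _ _ _ _ R (distribution P X) (distribution P Y)
  (image_measure P mXY) XY_independent D mD.
rewrite image_measureE => <-; rewrite /product_measure1 /=.
rewrite ge0_integral_distribution //=; last exact: measurable_fun_xsection.
apply: eq_integral => w _ /=; rewrite /distribution /pushforward.
congr (P _); apply/seteqP; split => w'; rewrite /xsection /=.
  by rewrite inE.
by move=> h; rewrite inE.
Qed.

End independent_law.

Section independent_marks.
Context dO (O : measurableType dO) (R : realType) (P : probability O R).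
Variables (K : choiceType) (X Y : K -> O -> R) (FX FY : set (set O)).
Hypotheses (FX_sub : <<s FX >> `<=` measurable) (FY_sub : <<s FY >> `<=` measurable).
Hypothesis XY_independent : independent2 P <<s FX >> <<s FY >>.
Hypothesis FX_X : forall k B, measurable B -> <<s FX >> (X k @^-1` B).
Hypothesis FY_Y : forall k B, measurable B -> <<s FY >> (Y k @^-1` B).
Variables (phi : R -> R) (mphi : measurable_fun setT phi).
Hypothesis Y_rule : forall (L : seq K) (c : K -> R), uniq L ->
  P (\big[setI/setT]_(k <- L) [set w | Y k w <= c k]) =
  (\prod_(k <- L) P [set w | (Y k w <= c k)%R])%E.

Let packed (F : set (set O)) (L : seq K) (V : K -> O -> R) w :=
  [tuple V (tnth (in_tuple L) i) w | i < size L].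

Let packed_sigma F (L : seq K) V : (forall k B, measurable B -> <<s F >> (V k @^-1` B)) ->
  forall B, measurable B -> <<s F >> (packed F L V @^-1` B).
Proof.
move=> FV; suff : measurable_fun [set: g_sigma_algebraType F] (packed F L V).
  by move=> h B mB; have := h measurableT _ mB; rewrite setTI.
apply/measurable_fun_tnthP => i B mB; rewrite setTI.
have -> : ((@tnth _ _)^~ i \o packed F L V) = V (tnth (in_tuple L) i).
  by apply/funext => w; rewrite /= tnth_mktuple.
exact: FV.
Qed.

(** With the points held fixed, the marks have to satisfy fixed bounds, and the
    product rule for the marks applies. *)
Lemma independent_marks (L : seq K) : uniq L ->
  P [set w | forall k, k \in L -> Y k w <= phi (X k w)] =
  (\int[P]_w \prod_(k <- L) P [set w' | (Y k w' <= phi (X k w))%R])%E.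
Proof.
move=> uL; set n := size L.
have mpX : measurable_fun setT (packed FX L X).
  by move=> _ B mB; rewrite setTI; apply: FX_sub; exact: packed_sigma.
have mpY : measurable_fun setT (packed FY L Y).
  by move=> _ B mB; rewrite setTI; apply: FY_sub; exact: packed_sigma.
pose pX : {mfun O >-> n.-tuple R} := HB.pack (packed FX L X)
  (isMeasurableFun.Build _ _ _ _ _ mpX).
pose pY : {mfun O >-> n.-tuple R} := HB.pack (packed FY L Y)
  (isMeasurableFun.Build _ _ _ _ _ mpY).
pose D : set (n.-tuple R * n.-tuple R) :=
  [set xy | forall i : 'I_n, tnth xy.2 i <= phi (tnth xy.1 i)].
have mD : measurable D.
  have -> : D = \bigcap_(i in [set: 'I_n])
      [set xy | tnth xy.2 i <= phi (tnth xy.1 i)].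
    by apply/seteqP; split => [xy h i _|xy h i]; exact: h.
  apply: fin_bigcap_measurable; first exact: finite_finset.
  move=> i _; rewrite -[X in measurable X]setTI; apply: measurable_fun_le => //.
    exact: (measurableT_comp (measurable_tnth i) measurable_snd).
  apply: measurableT_comp mphi _.
  exact: (measurableT_comp (measurable_tnth i) measurable_fst).
have DE w w' : D (pX w, pY w') <-> forall k, k \in L -> Y k w' <= phi (X k w).
  split=> [h k kL|h i]; last first.
    by rewrite !tnth_mktuple; apply: h; exact: mem_tnth.
  have hk : (index k L < n)%N by rewrite index_mem.
  have := h (Ordinal hk); rewrite !tnth_mktuple (tnth_nth k) /= nth_index //.
have := @independent_law _ _ _ P _ _ _ _ pX pY _ D mD.
have -> : [set w | D (pX w, pY w)] = [set w | forall k, k \in L -> Y k w <= phi (X k w)].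
  by apply/seteqP; split => w /DE.
move=> ->; last first.
  by move=> A B mA mB; apply: XY_independent; exact: packed_sigma.
apply: eq_integral => w _; rewrite -Y_rule //; congr (P _).
rewrite -bigcap_seq; apply/seteqP; split => w'; first by move/DE.
by move=> h; apply/DE.
Qed.

End independent_marks.

(** * The exponential intensity *)
Section exponential_intensity.
Context (R : realType) (c : R) (c0 : 0 <= c).
Local Notation mu := (@lebesgue_measure R).

Lemma measurable_expRN : measurable_fun [set: R] (fun x => expR (- x)).
Proof. by apply: measurableT_comp => //; exact: measurable_expR. Qed.

Let density (x : measurableTypeR R) : R := c * expR (- x).

Let mdensity : measurable_fun setT density.
Proof. by apply: measurable_funM => //; exact: measurable_expRN. Qed.

Let density_ge0 x : 0 <= density x.
Proof. by rewrite mulr_ge0 // expR_ge0. Qed.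

Let mid : measurable_fun setT (id : measurableTypeR R -> R).
Proof. exact: measurable_id. Qed.

(** The function [exp_intensity c] as a measure. Lebesgue measure lives on another
    measurable structure of [R]; the image under the identity changes it. *)
Definition exp_measure : {measure set R -> \bar R} :=
  image_measure (density_measure mu mdensity density_ge0) mid.

Lemma ge0_integral_exp_measure (f : R -> \bar R) :
  measurable_fun setT f -> (forall x, (0 <= f x)%E) ->
  (\int[exp_measure]_x f x = \int[mu]_x (f x * (c * expR (- x))%:E))%E.
Proof.
move=> mf f0; rewrite ge0_integral_image_measure //.
exact: ge0_integral_density_measure.
Qed.

Let tail_integral (y : R) : 0 <= y ->
  (\int[mu]_x ((\1_[set x | (expR (- x) < y)%R] x * (c * expR (- x)))%:E) = (c * y)%:E)%E.
Proof.
rewrite le_eqVlt => /predU1P[<-|y0].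
  rewrite mulr0 integral0_eq // => x _; rewrite indicE memNset ?mul0r //=.
  by rewrite ltNge expR_ge0.
have tailE : [set x : R | (expR (- x) < y)%R] = `](- ln y)%R, +oo[%classic.
  apply/seteqP; split => x /=; have := ltr_expR (- x) (ln y);
    by rewrite lnK // in_itv /= andbT ltrNl => ->.
transitivity (\int[mu]_(x in `](- ln y)%R, +oo[) (c * expR (- x))%:E)%E.
  rewrite [RHS]integral_mkcond; apply: eq_integral => x _.
  rewrite patchE tailE indicE; case: (x \in _); first by rewrite mul1r.
  by rewrite mul0r.
rewrite integral_itv_obnd_cbnd; last first.
  by apply: measurable_funTS; apply/measurable_EFinP; exact: mdensity.
have dF (x : R) : is_derive x (1 : R) (fun x => - (c * expR (- x)) : R) (c * expR (- x)).
  by apply: is_derive_eq; rewrite /GRing.scale /= mulrN1 mulrN opprK.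
have cD : continuous (fun x : R => c * expR (- x)).
  by move=> x; apply: differentiable_continuous; apply/derivable1_diffP.
rewrite (@ge0_continuous_FTC2y _ _ (fun x : R => - (c * expR (- x))) _ 0) //.
- by rewrite !opprK lnK // -EFinB sub0r opprK.
- by move=> x _; rewrite mulr_ge0 // expR_ge0.
- exact: (continuous_subspaceT cD).
- rewrite -[0]oppr0 -[X in - X](mulr0 c); apply: cvgN; apply: cvgM; first exact: cvg_cst.
  exact: cvgr_expR.
- by apply: cvg_at_right_filter; apply: cvgN; exact: cD.
- by move=> x _; rewrite derive1E; exact: derive_val.
Qed.

Context dO (O : measurableType dO) (P : probability O R).

(** By Fubini: for a fixed value [y] of [Y] the condition is [- ln y < x], and the
    intensity of this half-line is [c * y]. *)
Lemma integral_exp_measure_tail (Y : O -> R) : measurable_fun setT Y -> (forall w, 0 <= Y w) ->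
  (\int[exp_measure]_x P [set w | (expR (- x) < Y w)%R] = c%:E * \int[P]_w (Y w)%:E)%E.
Proof.
move=> mY Y0.
pose D : set (measurableTypeR R * O) := [set xw | expR (- xw.1) < Y xw.2].
have mD : measurable D.
  have mlt : measurable_fun setT
      (fun xw : measurableTypeR R * O => expR (- xw.1) < Y xw.2).
    apply: measurable_fun_ltr.
      exact: (measurableT_comp measurable_expRN measurable_fst).
    exact: (measurableT_comp mY measurable_snd).
  rewrite -[D]setTI; exact: (mlt measurableT [set true] I).
pose f (xw : measurableTypeR R * O) : \bar R := (\1_D xw * (c * expR (- xw.1)))%:E.
have mf : measurable_fun setT f.
  apply/measurable_EFinP; apply: measurable_funM; first exact: measurable_indic.
  exact: (measurableT_comp mdensity measurable_fst).
have f0 xw : (0 <= f xw)%E by rewrite lee_fin mulr_ge0 // density_ge0.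
have PD_set x : [set w | expR (- x) < Y w] = xsection D x.
  by apply/seteqP; split => w; rewrite /xsection /= inE.
have PD x : P [set w | expR (- x) < Y w] = (P \o xsection D) x by rewrite PD_set.
rewrite ge0_integral_exp_measure //; last first.
  by under eq_fun do rewrite PD; exact: measurable_fun_xsection.
transitivity (\int[mu]_x \int[P]_w f (x, w))%E.
  apply: eq_integral => x _; pose A := [set w | expR (- x) < Y w].
  have mA : measurable A by rewrite /A PD_set; exact: measurable_xsection.
  rewrite -/A muleC -[in LHS](setIT A) -integral_indic // -ge0_integralZl_EFin //; first last.
  - exact: density_ge0.
  - by apply/measurable_EFinP; exact: measurable_indic.
  apply: eq_integral => w _; rewrite -EFinM mulrC /f; congr (_ * _)%:E.
rewrite fubini_tonelli //.
transitivity (\int[P]_w (c%:E * (Y w)%:E))%E; last first.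
  rewrite ge0_integralZl_EFin //; first by move=> w _; rewrite lee_fin.
  exact/measurable_EFinP.
apply: eq_integral => w _; rewrite -EFinM -tail_integral //.
Qed.

End exponential_intensity.

(** * Void probabilities *)
Definition enumerate (J : countType) (n : nat) : seq J := pmap (@choice.pickle_inv J) (iota 0 n).

Lemma enumerate_uniq (J : countType) n : uniq (enumerate J n).
Proof. by rewrite /enumerate (pmap_uniq (@choice.pickle_invK J)) ?iota_uniq. Qed.

Lemma mem_enumerate (J : countType) n (j : J) : (j \in enumerate J n) = (choice.pickle j < n)%N.
Proof.
rewrite mem_pmap; apply/mapP/idP => [[k]|jn].
  rewrite mem_iota /= add0n => kn /esym kj; have := @choice.pickle_invK J k.
  by rewrite kj /= => ->.
by exists (choice.pickle j); rewrite ?mem_iota ?add0n // choice.pickleK_inv.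
Qed.

Section void_event.
Context dO (O : measurableType dO) (R : realType) (P : probability O R).
Variables (J : countType) (X : nat -> J -> {RV P >-> R}) (Y : nat * J -> O -> R).
Hypothesis mY : forall k, measurable_fun setT (Y k).

(** The points with [exp (- X) < Y] are the exceedances; they are excluded for
    the pairs in [D]. *)
Definition void_event (D : set (nat * J)) : set O :=
  [set w | forall k, D k -> Y k w <= expR (- X k.1 k.2 w)].

Lemma measurable_void_event D : measurable (void_event D).
Proof.
have mk k : measurable [set w | Y k w <= expR (- X k.1 k.2 w)].
  rewrite -[X in measurable X]setTI; apply: measurable_fun_le => //.
  exact: measurableT_comp (@measurable_expRN R) _.
have -> : void_event D = \bigcap_n [set w | forall k, choice.pickle k = n -> D k ->
    Y k w <= expR (- X k.1 k.2 w)].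
  apply/seteqP; split => [w h n _ k _ Dk|w h k Dk]; first exact: h.
  exact: (h (choice.pickle k) I k).
apply: bigcapT_measurable => n; set A := [set w | _].
have [[k [kn Dk]]|no] := pselect (exists k, choice.pickle k = n /\ D k); last first.
  suff -> : A = setT by [].
  by apply/seteqP; split => // w _ k kn Dk; case: no; exists k.
suff -> : A = [set w | Y k w <= expR (- X k.1 k.2 w)] by [].
apply/seteqP; split => [w h|w h l ln _]; first exact: h.
by have -> : l = k by apply: (pcan_inj (@choice.pickleK _)); rewrite ln kn.
Qed.

End void_event.

Section void_probability.
Context dO (O : measurableType dO) (R : realType) (P : probability O R).
Variables (J : countType) (X : nat -> J -> {RV P >-> R}) (Y : nat * J -> O -> R).
Variables (c : R) (c0 : 0 <= c).
Hypothesis X_poisson : forall j, poisson_point_process (fun i => X i j) (exp_intensity c).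
Hypothesis X_independent : mutually_independent P
  (fun j => sigma_of measurable (point_process (fun i => X i j))).
Variables (FX FY : set (set O)) (F : nat * J -> set (set O)).
Hypotheses (FX_sub : <<s FX >> `<=` measurable) (FY_sub : <<s FY >> `<=` measurable).
Hypothesis XY_independent : independent2 P <<s FX >> <<s FY >>.
Hypothesis FX_X : forall i j B, measurable B -> <<s FX >> (X i j @^-1` B).
Hypothesis FY_Y : forall k B, measurable B -> <<s FY >> (Y k @^-1` B).
Hypothesis Y_independent : mutually_independent P F.
Hypothesis F_Y : forall k B, measurable B -> F k (Y k @^-1` B).
Hypothesis Y0 : forall k w, 0 <= Y k w.
Hypothesis Y_law : forall i j x,
  P [set w | (Y (i, j) w <= x)%R] = P [set w | (Y (0%N, j) w <= x)%R].
Variable EY : J -> R.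
Hypothesis Y_mean : forall j, (\int[P]_w (Y (0%N, j) w)%:E = (EY j)%:E)%E.

Let mY k : measurable_fun setT (Y k).
Proof. by move=> _ B mB; rewrite setTI; apply: FY_sub; exact: FY_Y. Qed.

Let measurable_void := measurable_void_event X mY.
Local Notation void_event := (void_event X Y).

Let void_cvg (D : nat -> set (nat * J)) (D' : set (nat * J)) :
  (forall n k, (n <= k)%N -> D n `<=` D k) -> D' = \bigcup_n D n ->
  (fun n => fine (P (void_event (D n)))) @ \oo --> fine (P (void_event D')).
Proof.
move=> mono ->.
have -> : void_event (\bigcup_n D n) = \bigcap_n void_event (D n).
  by apply/seteqP; split => [w h n _ k Dk|w h k [n _ Dk]]; [apply: h; exists n|exact: (h n)].
apply: fine_cvg; rewrite fineK ?fin_num_measure //; last exact: bigcapT_measurable.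
apply: nonincreasing_cvg_mu => //.
- by rewrite -ge0_fin_numE // fin_num_measure.
- exact: bigcapT_measurable.
- by move=> n k nk; apply/subsetPset => w h l Dl; apply: h; exact: mono Dl.
Qed.

Let h (j : J) (x : R) : R := fine (P [set w | (expR (- x) < Y (0%N, j) w)%R]).

Let mgt j x : measurable [set w | x < Y (0%N, j) w].
Proof.
have := mY (0%N, j) measurableT (measurable_itv `]x, +oo[); rewrite setTI.
by congr measurable; apply/seteqP; split => w /=; rewrite in_itv /= andbT.
Qed.

Let hE j x : (h j x)%:E = P [set w | (expR (- x) < Y (0%N, j) w)%R].
Proof. by rewrite fineK // fin_num_measure. Qed.

Let mh j : measurable_fun setT (h j).
Proof.
apply: nondecreasing_measurable => // x y xy.
apply: fine_le; rewrite ?fin_num_measure //; apply: le_measure; rewrite ?inE //.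
by move=> w /=; apply: le_lt_trans; rewrite ler_expR lerN2.
Qed.

Let h01 j x : 0 <= h j x <= 1.
Proof.
rewrite fine_ge0 //= -lee_fin hE; exact: probability_le1.
Qed.

Let h_compl i j x : P [set w | (Y (i, j) w <= expR (- x))%R] = (1 - h j x)%:E.
Proof.
rewrite Y_law EFinB hE -probability_setC //; congr (P _).
by apply/seteqP; split => w /=; rewrite leNgt => /negP.
Qed.

Let box (s : seq J) (N : nat) : set (nat * J) := [set k | (k.1 < N)%N /\ k.2 \in s].

Let void_box s N : uniq s ->
  fine (P (void_event (box s N))) = (\int[P]_w thinned X s h N w)%R.
Proof.
move=> us; rewrite /Rintegral; congr fine.
pose L := [seq (i, j) | j <- s, i <- iota 0 N].
have uL : uniq L.
  by apply: allpairs_uniq_dep => // [|[j i] [j' i'] _ _ /= [-> ->] //] j _; exact: iota_uniq.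
have -> : void_event (box s N) =
    [set w | forall k, k \in L -> Y k w <= expR (- X k.1 k.2 w)].
  apply/seteqP; split => w hw [i j] kL; apply: hw.
    move/allpairsPdep: kL => [j' [i' [js iN [-> ->]]]]; split => //=.
    by move: iN; rewrite mem_iota.
  by case: kL => /= iN js; apply/allpairsPdep; exists j, i; rewrite mem_iota.
rewrite (@independent_marks _ _ _ P _ (fun k => X k.1 k.2) Y FX FY FX_sub FY_sub
  XY_independent _ FY_Y _ (@measurable_expRN R)) //; last 2 first.
- by move=> k B mB; exact: FX_X.
- move=> L' c' uL'; rewrite Y_independent // => k _.
  exact: (F_Y k (measurable_itv `]-oo, c' k])).
apply: eq_integral => w _; rewrite /thinned big_allpairs_dep -prodEFin.
apply: eq_bigr => j _; rewrite -prodEFin -(big_mkord xpredT (fun i => (1 - h j (X i j w))%:E)).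
by rewrite /index_iota subn0; apply: eq_bigr => i _; exact: h_compl.
Qed.

Let void_list s : uniq s ->
  fine (P (void_event [set k | k.2 \in s])) = expR (- (c * \sum_(j <- s) EY j)).
Proof.
move=> us.
have hint j : (\int[exp_measure c0]_x (h j x)%:E = (c * EY j)%:E)%E.
  under eq_integral do rewrite hE.
  by rewrite integral_exp_measure_tail // EFinM -Y_mean.
have lap := @laplace_poisson _ _ _ P _ X (exp_measure c0) X_poisson X_independent s us h mh h01.
have {lap} := lap (fun j => eq_ind_r (fun x => x < +oo)%E (ltry _) (hint j)).
have -> : \sum_(j <- s) fine (\int[exp_measure c0]_x (h j x)%:E)%E = c * \sum_(j <- s) EY j.
  by rewrite mulr_sumr; apply: eq_bigr => j _; rewrite hint.
under eq_fun do rewrite -void_box //.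
move=> lap; rewrite -(cvg_lim _ lap) //; apply/esym/cvg_lim => //.
apply: void_cvg => [n k nk [i j] [iN js]|]; first by split => //; exact: leq_trans nk.
apply/seteqP; split => [[i j] js|[i j] [n _ []] //].
by exists i.+1.
Qed.

(** A point at [x] of the process [j] is an exceedance with probability
    [P (exp (- x) < Y)], whose integral against the intensity is [c * EY j]; the
    Laplace functional gives the result for finitely many processes, and
    continuity of [P] along an enumeration of [J] does the rest. *)
Lemma void_probability (S : R) :
  (fun n => \sum_(j <- enumerate J n) EY j) @ \oo --> S ->
  P (void_event setT) = (expR (- (c * S)))%:E.
Proof.
move=> ES.
rewrite -[LHS]fineK ?fin_num_measure //; congr (_%:E).
have cv : (fun n => fine (P (void_event [set k | k.2 \in enumerate J n]))) @ \oo -->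
    expR (- (c * S)).
  under eq_fun do rewrite void_list ?enumerate_uniq //.
  apply: continuous_cvg; first exact: continuous_expR.
  by apply: cvgN; apply: cvgM => //; exact: cvg_cst.
rewrite -(cvg_lim _ cv) //; apply/esym/cvg_lim => //.
apply: void_cvg => [n k nk [i j] /=|]; first by rewrite !mem_enumerate => jn; exact: leq_trans nk.
apply/seteqP; split => [[i j] _|//].
by exists (choice.pickle j).+1 => //=; rewrite mem_enumerate.
Qed.

End void_probability.

(** * The exponent of the finite-dimensional distributions *)
Section weighted_maximum.
Context (R : realType).

(** [exp (- z)], except that the constraint [y <= +oo] carries no weight. *)
Definition weight (z : \bar R) : R := if z is r%:E then expR (- r) else 0.

Lemma weight_ge0 z : 0 <= weight z.
Proof. by case: z => [r| |] //=; exact: expR_ge0. Qed.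

Lemma le_weight (x v : R) (z : \bar R) : (-oo < z)%E ->
  ((x + v)%:E <= z)%E = (weight z * expR v <= expR (- x)).
Proof.
case: z => [r| |] //= _; last by rewrite leey mul0r expR_ge0.
by rewrite lee_fin -expRD ler_expR; apply/idP/idP; lra.
Qed.

Variables (n : nat) (a : 'I_n -> R).
Hypothesis a0 : forall k, 0 <= a k.

Definition max_exp (v : 'I_n -> R) : R := \big[Num.max/0]_(k < n) (a k * expR (v k)).

Lemma max_exp_ge0 v : 0 <= max_exp v.
Proof. exact: bigmax_ge_id. Qed.

Lemma max_exp_le v x : 0 <= x -> max_exp v <= x <-> forall k, a k * expR (v k) <= x.
Proof.
move=> x0; split => [h k|h]; last by apply/bigmax_leP.
by move/bigmax_leP: h => [_]; exact.
Qed.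

Lemma max_exp_addc v c : max_exp (fun k => v k + c) = expR c * max_exp v.
Proof.
rewrite /max_exp (big_morph ( *%R (expR c)) (op1 := Num.max) (id1 := 0)) ?mulr0 //.
  by apply: eq_bigr => k _; rewrite expRD; ring.
by move=> x y; rewrite maxr_pMr ?expR_ge0.
Qed.

Lemma max_exp_le_sum v : max_exp v <= \sum_(k < n) a k * expR (v k).
Proof.
have p k : 0 <= a k * expR (v k) by rewrite mulr_ge0 ?expR_ge0.
apply/max_exp_le => [|k]; first by apply: sumr_ge0 => k _; exact: p.
by rewrite (bigD1 k) //= lerDl; apply: sumr_ge0 => l _; exact: p.
Qed.

Lemma measurable_max_exp d (T : measurableType d) (f : 'I_n -> T -> R) :
  (forall k, measurable_fun setT (f k)) ->
  measurable_fun setT (fun x => max_exp (fun k => f k x)).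
Proof.
move=> mf; rewrite /max_exp; elim: (index_enum _) => [|k s IH].
  by under eq_fun do rewrite big_nil; exact: measurable_cst.
under eq_fun do rewrite big_cons; apply: measurable_maxr => //.
by apply: measurable_funM => //; apply: measurableT_comp.
Qed.

Context (d : nat) (gamma : 'rV[R]_d -> R) (t : 'I_n -> 'rV[R]_d).

(** By [max_exp_addc] the maximum is [exp (V 0)] times the same function of the
    increments from [0]. *)
Let tilted_max_exp dO (O : measurableType dO) (P : probability O R)
    (W : 'rV[R]_d -> {RV P >-> R}) sigma2 :
  (\int[P]_w (max_exp (fun k => drifted W sigma2 (t k) w))%:E =
   \int[image_measure (tilt W sigma2 0) (measurable_increments W sigma2 t 0)]_x
     (max_exp (tnth x))%:E)%E.
Proof.
have mm : measurable_fun setT (fun x : n.-tuple R => (max_exp (tnth x))%:E).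
  by apply/measurable_EFinP; apply: measurable_max_exp => k; exact: measurable_tnth.
rewrite ge0_integral_image_measure //; last by move=> x; rewrite lee_fin max_exp_ge0.
rewrite (@ge0_integral_tilt _ _ _ _ _ W sigma2 0
  (fun w => (max_exp (tnth (increments W sigma2 t 0 w)))%:E)); last 2 first.
- by apply: measurableT_comp mm _; exact: measurable_increments.
- by move=> w; rewrite lee_fin max_exp_ge0.
apply: eq_integral => w _; rewrite -EFinM mulrC -max_exp_addc; congr (_%:E).
apply: eq_bigr => k _; congr (_ * expR _).
by rewrite tnth_mktuple addr0 subrK.
Qed.

(** The exponent measure of the finite-dimensional distributions: it depends on
    the field only through the variogram. *)
Lemma max_exp_mean dO (O : measurableType dO) (P : probability O R)
    (W : 'rV[R]_d -> {RV P >-> R}) sigma2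
    (Wg : gaussian_field W) (Wm : has_mean_zero W) (Ws : intrinsically_stationary W)
    (Wv : has_variogram W gamma) (Wr : has_variance W sigma2)
    dO' (O' : measurableType dO') (P' : probability O' R)
    (W' : 'rV[R]_d -> {RV P' >-> R}) sigma2'
    (Wg' : gaussian_field W') (Wm' : has_mean_zero W') (Ws' : intrinsically_stationary W')
    (Wv' : has_variogram W' gamma) (Wr' : has_variance W' sigma2') :
  (\int[P]_w (max_exp (fun k => drifted W sigma2 (t k) w))%:E =
   \int[P']_w (max_exp (fun k => drifted W' sigma2' (t k) w))%:E)%E.
Proof.
rewrite !tilted_max_exp; apply: eq_measure_integral => A mA _.
by rewrite !image_measureE; exact: (tilted_law Wg Wm Ws Wv Wr Wg' Wm' Ws' Wv' Wr').
Qed.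

Lemma max_exp_integrable dO (O : measurableType dO) (P : probability O R)
    (W : 'rV[R]_d -> {RV P >-> R}) sigma2
    (Wg : gaussian_field W) (Wm : has_mean_zero W) (Ws : intrinsically_stationary W)
    (Wv : has_variogram W gamma) (Wr : has_variance W sigma2) :
  P.-integrable setT (fun w => (max_exp (fun k => drifted W sigma2 (t k) w))%:E).
Proof.
have mexp k : measurable_fun setT (fun w => expR (drifted W sigma2 (t k) w)).
  by apply: measurableT_comp => //; exact: measurable_drifted.
have iexp k : P.-integrable setT (EFin \o (fun w => a k * expR (drifted W sigma2 (t k) w))).
  apply: integrableRZ; apply: integrable_ge0_finite => //.
  exact: (tilt_finite Wg Wm Ws Wv Wr (t k)).
have [isum _] := Rintegral_sum (index_enum _) iexp.
apply: le_integrable isum => //.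
  apply/measurable_EFinP; apply: measurable_max_exp => k; exact: measurable_drifted.
move=> w _; rewrite /= lee_fin !ger0_norm ?max_exp_ge0 //; first exact: max_exp_le_sum.
by apply: sumr_ge0 => k _; rewrite mulr_ge0 ?expR_ge0.
Qed.

End weighted_maximum.

(** * Laws of extended real tuples *)
Section extended_tuples.
Context (R : realType) (n : nat).
Implicit Types z : 'I_n -> \bar R.

Definition lower_box z : set (n.-tuple (\bar R)) := [set y | forall k, (tnth y k <= z k)%E].

Let measurable_lower_box z : measurable (lower_box z).
Proof.
have -> : lower_box z = \bigcap_(k in [set: 'I_n]) ((@tnth n (\bar R))^~ k @^-1` [set y | (y <= z k)%E]).
  by apply/seteqP; split => [y h k _|y h k]; exact: h.
apply: fin_bigcap_measurable; first exact: finite_finset.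
move=> k _; rewrite -[X in measurable X]setTI; apply: measurable_tnth => //.
rewrite (_ : [set y | _] = `]-oo, z k]%classic); first exact: emeasurable_itv.
by apply/seteqP; split => y /=; rewrite in_itv.
Qed.

(** The bounds [+oo] are allowed so that the whole space is a lower box and that
    single coordinates can be constrained. *)
Lemma etuple_measure_unique (m1 m2 : {measure set (n.-tuple (\bar R)) -> \bar R}) :
  (m1 setT < +oo)%E ->
  (forall z, (forall k, -oo < z k)%E -> m1 (lower_box z) = m2 (lower_box z)) ->
  forall A, measurable A -> m1 A = m2 A.
Proof.
move=> fin m12.
pose G : set (set (n.-tuple (\bar R))) :=
  [set B | exists z, (forall k, -oo < z k)%E /\ B = lower_box z].
apply: (measure_unique G (fun=> setT)) => //.
- apply/seteqP; split; last first.
    apply: smallest_sub; first exact: sigma_algebra_measurable.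
    by move=> _ [z [_ ->]]; exact: measurable_lower_box.
  suff mid : measurable_fun setT (id : g_sigma_algebraType G -> n.-tuple (\bar R)).
    by move=> B mB; have := mid measurableT B mB; rewrite setTI.
  apply/measurable_fun_tnthP => k.
  apply: (measurability (ErealGenOInfty.G (R := R))).
    exact: ErealGenOInfty.measurableE.
  move=> _ [_ [x ->] <-]; rewrite setTI.
  rewrite (_ : _ @^-1` _ = ~` lower_box (fun i => if i == k then x%:E else +oo%E)).
    apply: measurableC; apply: sub_sigma_algebra; eexists; split; last reflexivity.
    by move=> i /=; case: eqVneq => _; rewrite ?ltNyr.
  apply/seteqP; split => y /=.
    by rewrite in_itv /= andbT => xy /(_ k); rewrite eqxx leNgt xy.
  rewrite in_itv /= andbT => h; rewrite ltNge; apply/negP => yx; apply: h => i /=.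
  by case: eqVneq => [->//|_]; rewrite leey.
- move=> _ _ [z [z0 ->]] [z' [z'0 ->]]; exists (fun k => Order.min (z k) (z' k)); split.
    by move=> k; rewrite lt_min z0 z'0.
  apply/seteqP; split => y /=.
    by move=> [h h'] k; rewrite le_min h h'.
  by move=> h; split=> k; have := h k; rewrite le_min => /andP[].
- move=> _; exists (fun=> +oo%E); split => [k|]; first by [].
  by apply/seteqP; split => // y _ k; rewrite leey.
- by rewrite bigcup_const //; exists 0%N.
- by move=> _ [z [z0 ->]]; exact: m12.
Qed.

End extended_tuples.

Section lower_boxes.
Context (R : realType) (I : Type).

Definition measurable_lower_boxes d (O : measurableType d) (Y : I -> O -> \bar R) :=
  forall n (t : 'I_n -> I) (z : 'I_n -> \bar R), (forall k, -oo < z k)%E ->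
    measurable [set w | forall k, (Y (t k) w <= z k)%E].

Let measurable_coordinate d (O : measurableType d) (Y : I -> O -> \bar R) t :
  measurable_lower_boxes Y -> measurable_fun setT (Y t).
Proof.
move=> mY; apply: (measurability (ErealGenOInfty.G (R := R))).
  exact: ErealGenOInfty.measurableE.
move=> _ [_ [x ->] <-]; rewrite setTI.
rewrite (_ : _ @^-1` _ = ~` [set w | forall k : 'I_1, (Y t w <= x%:E)%E]).
  by apply/measurableC/(mY 1%N (fun=> t) (fun=> x%:E)) => k; exact: ltNyr.
apply/seteqP; split => w /=; rewrite in_itv /= andbT ltNge => h.
  by move/(_ ord0); apply/negP.
by apply/negP => yx; apply: h.
Qed.

Lemma eq_fdd_lower_boxes
    d1 (O1 : measurableType d1) (P1 : probability O1 R) (Y1 : I -> O1 -> \bar R)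
    d2 (O2 : measurableType d2) (P2 : probability O2 R) (Y2 : I -> O2 -> \bar R) :
  measurable_lower_boxes Y1 -> measurable_lower_boxes Y2 ->
  (forall n (t : 'I_n -> I) (z : 'I_n -> \bar R), (forall k, -oo < z k)%E ->
     P1 [set w | forall k, (Y1 (t k) w <= z k)%E] =
     P2 [set w | forall k, (Y2 (t k) w <= z k)%E]) ->
  eq_fdd P1 Y1 P2 Y2.
Proof.
move=> box1 box2 h.
have m1 t := measurable_coordinate t box1; have m2 t := measurable_coordinate t box2.
split => // n t B mB.
pose g1 w := [tuple Y1 (t k) w | k < n]; pose g2 w := [tuple Y2 (t k) w | k < n].
have mg1 : measurable_fun setT g1.
  apply/measurable_fun_tnthP => k; rewrite (_ : _ \o _ = Y1 (t k)) //.
  by apply/funext => w /=; rewrite tnth_mktuple.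
have mg2 : measurable_fun setT g2.
  apply/measurable_fun_tnthP => k; rewrite (_ : _ \o _ = Y2 (t k)) //.
  by apply/funext => w /=; rewrite tnth_mktuple.
apply: (@etuple_measure_unique _ _ (image_measure P1 mg1) (image_measure P2 mg2)) mB.
  rewrite image_measureE; apply: le_lt_trans (ltry 1).
  by apply: probability_le1; rewrite preimage_setT.
move=> z z0; rewrite !image_measureE.
have := h n t z z0; congr (_ = _); congr (_ _); apply/seteqP; split => w hw k.
- by rewrite tnth_mktuple; exact: hw.
- by have := hw k; rewrite tnth_mktuple.
- by rewrite tnth_mktuple; exact: hw.
- by have := hw k; rewrite tnth_mktuple.
Qed.

End lower_boxes.

(** * Marks of the restricted processes *)
Section lattice.
Context (R : realType) (d m : nat) (p : 'rV[R]_d).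
Hypothesis hp : forall l, 0 < p ord0 l.

(** In each coordinate the admissible integers are [m] consecutive ones. *)
Lemma lattice_count (s : 'rV[R]_d) : exists L : seq 'rV[int]_d,
  [/\ uniq L, size L = (m ^ d)%N &
   forall j, j \in L <-> half_open_box (m%:R *: p) (s - lattice_point p j)].
Proof.
pose a l : int := Num.ceil (s ord0 l / p ord0 l - m%:R / 2).
pose f (k : {ffun 'I_d -> 'I_m}) : 'rV[int]_d := \row_l (a l + (k l : nat)%:Z).
exists [seq f k | k <- enum {ffun 'I_d -> 'I_m}]; split.
- rewrite map_inj_uniq ?enum_uniq // => k k' /rowP kk; apply/ffunP => l.
  have := kk l; rewrite !mxE => /addrI [] kl; exact: val_inj.
- by rewrite size_map -cardE card_ffun !card_ord.
move=> j.
have boxE : half_open_box (m%:R *: p) (s - lattice_point p j) <->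
    forall l, (a l <= j ord0 l < a l + m%:Z).
  have coord l : (- ((m%:R *: p) ord0 l / 2) < (s - lattice_point p j) ord0 l <=
      (m%:R *: p) ord0 l / 2) = (a l <= j ord0 l < a l + m%:Z).
    have pl := hp l; have pe : p ord0 l != 0 by rewrite gt_eqF.
    have xp : (s ord0 l / p ord0 l - m%:R / 2) * p ord0 l = s ord0 l - m%:R * p ord0 l / 2.
      by field.
    have -> : (a l <= j ord0 l < a l + m%:Z) = (a l <= j ord0 l) && ~~ (a l <= j ord0 l - m%:Z).
      by rewrite lerBrDr -ltNge.
    rewrite andbC /a !mxE !Num.Theory.ceil_le_int -ltNge -[in RHS](ler_pM2r pl) -[in RHS](ltr_pM2r pl) !xp rmorphB /= -pmulrn.
    by congr (_ && _); apply/idP/idP; lra.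
  by split => h l; have := h l; rewrite coord.
split=> [/mapP[k _ jk]|/boxE h].
  by apply/boxE => l; rewrite jk mxE lerDl ltrD2l lez_nat ltz_nat ltn_ord.
have hk l : (`|j ord0 l - a l| < m)%N.
  have /andP[h1 h2] := h l; rewrite -ltz_nat gez0_abs ?subr_ge0 // ltrBlDl //.
apply/mapP; exists [ffun l => Ordinal (hk l)]; first by rewrite mem_enum.
apply/rowP => l; rewrite !mxE ffunE /= gez0_abs ?subr_ge0; last by case/andP: (h l).
by rewrite subrKC.
Qed.

Definition in_cell (s : 'rV[R]_d) (j : 'rV[int]_d) : R :=
  \1_(half_open_box (m%:R *: p)) (s - lattice_point p j).

Lemma lattice_sum s :
  (forall n, \sum_(j <- enumerate _ n) in_cell s j <= (m ^ d)%:R) /\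
  (fun n => \sum_(j <- enumerate _ n) in_cell s j) @ \oo --> ((m ^ d)%:R : R).
Proof.
have [L [uL sL LE]] := lattice_count s.
have sumE n : \sum_(j <- enumerate _ n) in_cell s j =
    (size [seq j <- enumerate _ n | j \in L])%:R.
  rewrite size_filter -sum1_count natr_sum [RHS]big_mkcond /=; apply: eq_bigr => j _.
  rewrite /in_cell indicE; have [jL|jL] := boolP (j \in L).
    by rewrite mem_set //; exact/LE.
  by rewrite memNset // => /LE; rewrite (negbTE jL).
have uf n : uniq [seq j <- enumerate 'rV[int]_d n | j \in L].
  by rewrite filter_uniq // enumerate_uniq.
split=> [n|].
  rewrite sumE ler_nat -sL uniq_leq_size // => j.
  by rewrite mem_filter => /andP[].
apply: cvg_near_cst; exists (\max_(j <- L) choice.pickle j).+1 => // n /= hn.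
rewrite sumE -sL; congr (_%:R); apply/perm_size/uniq_perm => // j.
rewrite mem_filter andb_idr // => jL; rewrite mem_enumerate.
by apply: leq_ltn_trans hn; exact: leq_bigmax_seq.
Qed.

End lattice.

Section marks.
Context (R : realType) (d m n : nat) (p : 'rV[R]_d) (a : 'I_n -> R) (t : 'I_n -> 'rV[R]_d).
Hypotheses (hp : forall l, 0 < p ord0 l) (a0 : forall k, 0 <= a k).

Local Notation box := (half_open_box (m%:R *: p)).

(** What a path of the process [j] contributes to the exponent: nothing if its
    smallest maximizer is outside the box. *)
Definition mark (j : 'rV[int]_d) (f : pathM R d) : R :=
  \1_box (inf_argsup (sval f)) * max_exp a (fun k => sval f (t k - lattice_point p j)).

Lemma mark_ge0 j f : 0 <= mark j f.
Proof. by rewrite mulr_ge0 // max_exp_ge0. Qed.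

Lemma measurable_mark j : measurable_fun setT (mark j).
Proof.
apply: measurable_funM.
  have mbox := @measurable_inf_argsup_in_box _ (pathM R d) R d (fun t f => sval f t)
    (@measurable_evaluation R d) (fun f => svalP f) (m%:R *: p).
  rewrite (_ : (fun f => _) = \1_[set f : pathM R d | box (inf_argsup (sval f))]).
    exact: measurable_indic.
  by apply/funext => f; rewrite !indicE; congr (nat_of_bool _)%:R; apply/idP/idP; rewrite !inE.
by apply: measurable_max_exp => k; exact: measurable_evaluation.
Qed.

Variables (gamma sigma2 : 'rV[R]_d -> R) (sigma2_cont : continuous sigma2).
Context dO (O : measurableType dO) (P : probability O R).
Variables (W : 'rV[R]_d -> {RV P >-> R}) (cW : sample_continuous W).
Hypotheses (Wg : gaussian_field W) (Wm : has_mean_zero W) (Ws : intrinsically_stationary W)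
  (Wv : has_variogram W gamma) (Wr : has_variance W sigma2).
Hypothesis W_limit : {ae P, forall w,
  tends_to_ninfty_at_infinity (fun t => W t w - sigma2 t / 2)}.

Local Notation V := (drifted W sigma2).
Let M w : R := max_exp a (fun k => V (t k) w).
Let A j w : R := \1_box (inf_argsup (fun s => V (s + lattice_point p j) w)).

Let iM : P.-integrable setT (EFin \o M).
Proof. exact: (max_exp_integrable a0 t Wg Wm Ws Wv Wr). Qed.

Let mM : measurable_fun setT M.
Proof. by apply: measurable_max_exp => k; exact: measurable_drifted. Qed.

Let mA j : measurable_fun setT (A j).
Proof.
have mbox := @measurable_inf_argsup_in_box _ O R d
  (fun s w => V (s + lattice_point p j) w)
  (fun s => measurable_drifted W sigma2 _)
  (@continuous_shifted _ _ _ sigma2_cont _ _ _ _ cW (lattice_point p j)) (m%:R *: p).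
rewrite (_ : A j = \1_[set w | box (inf_argsup (fun s => V (s + lattice_point p j) w))]).
  exact: measurable_indic.
by apply/funext => w; rewrite !indicE; congr (nat_of_bool _)%:R; apply/idP/idP; rewrite !inE.
Qed.

Let A01 j w : 0 <= A j w <= 1.
Proof. by rewrite /A indicE ler0n lern1 leq_b1. Qed.

(** The translation by [lattice_point p j] brings the points back to [t k] and
    moves the maximizer by the same vector. *)
Let mark_shift j :
  (\int[P]_w (mark j (drifted_path sigma2_cont cW w))%:E = \int[P]_w (A j w * M w)%:E)%E.
Proof.
have mH : measurable_fun setT (fun f => (mark j f)%:E).
  by apply/measurable_EFinP; exact: measurable_mark.
have HZ (f g : path R d) (c : R) : (forall s, sval g s = sval f s + c) ->
    (mark j g)%:E = ((expR c)%:E * (mark j f)%:E)%E.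
  move=> fg; rewrite -EFinM /mark /inf_argsup (argsup_addc fg) mulrCA -max_exp_addc.
  by congr (_ * _)%:E; apply: eq_bigr => k _; rewrite fg.
have := drifted_path_shift sigma2_cont cW Wg Wm Ws Wv Wr mH _ HZ 0 (lattice_point p j).
move=> /(_ _) h; rewrite -[RHS]/(\int[P]_w (A j w * M w)%:E)%E.
transitivity (\int[P]_w (mark j (shifted_path sigma2_cont cW 0 w))%:E)%E.
  apply: eq_integral => w _; congr (mark j _)%:E.
  apply: eq_exist; apply/funext => s /=; by rewrite addr0.
rewrite h; last by move=> f; rewrite lee_fin mark_ge0.
apply: eq_integral => w _; rewrite /mark /A /M /=; congr (_ * _)%:E.
by apply: eq_bigr => k _; rewrite /= subrK.
Qed.

(** The half-open box meets every translate of the lattice in [m ^ d] points,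
    which compensates the intensity of the Poisson processes. *)
Lemma mark_mean_sum :
  (forall j, P.-integrable setT (fun w => (mark j (drifted_path sigma2_cont cW w))%:E)) /\
  (fun N => \sum_(j <- enumerate _ N) (\int[P]_w mark j (drifted_path sigma2_cont cW w))%R)
    @ \oo --> (m ^ d)%:R * (\int[P]_w M w)%R.
Proof.
have [N [mN N0 NW]] := W_limit.
pose G := ~` N; have mG : measurable G by exact: measurableC.
have M0 w : 0 <= M w by exact: max_exp_ge0.
pose c := (m ^ d)%:R : R.
have AG w j : G w -> A j w = in_cell m p (inf_argsup (V ^~ w)) j.
  move=> Gw; rewrite /A /in_cell (@inf_argsup_shift _ _ (V ^~ w)) //.
  apply: lexi_min_argsup_exists; first exact: continuous_drifted.
  by apply: contrapT => h; apply: Gw; exact: NW.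
have aeG f : measurable_fun setT f -> (\int[P]_w (f w)%:E = \int[P]_w (f w * \1_G w)%:E)%E.
  move=> mf; apply: ae_eq_integral => //.
  - exact/measurable_EFinP.
  - by apply/measurable_EFinP; apply: measurable_funM => //; exact: measurable_indic.
  - exists N; split => // w /= /not_implyP[_ h]; apply: contrapT => Gw; apply: h.
    by rewrite indicE mem_set // mulr1.
have mAMG j : measurable_fun setT (fun w => A j w * M w * \1_G w).
  by apply: measurable_funM; [exact: measurable_funM|exact: measurable_indic].
have iAMG j : P.-integrable setT (EFin \o (fun w => A j w * M w * \1_G w)).
  apply: le_integrable iM => //; first exact/measurable_EFinP.
  move=> w _; rewrite /= lee_fin !normrM (ger0_norm (M0 w)) -mulrA mulrCA ler_piMr //.
  have /andP[A0 A1] := A01 j w; rewrite ger0_norm // mulr_ile1 //.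
  by rewrite indicE normr_nat lern1 leq_b1.
have E j : (\int[P]_w (mark j (drifted_path sigma2_cont cW w))%:E =
    \int[P]_w (A j w * M w * \1_G w)%:E)%E.
  by rewrite mark_shift aeG //; exact: measurable_funM.
split=> [j|].
  apply: (@integrable_ge0_finite _ _ _ P (fun w => mark j (drifted_path sigma2_cont cW w))).
  - by apply: measurableT_comp (measurable_mark j) _; exact: measurable_drifted_path.
  - by move=> w; exact: mark_ge0.
  - rewrite E; have /integrableP[_] := iAMG j; apply: le_lt_trans.
    rewrite le_eqVlt; apply/predU1P; left; apply: eq_integral => w _ /=.
    by rewrite ger0_norm // -mulrA; have /andP[A0 _] := A01 j w; rewrite !mulr_ge0.
have sumE N' : \sum_(j <- enumerate _ N') (\int[P]_w mark j (drifted_path sigma2_cont cW w))%R =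
    (\int[P]_w (\sum_(j <- enumerate _ N') A j w * M w * \1_G w))%R.
  have [_ ->] := Rintegral_sum (enumerate _ N') iAMG.
  by apply: eq_bigr => j _; rewrite /Rintegral E.
under eq_fun do rewrite sumE.
have -> : c * (\int[P]_w M w)%R = (\int[P]_w (c * M w * \1_G w))%R.
  rewrite -RintegralZl // /Rintegral aeG //; exact: measurable_funM.
have sumG w N' : G w -> \sum_(j <- enumerate _ N') A j w * M w * \1_G w =
    (\sum_(j <- enumerate _ N') in_cell m p (inf_argsup (V ^~ w)) j) * M w.
  move=> Gw; rewrite mulr_suml; apply: eq_bigr => j _.
  by rewrite AG // indicE mem_set // mulr1.
have sum0 w N' : ~ G w -> \sum_(j <- enumerate _ N') A j w * M w * \1_G w = 0.
  by move=> Gw; rewrite big1 // => j _; rewrite indicE memNset // mulr0.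
apply: (@Rdominated_cvg _ _ _ P _ _ (fun w => c * M w)).
- by move=> N'; apply: measurable_sum => j; exact: mAMG.
- move=> w; have [Gw|Gw] := pselect (G w).
    under eq_fun do rewrite sumG //; rewrite indicE mem_set // mulr1.
    by apply: cvgM; [have [] := lattice_sum m hp (inf_argsup (V ^~ w))|exact: cvg_cst].
  under eq_fun do rewrite sum0 //; rewrite indicE memNset // mulr0; exact: cvg_cst.
- exact: integrableRZ.
- move=> N' w; have [Gw|Gw] := pselect (G w); last first.
    by rewrite sum0 // normr0 mulr_ge0.
  have [le _] := lattice_sum m hp (inf_argsup (V ^~ w)).
  rewrite sumG // normrM (ger0_norm (M0 w)) ler_wpM2r // ger0_norm //.
  exact: sumr_ge0.
Qed.

End marks.

(** * The Brown-Resnick process *)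
Section sigma_of.
Context dO (O : measurableType dO) dE (E : measurableType dE).
Implicit Types K : Type.

(** The sample space with the sigma-algebra generated by [X]: events in
    [sigma_of] are then obtained from measurability of functions. *)
Definition sigma_of_type K (X : K -> O -> E) :=
  g_sigma_algebraType (\bigcup_(k in setT) preimage_set_system setT (X k) measurable).

Lemma measurable_sigma_of_type K (X : K -> O -> E) k :
  measurable_fun setT (X k : sigma_of_type X -> E).
Proof. by move=> _ B mB; apply: sub_sigma_algebra; exists k => //; exists B. Qed.

Lemma sigma_of_preimage K (X : K -> O -> E) d' (T : measurableType d') (g : O -> T) :
  measurable_fun setT (g : sigma_of_type X -> T) ->
  forall B, measurable B -> sigma_of setT X (g @^-1` B).
Proof. by move=> mg B mB; have := mg measurableT B mB; rewrite setTI. Qed.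

Lemma sigma_of_sub K K' (X : K -> O -> E) (X' : K' -> O -> E) (f : K -> K') :
  (forall k, X k = X' (f k)) -> sigma_of setT X `<=` sigma_of setT X'.
Proof.
move=> XX; apply: sub_smallest2r; first exact: smallest_sigma_algebra.
by move=> A [k _ XA]; exists (f k) => //; rewrite -XX.
Qed.

Lemma sigma_of_measurable K (X : K -> O -> E) : (forall k, measurable_fun setT (X k)) ->
  sigma_of setT X `<=` measurable.
Proof.
move=> mX; apply: smallest_sub; first exact: sigma_algebra_measurable.
by move=> _ [k _ [B mB <-]]; exact: mX.
Qed.

End sigma_of.

Section brown_resnick.
Context (R : realType) (d n : nat) dO (O : measurableType dO) (P : probability O R).
Variables (gamma : 'rV[R]_d -> R) (Z : 'rV[R]_d -> O -> \bar R).
Variables (X : nat -> {RV P >-> R}) (W : nat -> 'rV[R]_d -> {RV P >-> R}) (sigma2 : 'rV[R]_d -> R).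
Hypotheses (Wg : gaussian_field (W 0%N)) (Ws : intrinsically_stationary (W 0%N))
  (Wv : has_variogram (W 0%N) gamma) (Wm : has_mean_zero (W 0%N))
  (Wr : has_variance (W 0%N) sigma2).
Hypothesis W_copies : independent_copies (W 0%N) W.
Hypothesis X_poisson : poisson_point_process X (exp_intensity 1).
Hypothesis XW_independent : independent2 P (sigma_of setT (fun i => X i : O -> R))
  (sigma_of setT (fun it : nat * 'rV[R]_d => W it.1 it.2 : O -> R)).
Hypothesis ZE : forall t w,
  Z t w = ereal_sup (range (fun i => (X i w + W i t w - sigma2 t / 2)%:E)).
Variables (t : 'I_n -> 'rV[R]_d) (z : 'I_n -> \bar R) (z_gt : forall k, (-oo < z k)%E).

Let a k := weight (z k).
Let X' i (_ : unit) := X i.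
Let Y (k : nat * unit) w := max_exp a (fun l => drifted (W k.1) sigma2 (t l) w).

Let mY k : measurable_fun setT (Y k).
Proof. by apply: measurable_max_exp => l; exact: measurable_drifted. Qed.

Let eventE : [set w | forall k, (Z (t k) w <= z k)%E] = void_event X' Y setT.
Proof.
apply/seteqP; split => w h.
  move=> [i j] _; apply/max_exp_le => [|k]; first exact: expR_ge0.
  rewrite -le_weight // addrA; have := h k; rewrite ZE => /ereal_supP; apply.
  by exists i.
move=> k; rewrite ZE; apply/ereal_supP => _ [i _ <-].
have := h (i, tt) I; move/max_exp_le => /(_ (expR_ge0 _) k).
by rewrite -le_weight // addrA.
Qed.

Lemma brown_resnick_event_measurable : measurable [set w | forall k, (Z (t k) w <= z k)%E].
Proof. by rewrite eventE; exact: measurable_void_event. Qed.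

Let Y_law i (j : unit) x : P [set w | (Y (i, j) w <= x)%R] = P [set w | (Y (0%N, j) w <= x)%R].
Proof.
have [copies _] := W_copies; have [_ _ law] := copies i.
pose B := [set y : n.-tuple R | max_exp a (fun k => tnth y k - sigma2 (t k) / 2) <= x].
have mB : measurable B.
  have mg : measurable_fun setT (fun y : n.-tuple R =>
      max_exp a (fun k => tnth y k - sigma2 (t k) / 2)).
    by apply: measurable_max_exp => k; apply: measurable_funB => //; exact: measurable_tnth.
  have := mg measurableT _ (measurable_itv `]-oo, x]); rewrite setTI.
  by congr measurable; apply/seteqP; split => y /=; rewrite in_itv.
have BE i' : [set w | B [tuple W i' (t k) w | k < n]] = [set w | (Y (i', j) w <= x)%R].
  have e w : max_exp a (fun k => tnth [tuple W i' (t k) w | k < n] k - sigma2 (t k) / 2) =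
      Y (i', j) w by apply: eq_bigr => k _; rewrite tnth_mktuple.
  by apply/seteqP; split => w; rewrite /B /= e.
by rewrite -(BE i) -(BE 0%N); exact: law.
Qed.

(** A single Poisson process, so the index set of [void_probability] is [unit]. *)
Lemma brown_resnick_lower_box : P [set w | forall k, (Z (t k) w <= z k)%E] =
  (expR (- (\int[P]_w max_exp a (fun k => drifted (W 0%N) sigma2 (t k) w))%R))%:E.
Proof.
have [_ W_indep] := W_copies.
have iY := max_exp_integrable (fun k => weight_ge0 (z k)) t Wg Wm Ws Wv Wr.
have Y_mean (j : unit) : (\int[P]_w (Y (0%N, j) w)%:E =
    ((\int[P]_w max_exp a (fun k => drifted (W 0%N) sigma2 (t k) w))%R)%:E)%E.
  by rewrite /Rintegral fineK //; exact: integrable_fin_num iY.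
rewrite eventE -[X in expR (- X)]mul1r.
pose F (k : nat * unit) := sigma_of setT (fun s => W k.1 s : O -> R).
have F_Y k B : measurable B -> F k (Y k @^-1` B).
  apply: sigma_of_preimage; apply: measurable_max_exp => l; apply: measurable_funB => //.
  exact: (measurable_sigma_of_type (X := fun s => W k.1 s : O -> R)).
apply: (@void_probability _ _ _ P _ X' Y 1 ler01 _ _
  (\bigcup_(k in setT) preimage_set_system setT (X k : O -> R) measurable)
  (\bigcup_(k in setT) preimage_set_system setT
     (W k.1 k.2 : O -> R) measurable) F) => //.
- move=> s A us FA.
  case: s us {FA} => [|[] [|[] s]] //= _; last by rewrite !big_seq1.
  by rewrite !big_nil; exact: probability_setT.
- exact: sigma_of_measurable.
- exact: sigma_of_measurable.
- move=> i j B mB; apply: sigma_of_preimage => //.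
  exact: (measurable_sigma_of_type (X := fun i => X i : O -> R)).
- move=> k B mB; apply: (sigma_of_sub (f := fun s => (k.1, s))) (F_Y k B mB) => //.
- move=> s A us FA.
  have := W_indep (map fst s) (fun i => A (i, tt)).
  rewrite !big_map => h.
  rewrite (eq_bigr (fun k => A (k.1, tt))); last by move=> [i []].
  rewrite [RHS](eq_bigr (fun k => P (A (k.1, tt)))); last by move=> [i []].
  apply: h; first by rewrite map_inj_uniq // => -[i []] [i' []] /= ->.
  by move=> _ /mapP[[i []] ks ->]; exact: FA.
- by move=> k w; exact: max_exp_ge0.
- exact: Y_mean.
- apply: cvg_near_cst; exists (choice.pickle tt).+1 => // N /= hN.
  rewrite (bigD1_seq tt) ?mem_enumerate ?enumerate_uniq //= big1 ?addr0 //.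
Qed.

End brown_resnick.

(** * The maximum over the restricted processes *)
Section thinned_maximum.
Context (R : realType) (d n : nat) d0 (O0 : measurableType d0) (P0 : probability O0 R).
Variables (W : 'rV[R]_d -> {RV P0 >-> R}) (gamma sigma2 : 'rV[R]_d -> R).
Hypotheses (W_continuous : sample_continuous W) (Ws : intrinsically_stationary W)
  (Wg : gaussian_field W) (Wv : has_variogram W gamma) (Wm : has_mean_zero W)
  (Wr : has_variance W sigma2).
Hypothesis W_limit : {ae P0, forall w,
  tends_to_ninfty_at_infinity (fun t => W t w - sigma2 t / 2)}.
Context dO (O : measurableType dO) (P : probability O R).
Variable Wc : nat -> 'rV[int]_d -> 'rV[R]_d -> {RV P >-> R}.
Hypothesis Wc_continuous : forall i j, sample_continuous (Wc i j).
Hypothesis Wc_copies : independent_copies W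
  (fun ij : nat * 'rV[int]_d => Wc ij.1 ij.2).
Variables (m : nat) (hm : (0 < m)%N) (p : 'rV[R]_d) (hp : forall l, 0 < p ord0 l).
Variable X : nat -> 'rV[int]_d -> {RV P >-> R}.
Hypothesis X_poisson : forall j, poisson_point_process (fun i => X i j)
  (exp_intensity ((m%:R ^+ d)^-1)).
Hypothesis X_independent : mutually_independent P (fun j : 'rV[int]_d =>
  sigma_of measurable (point_process (fun i => X i j))).
Hypothesis XW_independent : independent2 P
  (sigma_of setT (fun ij : nat * 'rV[int]_d => X ij.1 ij.2 : O -> R))
  (sigma_of setT (fun ijt : nat * 'rV[int]_d * 'rV[R]_d =>
     Wc ijt.1.1 ijt.1.2 ijt.2 : O -> R)).
Variables (t : 'I_n -> 'rV[R]_d) (z : 'I_n -> \bar R) (z_gt : forall k, (-oo < z k)%E).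

Let sigma2_cont : continuous sigma2 := variance_continuous Wg Wm Wr W_continuous.
Let a k := weight (z k).
Let a0 k : 0 <= a k := weight_ge0 (z k).
Let path_of (k : nat * 'rV[int]_d) : O -> pathM R d :=
  drifted_path sigma2_cont (@Wc_continuous k.1 k.2).
Let Y (k : nat * 'rV[int]_d) w := mark m p a t k.2 (path_of k w).

Let mY k : measurable_fun setT (Y k).
Proof.
by apply: measurableT_comp (measurable_mark _ _ _ _ _) _; exact: measurable_drifted_path.
Qed.

Let eventE : [set w | forall k, (Z3 sigma2 m p X Wc (t k) w <= z k)%E] =
  void_event X Y setT.
Proof.
apply/seteqP; split => w h.
  move=> [i j] _; rewrite /Y /mark indicE.
  case: (boolP (_ \in _)) => [Tij|_]; last by rewrite mul0r expR_ge0.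
  rewrite mul1r; apply/max_exp_le => [|k]; first exact: expR_ge0.
  rewrite -le_weight // addrA; have /ereal_supP := h k; apply.
  by exists i, j.
move=> k; apply/ereal_supP => _ [i [j [Tij ->]]].
have := h (i, j) I; rewrite /Y /mark indicE mem_set; last exact: set_mem Tij.
rewrite mul1r; move/max_exp_le => /(_ (expR_ge0 _) k).
by rewrite -le_weight // addrA.
Qed.

Lemma thinned_event_measurable :
  measurable [set w | forall k, (Z3 sigma2 m p X Wc (t k) w <= z k)%E].
Proof. by rewrite eventE; exact: measurable_void_event. Qed.

Let same_law i j A : measurable A ->
  P (path_of (i, j) @^-1` A) = P0 (drifted_path sigma2_cont W_continuous @^-1` A).
Proof.
have [copies _] := Wc_copies; apply: drifted_path_law; exact: copies (i, j).
Qed.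

(** The marks are functions of the paths, so their laws and their independence
    come from those of the copies of [W]; the factor [m ^ d] of
    [mark_mean_sum] cancels the intensity. *)
Lemma thinned_lower_box : P [set w | forall k, (Z3 sigma2 m p X Wc (t k) w <= z k)%E] =
  (expR (- (\int[P0]_w max_exp a (fun k => drifted W sigma2 (t k) w))%R))%:E.
Proof.
have [_ Wc_indep] := Wc_copies.
have md : (m%:R ^+ d : R) != 0 by rewrite expf_neq0 // pnatr_eq0 -lt0n.
have [iY sumY] := mark_mean_sum m t hp a0 sigma2_cont W_continuous Wg Wm Ws Wv Wr W_limit.
set I0 := (X in expR (- X)).
have -> : I0 = (m%:R ^+ d)^-1 * ((m ^ d)%:R * I0) by rewrite natrX mulKf.
rewrite eventE.
pose F (k : nat * 'rV[int]_d) := sigma_of setT (fun s => Wc k.1 k.2 s : O -> R).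
have F_Y k B : measurable B -> F k (Y k @^-1` B).
  move=> mB; have := measurable_mark m p a t k.2 measurableT mB; rewrite setTI => mA.
  exact: (drifted_path_sigma_of sigma2_cont (@Wc_continuous k.1 k.2) mA).
have c0 : 0 <= (m%:R ^+ d : R)^-1 by rewrite invr_ge0 exprn_ge0.
apply: (@void_probability _ _ _ P _ X Y _ c0 X_poisson X_independent
  (\bigcup_(k in setT) preimage_set_system setT (X k.1 k.2 : O -> R) measurable)
  (\bigcup_(k in setT) preimage_set_system setT
     (Wc k.1.1 k.1.2 k.2 : O -> R) measurable) F) => //.
- exact: sigma_of_measurable.
- exact: sigma_of_measurable.
- move=> i j B mB; apply: sigma_of_preimage => //.
  exact: (measurable_sigma_of_type (X := fun ij : nat * 'rV[int]_d => X ij.1 ij.2 : O -> R) (i, j)).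
- move=> k B mB; apply: (sigma_of_sub (f := fun s => (k, s))) (F_Y k B mB) => //.
- by move=> k w; exact: mark_ge0.
- move=> i j x.
  have mB : measurable [set f : pathM R d | mark m p a t j f <= x].
    have := measurable_mark m p a t j measurableT (measurable_itv `]-oo, x]); rewrite setTI.
    by congr measurable; apply/seteqP; split => y /=; rewrite in_itv.
  by rewrite [LHS](same_law i j mB) [RHS](same_law 0%N j mB).
- move=> j.
  transitivity (\int[P0]_w (mark m p a t j (drifted_path sigma2_cont W_continuous w))%:E)%E.
    have mE : measurable_fun setT (fun f => (mark m p a t j f)%:E).
      by apply/measurable_EFinP; exact: measurable_mark.
    have E0 f : (0 <= (mark m p a t j f)%:E)%E by rewrite lee_fin mark_ge0.
    have im0 := ge0_integral_image_measure P0
      (measurable_drifted_path sigma2_cont W_continuous) mE E0.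
    have im := ge0_integral_image_measure P
      (measurable_drifted_path sigma2_cont (@Wc_continuous 0%N j)) mE E0.
    apply: eq_trans (esym im) (eq_trans _ im0).
    by apply: eq_measure_integral => A mA _; rewrite !image_measureE; exact: same_law.
  by rewrite -[LHS]fineK; [reflexivity|exact: integrable_fin_num (iY j)].
- exact: sumY.
Qed.

End thinned_maximum.

Theorem mainTheorem4 (R : realType) (d : nat) (hd : (0 < d)%N)
    (d0 : measure_display) (O0 : measurableType d0) (P0 : probability O0 R)
    (W : 'rV[R]_d -> {RV P0 >-> R})
    (gamma sigma2 : 'rV[R]_d -> R)
    (W_continuous : sample_continuous W)
    (W_stationary : intrinsically_stationary W)
    (W_gaussian : gaussian_field W)
    (W_variogram : has_variogram W gamma)
    (W_mean : has_mean_zero W)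
    (W_variance : has_variance W sigma2)
    (W_limit : {ae P0, forall w,
       tends_to_ninfty_at_infinity (fun t => W t w - sigma2 t / 2)})
    (d1 : measure_display) (O1 : measurableType d1) (P : probability O1 R)
    (Wc : nat -> 'rV[int]_d -> 'rV[R]_d -> {RV P >-> R})
    (Wc_continuous : forall i j, sample_continuous (Wc i j))
    (Wc_copies : independent_copies W
       (fun ij : nat * 'rV[int]_d => Wc ij.1 ij.2))
    (m : nat) (hm : (0 < m)%N)
    (p : 'rV[R]_d) (hp : forall l, 0 < p ord0 l)
    (X : nat -> 'rV[int]_d -> {RV P >-> R})
    (X_poisson : forall j, poisson_point_process (fun i => X i j)
       (exp_intensity ((m%:R ^+ d)^-1)))
    (X_independent : mutually_independent P (fun j : 'rV[int]_d =>
       sigma_of measurable (point_process (fun i => X i j))))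
    (X_W_independent : independent2 P
       (sigma_of setT (fun ij : nat * 'rV[int]_d => X ij.1 ij.2 : O1 -> R))
       (sigma_of setT (fun ijt : nat * 'rV[int]_d * 'rV[R]_d =>
          Wc ijt.1.1 ijt.1.2 ijt.2 : O1 -> R)))
    (d2 : measure_display) (O2 : measurableType d2) (P' : probability O2 R)
    (Z : 'rV[R]_d -> O2 -> \bar R)
    (Z_brown_resnick : brown_resnick_process gamma P' Z) :
  eq_fdd P (Z3 sigma2 m p X Wc) P' Z.
Proof.
have [Xz [Wz [s2 [[Wzg Wzs Wzv Wzm Wzr] copies Xz_poisson XWz ZE]]]] := Z_brown_resnick.
apply: eq_fdd_lower_boxes => [n t z z_gt|n t z z_gt|n t z z_gt].
- exact: (thinned_event_measurable W_continuous W_gaussian W_mean W_variance Wc_continuous).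
- exact: (brown_resnick_event_measurable ZE).
rewrite (thinned_lower_box W_continuous W_stationary W_gaussian W_variogram W_mean W_variance
  W_limit Wc_continuous Wc_copies hm hp X_poisson X_independent X_W_independent) //.
rewrite (brown_resnick_lower_box Wzg Wzs Wzv Wzm Wzr copies Xz_poisson XWz ZE) //.
congr (expR (- _))%:E; rewrite /Rintegral; congr fine.
exact: (max_exp_mean _ _ W_gaussian W_mean W_stationary W_variogram W_variance
  Wzg Wzm Wzs Wzv Wzr).
Qed.
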